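(* (a) Let $0<\omega<\pi/2$. For every deterministic adaptive probing strategy that correctly determines every convex polygon all of whose internal angles are strictly larger than $\omega$, and for every integer $n\ge 5$, there exist a convex polygon $\mathcal{O}$ with $n$ vertices, all internal angles strictly larger than $\omega$, a point $p\in\mathcal{O}$ and a circle $\Psi$ enclosing $\mathcal{O}$, such that the strategy, run on $\mathcal{O}$ with data $p,\Psi$, makes at least $2n-2$ $\omega$-probes. (b) The same holds for $\omega=\pi/2$ with $2n-3$ in place of $2n-2$.
   Context: An $\omega$-wedge $\mathcal{W}(\omega,q,H_1,H_2)$ is the closed region formed by a point $q$ (the apex), two rays $H_1,H_2$ emanating from $q$ with angle $\omega$ between them such that $H_2$ is obtained from $H_1$ by a counterclockwise rotation by $\omega$, and all points between them. A valid $\omega$-probe of a convex polygon $\mathcal{O}$ with respect to a directed line $\overrightarrow{L}$ is an $\omega$-wedge containing $\mathcal{O}$, each of whose rays contains at least one point of $\mathcal{O}$, whose apex $q$ lies on $\overrightarrow{L}$, and such that the ray from $q$ in the direction of $\overrightarrow{L}$ intersects $\mathcal{O}$. Probing model: $\mathcal{O}$ is unknown to the prober, who knows only a point $p\in\mathcal{O}$ and a circle $\Psi$ with $\mathcal{O}$ contained in the disk bounded by $\Psi$ (the number $n$ of vertices is not known). One $\omega$-probe consists of the prober choosing a directed line $\overrightarrow{L}$; if a valid $\omega$-probe of $\mathcal{O}$ with respect to $\overrightarrow{L}$ exists, the prober receives its apex $q$, its rays $H_1,H_2$, and the points $p_1\in\mathcal{O}\cap H_1$, $p_2\in\mathcal{O}\cap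 H_2$ closest to $q$; otherwise the prober is told only that the probe missed $\mathcal{O}$. A strategy is adaptive: each chosen line may depend on all previous outcomes; it is deterministic and must output exactly $\mathcal{O}$ after its last probe. *)

(* Defs.v *)
From Stdlib Require Import Reals Lra List.
Import ListNotations.
Open Scope R_scope.

Definition pt : Type := (R * R)%type.
Definition padd (x y : pt) : pt := (fst x + fst y, snd x + snd y).
Definition psub (x y : pt) : pt := (fst x - fst y, snd x - snd y).
Definition pscale (s : R) (x : pt) : pt := (s * fst x, s * snd x).
Definition dot (x y : pt) : R := fst x * fst y + snd x * snd y.
Definition cross (x y : pt) : R := fst x * snd y - snd x * fst y.
Definition norm (x : pt) : R := sqrt (dot x x).
Definition dist (x y : pt) : R := norm (psub x y).
Definition rot (w : R) (u : pt) : pt :=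
  (cos w * fst u - sin w * snd u, sin w * fst u + cos w * snd u).

Fixpoint wsum (ws : list R) (vs : list pt) : pt :=
  match ws, vs with
  | w :: ws', v :: vs' => padd (pscale w v) (wsum ws' vs')
  | _, _ => (0, 0)
  end.
Definition in_hull (vs : list pt) (x : pt) : Prop :=
  exists ws : list R,
    length ws = length vs /\ Forall (fun w => 0 <= w) ws /\
    fold_right Rplus 0 ws = 1 /\ x = wsum ws vs.

Definition vtx (vs : list pt) (i : nat) : pt := nth (i mod length vs) vs (0, 0).

(** [vs] lists the vertices of a convex polygon with [length vs] vertices in
    counterclockwise order: every vertex other than the endpoints of an edge
    lies strictly to the left of that (directed) edge. *)
Definition convex_polygon (vs : list pt) : Prop :=
  (3 <= length vs)%nat /\
  forall i j, (i < length vs)%nat -> (j < length vs)%nat ->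
    j <> i -> j <> ((i + 1) mod length vs)%nat ->
    0 < cross (psub (vtx vs (i + 1)) (vtx vs i)) (psub (vtx vs j) (vtx vs i)).

Definition internal_angle (vs : list pt) (i : nat) : R :=
  let a := psub (vtx vs (i + length vs - 1)) (vtx vs i) in
  let b := psub (vtx vs (i + 1)) (vtx vs i) in
  acos (dot a b / (norm a * norm b)).

Definition angles_gt (w : R) (vs : list pt) : Prop :=
  forall i, (i < length vs)%nat -> w < internal_angle vs i.

Definition encloses (c : pt) (rho : R) (O : pt -> Prop) : Prop :=
  0 < rho /\ forall x, O x -> dist x c <= rho.

Definition on_ray (q u x : pt) : Prop := exists s, 0 <= s /\ x = padd q (pscale s u).
Definition in_wedge (w : R) (q u x : pt) : Prop :=
  exists s t, 0 <= s /\ 0 <= t /\ x = padd q (padd (pscale s u) (pscale t (rot w u))).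

Definition valid_probe (w : R) (O : pt -> Prop) (a d q u : pt) : Prop :=
  norm u = 1 /\
  (exists lam, q = padd a (pscale lam d)) /\
  (forall x, O x -> in_wedge w q u x) /\
  (exists x, O x /\ on_ray q u x) /\
  (exists x, O x /\ on_ray q (rot w u) x) /\
  (exists s, 0 <= s /\ O (padd q (pscale s d))).

Definition closest_on_ray (O : pt -> Prop) (q v x : pt) : Prop :=
  O x /\ on_ray q v x /\ forall y, O y -> on_ray q v y -> dist q x <= dist q y.

Inductive response : Type :=
  | Miss
  | Hit (q u p1 p2 : pt).

Definition probe_answer (w : R) (O : pt -> Prop) (a d : pt) (r : response) : Prop :=
  match r with
  | Miss => forall q u, ~ valid_probe w O a d q u
  | Hit q u p1 p2 =>
      valid_probe w O a d q u /\ closest_on_ray O q u p1 /\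
      closest_on_ray O q (rot w u) p2
  end.

(** A deterministic adaptive strategy: given p, the circle (center, radius)
    and the history of (line, answer) pairs, it either probes with a directed
    line (point, direction) or outputs a polygon (list of points, whose convex
    hull is the output region). *)
Inductive action : Type :=
  | Probe (a d : pt)
  | Output (P : list pt).

Definition strategy : Type := pt -> pt -> R -> list ((pt * pt) * response) -> action.

Definition run (w : R) (S : strategy) (O : pt -> Prop) (p c : pt) (rho : R)
    (h : list ((pt * pt) * response)) (P : list pt) : Prop :=
  (forall i, (i < length h)%nat ->
     let '((a, d), r) := nth i h (((0, 0), (0, 0)), Miss) in
     S p c rho (firstn i h) = Probe a d /\ d <> (0, 0) /\ probe_answer w O a d r) /\
  S p c rho h = Output P.

Definition correct (w : R) (S : strategy) : Prop :=
  forall (vs : list pt) (p c : pt) (rho : R),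
    convex_polygon vs -> angles_gt w vs -> in_hull vs p ->
    encloses c rho (in_hull vs) ->
    (exists h P, run w S (in_hull vs) p c rho h P) /\
    (forall h P, run w S (in_hull vs) p c rho h P ->
       forall x, in_hull P x <-> in_hull vs x).

(* Main.v *)
(** An adversary argument. A polygon is certified only if every edge is flush with
    a ray of some probe: otherwise a vertex could be added just outside the edge
    without changing any answer. When no two edge directions differ by [w], a probe
    is flush with at most one edge, so [n] flush probes are needed. The adversary
    moreover delays flush probes. Whenever the current polygon would make a probe
    flush with an edge, the apex is moved slightly backwards along the line with one
    contact point fixed, and a new vertex outside the middle of the edge is placed on
    the other ray. The probe is then no longer flush, the earlier answers are
    unchanged, and the polygon has gained a single vertex. Starting from a
    quadrilateral (a pentagon if [w = PI / 2]), the first two probes are made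
    non-flush without any new vertex, the second one by moving a vertex that the
    first probe did not touch. Hence at least [n - 2] (resp. [n - 3]) probes are made
    before the first flush one. *)

From Coquelicot Require Import Coquelicot.
From Stdlib Require Import Reals List Lra Lia Psatz Permutation Classical.
Require Import Defs.
Import ListNotations.
Open Scope R_scope.

(** The point and the circle are known to the prober beforehand, so every polygon used must contain
    the origin and stay in one open disk. This is why modifications only enlarge the hull and are
    arbitrarily small. Smallness is affordable because angle bounds, genericity and non-contact with
    a ray are finitely many strict polynomial conditions, and for most of them it suffices to look
    at the limit position of the displaced vertex. At an edge midpoint this limit is degenerate (a
    flat angle), and the missing orientations come from the direction of motion. The size of the
    displacement is dictated by the new ray, but tends to 0 with the backward motion of the apex.

    Since runs are given by a relation, the game makes sense only once answers are unique; a legal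
    history is then a prefix of every run on the polygon.

    The first probe depends only on the point and the circle, so the initial polygon can be rotated
    or shrunk to suit it. With [m] initial vertices the count is [2 + (n - m)] non-flush probes plus
    [n] flush ones. *)

(** * Properties of all sufficiently small positive parameters *)

Definition ev (P : R -> Prop) : Prop :=
  exists e, 0 < e /\ forall t, 0 < t < e -> P t.

Lemma ev_impl (P Q : R -> Prop) :
  (forall t, 0 < t -> P t -> Q t) -> ev P -> ev Q.
Proof.
intros HPQ [e [He H]]. exists e. split; [exact He|].
intros t Ht. apply HPQ; [lra|auto].
Qed.

Lemma ev_true (P : R -> Prop) : (forall t, 0 < t -> P t) -> ev P.
Proof. intros H. exists 1. split; [lra|]. intros t Ht. apply H. lra. Qed.

Lemma ev_and (P Q : R -> Prop) : ev P -> ev Q -> ev (fun t => P t /\ Q t).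
Proof.
intros [e [He H]] [f [Hf G]]. exists (Rmin e f).
split; [apply Rmin_pos; assumption|]. intros t [Ht1 Ht2].
pose proof (Rmin_l e f). pose proof (Rmin_r e f).
split; [apply H|apply G]; lra.
Qed.

Lemma ev_in {A : Type} (l : list A) (P : A -> R -> Prop) :
  (forall x, In x l -> ev (P x)) -> ev (fun t => forall x, In x l -> P x t).
Proof.
induction l as [|x l IH]; intros H.
- apply ev_true. intros t _ x [].
- assert (H1 : ev (P x)) by (apply H; left; reflexivity).
  assert (H2 : ev (fun t => forall y, In y l -> P y t)).
  { apply IH. intros y Hy. apply H. right. exact Hy. }
  apply (ev_impl (fun t => P x t /\ (forall y, In y l -> P y t))).
  + intros t _ [Ha Hb] y [<-|Hy]; auto.
  + apply ev_and; assumption.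
Qed.

Lemma ev_if (A : Prop) (P : R -> Prop) : (A -> ev P) -> ev (fun t => A -> P t).
Proof.
intros H. destruct (classic A) as [a|na].
- apply (ev_impl P); auto.
- apply ev_true. intros t _ a. contradiction.
Qed.

Lemma ev_ex (P : R -> Prop) : ev P -> exists t, 0 < t /\ P t.
Proof. intros [e [He H]]. exists (e / 2). split; [lra|]. apply H. lra. Qed.

(** Only continuity matters; differentiability is assumed because [auto_derive] discharges it for
    the polynomial expressions to come. *)
Lemma ev_pos (f : R -> R) : ex_derive f 0 -> 0 < f 0 -> ev (fun t => 0 < f t).
Proof.
intros Hd Hp.
assert (Hc : continuous f 0) by (apply (ex_derive_continuous f 0 Hd)).
assert (Hl : locally (f 0) (fun y => 0 < y)) by (apply (open_gt 0); exact Hp).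
destruct (Hc _ Hl) as [e He].
exists e. split; [apply cond_pos|].
intros t Ht. apply He. change (Rabs (t - 0) < e).
rewrite Rminus_0_r, Rabs_pos_eq; lra.
Qed.

Lemma ev_neq (f : R -> R) : ex_derive f 0 -> f 0 <> 0 -> ev (fun t => f t <> 0).
Proof.
intros Hd Hn. destruct (Rtotal_order (f 0) 0) as [H|[H|H]]; [|contradiction|].
- apply (ev_impl (fun t => 0 < - f t)); [intros; lra|].
  apply (ev_pos (fun t => - f t)); [|lra].
  apply (ex_derive_opp f 0 Hd).
- apply (ev_impl (fun t => 0 < f t)); [intros; lra|].
  apply ev_pos; assumption.
Qed.

Lemma pt_eq (x y : pt) : fst x = fst y -> snd x = snd y -> x = y.
Proof. destruct x, y. simpl. intros -> ->. reflexivity. Qed.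

Ltac unpg := unfold dist, norm, psub, padd, pscale, dot, cross, rot; simpl.
Ltac unpt := unfold dist, norm, psub, padd, pscale, dot, cross, rot in *; simpl in *.

(** * Convex hulls and their faces *)

Definition mix (t : R) (x y : pt) : pt := padd (pscale (1 - t) x) (pscale t y).

(** Closure under binary mixtures: inequalities for affine functions then follow by a two-case
    induction, without weight lists. *)
Inductive hull (vs : list pt) : pt -> Prop :=
  | hull_in : forall v, In v vs -> hull vs v
  | hull_mix : forall x y t, hull vs x -> hull vs y -> 0 <= t <= 1 -> hull vs (mix t x y).

(** Partial sums are normalised so that the induction yields points of the hull. A tail of total
    weight 0 cannot be normalised but contributes nothing, hence the middle clause. *)
Lemma wsum_scaled (vs : list pt) (ws : list R) :
  length ws = length vs -> Forall (fun w => 0 <= w) ws ->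
  0 <= fold_right Rplus 0 ws /\
  (fold_right Rplus 0 ws = 0 -> wsum ws vs = (0, 0)) /\
  (0 < fold_right Rplus 0 ws ->
    hull vs (pscale (/ fold_right Rplus 0 ws) (wsum ws vs))).
Proof.
revert ws. induction vs as [|v vs IH]; intros [|w ws] Hl Hf; simpl in *; try discriminate.
- split; [lra|]. split; [reflexivity|lra].
- inversion Hf as [|? ? Hw Hf']; subst.
  destruct (IH ws) as [H0 [H1 H2]]; [lia|assumption|].
  assert (Hmono : forall x, hull vs x -> hull (v :: vs) x).
  { intros x Hx. induction Hx; [apply hull_in; right; assumption|].
    apply hull_mix; assumption. }
  set (s := fold_right Rplus 0 ws) in *.
  split; [lra|]. split.
  + intros Hs. assert (w = 0) by lra. assert (s = 0) by lra.
    rewrite (H1 H3), H. unfold padd, pscale. simpl. f_equal; ring.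
  + intros Hs. destruct (Req_dec s 0) as [Hz|Hz].
    * rewrite (H1 Hz), Hz. replace (pscale _ _) with v.
      -- apply hull_in. left. reflexivity.
      -- apply pt_eq; unfold padd, pscale; simpl; field; lra.
    * replace (pscale _ _) with (mix (s / (w + s)) v (pscale (/ s) (wsum ws vs))).
      -- apply hull_mix; [apply hull_in; left; reflexivity|apply Hmono, H2; lra|].
         split; [apply Rdiv_le_0_compat; lra|].
         apply (Rmult_le_reg_r (w + s)); [lra|].
         unfold Rdiv. rewrite Rmult_assoc, Rinv_l; lra.
      -- apply pt_eq; unfold mix, padd, pscale; simpl; field; lra.
Qed.

Lemma wsum_comb (vs : list pt) (t : R) (ws ws' : list R) :
  length ws = length vs -> length ws' = length vs ->
  Forall (fun w => 0 <= w) ws -> Forall (fun w => 0 <= w) ws' -> 0 <= t <= 1 ->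
  exists ws'', length ws'' = length vs /\ Forall (fun w => 0 <= w) ws'' /\
    fold_right Rplus 0 ws'' =
      (1 - t) * fold_right Rplus 0 ws + t * fold_right Rplus 0 ws' /\
    wsum ws'' vs = mix t (wsum ws vs) (wsum ws' vs).
Proof.
intros Hl Hl' Hf Hf' Ht. revert ws ws' Hl Hl' Hf Hf'.
induction vs as [|v vs IH]; intros [|w ws] [|w' ws'] Hl Hl' Hf Hf'; simpl in *; try discriminate.
- exists []. repeat split; [constructor|simpl; ring|].
  apply pt_eq; unfold mix, padd, pscale; simpl; ring.
- inversion Hf; inversion Hf'; subst.
  destruct (IH ws ws') as [ws'' [H1' [H2' [H3' H4']]]]; try assumption; try lia.
  exists (((1 - t) * w + t * w') :: ws''). simpl. repeat split.
  + lia.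
  + constructor; [nra|assumption].
  + rewrite H3'. ring.
  + rewrite H4'. apply pt_eq; unfold mix, padd, pscale; simpl; ring.
Qed.

Lemma hull_iff (vs : list pt) (x : pt) : in_hull vs x <-> hull vs x.
Proof.
split.
- intros [ws [Hl [Hf [Hs ->]]]].
  destruct (wsum_scaled vs ws Hl Hf) as [_ [_ H]]. rewrite Hs in H.
  replace (wsum ws vs) with (pscale (/ 1) (wsum ws vs)); [apply H; lra|].
  apply pt_eq; unfold pscale; simpl; field.
- intros H. induction H as [v Hv|x y t _ [ws [Hl [Hf [Hs Hx]]]] _ [ws' [Hl' [Hf' [Hs' Hy]]]] Ht].
  + induction vs as [|a vs IH]; [destruct Hv|].
    destruct (classic (a = v)) as [->|Hne].
    * exists (1 :: map (fun _ => 0) vs). simpl. rewrite length_map.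
      assert (Hz : fold_right Rplus 0 (map (fun _ : pt => 0) vs) = 0 /\
                   wsum (map (fun _ => 0) vs) vs = (0, 0) /\
                   Forall (fun w => 0 <= w) (map (fun _ : pt => 0) vs)).
      { clear. induction vs as [|a vs [IH1 [IH2 IH3]]]; simpl.
        - repeat split. constructor.
        - rewrite IH1, IH2. repeat split; [ring| |constructor; [lra|assumption]].
          apply pt_eq; unfold padd, pscale; simpl; ring. }
      destruct Hz as [Hz1 [Hz2 Hz3]]. repeat split.
      -- constructor; [lra|assumption].
      -- rewrite Hz1. ring.
      -- rewrite Hz2. apply pt_eq; unfold padd, pscale; simpl; ring.
    * destruct Hv as [Hv|Hv]; [contradiction|].
      destruct (IH Hv) as [ws [Hl [Hf [Hs Hx]]]].
      exists (0 :: ws). simpl. repeat split.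
      -- lia.
      -- constructor; [lra|assumption].
      -- rewrite Hs. ring.
      -- rewrite <- Hx. apply pt_eq; unfold padd, pscale; simpl; ring.
  + destruct (wsum_comb vs t ws ws' Hl Hl' Hf Hf' Ht) as [ws'' [H1 [H2 [H3 H4]]]].
    exists ws''. repeat split; try assumption.
    * rewrite H3, Hs, Hs'. ring.
    * rewrite H4, <- Hx, <- Hy. reflexivity.
Qed.

Lemma hull_sub (vs vs' : list pt) (x : pt) :
  (forall v, In v vs -> hull vs' v) -> hull vs x -> hull vs' x.
Proof. intros H Hx. induction Hx; [auto|apply hull_mix; assumption]. Qed.

Definition affine (f : pt -> R) : Prop :=
  forall t x y, f (mix t x y) = (1 - t) * f x + t * f y.

Lemma hull_ge (vs : list pt) (f : pt -> R) (x : pt) :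
  affine f -> (forall v, In v vs -> 0 <= f v) -> hull vs x -> 0 <= f x.
Proof. intros Ha Hv Hx. induction Hx; [auto|]. rewrite Ha. nra. Qed.

Lemma hull_gt (vs : list pt) (f : pt -> R) (x : pt) :
  affine f -> (forall v, In v vs -> 0 < f v) -> hull vs x -> 0 < f x.
Proof.
intros Ha Hv Hx. induction Hx as [|x y t _ IH1 _ IH2 Ht]; [auto|]. rewrite Ha.
destruct (Req_dec t 0) as [->|]; [lra|]. nra.
Qed.

(** A nonnegative affine function vanishes at a proper mixture only if it vanishes at both ends. *)
Lemma hull_face (vs vs' : list pt) (f : pt -> R) (x : pt) :
  affine f -> (forall v, In v vs -> 0 <= f v) ->
  (forall v, In v vs -> f v = 0 -> In v vs') ->
  hull vs x -> f x = 0 -> hull vs' x.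
Proof.
intros Ha Hv Hz Hx. induction Hx as [v Hi|x y t Hx IH1 Hy IH2 Ht]; intros H0.
- apply hull_in. auto.
- rewrite Ha in H0.
  pose proof (hull_ge vs f x Ha Hv Hx). pose proof (hull_ge vs f y Ha Hv Hy).
  destruct (Req_dec t 0) as [->|Ht0].
  { replace (mix 0 x y) with x; [apply IH1; lra|].
    apply pt_eq; unfold mix, padd, pscale; simpl; ring. }
  destruct (Req_dec t 1) as [->|Ht1].
  { replace (mix 1 x y) with y; [apply IH2; lra|].
    apply pt_eq; unfold mix, padd, pscale; simpl; ring. }
  apply hull_mix; [apply IH1; nra|apply IH2; nra|exact Ht].
Qed.

Lemma hull_nil (x : pt) : ~ hull [] x.
Proof. intros H. induction H; [destruct H|assumption]. Qed.

Lemma hull_single (a x : pt) : hull [a] x -> x = a.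
Proof.
intros H. induction H as [v [->|[]]|x y t _ -> _ -> _]; [reflexivity|].
apply pt_eq; unfold mix, padd, pscale; simpl; ring.
Qed.

Lemma hull_face_ex (vs : list pt) (f : pt -> R) (x : pt) :
  affine f -> (forall v, In v vs -> 0 <= f v) -> hull vs x -> f x = 0 ->
  exists v, In v vs /\ f v = 0.
Proof.
intros Ha Hv Hx H0. apply NNPP. intros Hn.
(* Without a vertex on the face, the point would lie in the hull of the empty list. *)
apply (hull_nil x). apply (hull_face vs [] f); try assumption.
intros v Hi Hf. apply Hn. exists v. auto.
Qed.

Lemma hull_face_unique (vs : list pt) (f : pt -> R) (a x : pt) :
  affine f -> 0 <= f a -> (forall v, In v vs -> v <> a -> 0 < f v) ->
  hull vs x -> f x = 0 -> x = a.
Proof.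
intros Ha Hfa Hv Hx H0. apply hull_single.
apply (hull_face vs [a] f); try assumption.
- intros v Hi. destruct (classic (v = a)) as [->|Hne]; [assumption|].
  apply Rlt_le. auto.
- intros v Hi Hf. left. apply NNPP. intros Hne.
  assert (0 < f v) by auto. lra.
Qed.

Lemma affine_cross_l (u q : pt) : affine (fun x => cross u (psub x q)).
Proof. intros t x y. unfold mix. unpg. ring. Qed.
Lemma affine_cross_r (u q : pt) : affine (fun x => cross (psub x q) u).
Proof. intros t x y. unfold mix. unpg. ring. Qed.
Lemma affine_cross_l_opp (u q : pt) : affine (fun x => - cross u (psub x q)).
Proof. intros t x y. unfold mix. unpg. ring. Qed.
Lemma affine_dot (u q : pt) : affine (fun x => dot u (psub x q)).
Proof. intros t x y. unfold mix. unpg. ring. Qed.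

(** * Counterclockwise vertex lists and their edges *)

Definition orient (a b c : pt) : R := cross (psub b a) (psub c a).

Lemma orient_cyc (a b c : pt) : orient b c a = orient a b c.
Proof. unfold orient. unpg. ring. Qed.
Lemma orient_swap (a b c : pt) : orient a c b = - orient a b c.
Proof. unfold orient. unpg. ring. Qed.

(** All triples in list order turn left. Unlike the indexed form, this passes to cyclic rotations
    without index arithmetic, and appending a vertex adds a single family of conditions. *)
Fixpoint ccw (vs : list pt) : Prop :=
  match vs with
  | [] => True
  | x :: t => ForallOrdPairs (fun y z => 0 < orient x y z) t /\ ccw t
  end.

Lemma FOP_app {A : Type} (R : A -> A -> Prop) (l l' : list A) :
  ForallOrdPairs R (l ++ l') <->
  ForallOrdPairs R l /\ ForallOrdPairs R l' /\ (forall x y, In x l -> In y l' -> R x y).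
Proof.
induction l as [|a l IH]; simpl.
- split; [|tauto]. intros H. repeat split; [constructor|exact H|tauto].
- split.
  + intros H. inversion H as [|? ? H1 H2]; subst.
    apply IH in H2 as [H3 [H4 H5]]. rewrite Forall_forall in H1.
    repeat split.
    * constructor; [|exact H3]. apply Forall_forall. intros x Hx.
      apply H1, in_or_app. auto.
    * exact H4.
    * intros x y [<-|Hx] Hy; [apply H1, in_or_app; auto|auto].
  + intros [H1 [H2 H3]]. inversion H1 as [|? ? H4 H5]; subst.
    constructor.
    * apply Forall_forall. rewrite Forall_forall in H4.
      intros x Hx. apply in_app_or in Hx as [Hx|Hx]; auto.
    * apply IH. auto.
Qed.

Lemma FOP_in {A : Type} (R : A -> A -> Prop) (l : list A) (x y : A) :
  ForallOrdPairs R l -> In x l -> In y l -> x = y \/ R x y \/ R y x.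
Proof.
intros H Hx Hy. destruct (ForallOrdPairs_In H x y Hx Hy) as [e|e]; auto.
Qed.

Lemma FOP_impl {A : Type} (R R' : A -> A -> Prop) (l : list A) :
  (forall x y, In x l -> In y l -> R x y -> R' x y) ->
  ForallOrdPairs R l -> ForallOrdPairs R' l.
Proof.
intros HR H. induction H as [|a l Ha H IH]; constructor.
- rewrite Forall_forall in *. intros x Hx. apply HR; simpl; auto.
- apply IH. intros x y Hx Hy. apply HR; simpl; auto.
Qed.

Lemma ccw_snoc (l : list pt) (a : pt) :
  ccw (l ++ [a]) <-> ccw l /\ ForallOrdPairs (fun x y => 0 < orient x y a) l.
Proof.
induction l as [|x l IH]; simpl.
- split; intros _; repeat constructor.
- rewrite IH, FOP_app. split.
  + intros [[H1 [_ H2]] [H3 H4]]. repeat split; try assumption.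
    constructor; [|assumption]. apply Forall_forall. intros y Hy.
    apply (H2 y a); simpl; auto.
  + intros [[H1 H2] H3]. inversion H3 as [|? ? H4 H5]; subst.
    rewrite Forall_forall in H4.
    split; [split; [assumption|split]|split; assumption].
    * repeat constructor.
    * intros y z Hy [<-|[]]. auto.
Qed.

Lemma ccw_rot1 (l : list pt) (a : pt) : ccw (a :: l) <-> ccw (l ++ [a]).
Proof.
rewrite ccw_snoc. simpl.
assert (H : ForallOrdPairs (fun y z => 0 < orient a y z) l <->
            ForallOrdPairs (fun x y => 0 < orient x y a) l).
{ split; apply FOP_impl; intros x y _ _ H.
  - rewrite orient_cyc. exact H.
  - rewrite <- orient_cyc. exact H. }
tauto.
Qed.

Lemma ccw_rot (l l' : list pt) : ccw (l ++ l') -> ccw (l' ++ l).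
Proof.
revert l'. induction l as [|a l IH]; intros l' H; [rewrite app_nil_r; exact H|].
change (ccw (a :: (l ++ l'))) in H. rewrite ccw_rot1, <- app_assoc in H.
apply IH in H. rewrite <- app_assoc in H. exact H.
Qed.

Lemma ccw_orient_neq (vs : list pt) (x y z : pt) :
  ccw vs -> In x vs -> In y vs -> In z vs -> x <> y -> x <> z -> y <> z ->
  orient x y z <> 0.
Proof.
revert x y z.
assert (Hw : forall a l y z, ForallOrdPairs (fun y z => 0 < orient a y z) l ->
   In y l -> In z l -> y <> z -> orient a y z <> 0).
{ intros a l y z H Hy Hz Hyz.
  destruct (FOP_in _ _ _ _ H Hy Hz) as [E|[E|E]]; [contradiction|lra|].
  rewrite orient_swap in E. lra. }
induction vs as [|a vs IH]; intros x y z H Hx Hy Hz Hxy Hxz Hyz; [destruct Hx|].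
destruct H as [H1 H2].
destruct Hx as [->|Hx], Hy as [->|Hy], Hz as [->|Hz]; try congruence; eauto.
- rewrite <- orient_cyc. eauto.
- rewrite <- orient_cyc, <- orient_cyc. eauto.
Qed.

(** Edges, directed counterclockwise, are recognised from the vertex set alone. *)
Definition edge (vs : list pt) (x y : pt) : Prop :=
  In x vs /\ In y vs /\ x <> y /\
  forall z, In z vs -> z <> x -> z <> y -> 0 < orient x y z.

Lemma edge_perm (vs vs' : list pt) (x y : pt) :
  (forall z, In z vs <-> In z vs') -> edge vs x y -> edge vs' x y.
Proof.
intros H [Hx [Hy [Hn Hz]]]. repeat split; try (apply H; assumption); [exact Hn|].
intros z Hi. apply Hz. apply H. exact Hi.
Qed.

(** Two distinct successors would each have to lie strictly to the left of the edge ending at the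
    other. *)
Lemma edge_succ_unique (vs : list pt) (x y y' : pt) :
  edge vs x y -> edge vs x y' -> y = y'.
Proof.
intros [Hx [Hy [Hn Hz]]] [_ [Hy' [Hn' Hz']]]. apply NNPP. intros Hne.
assert (H1 : 0 < orient x y y') by (apply Hz; auto).
assert (H2 : 0 < orient x y' y) by (apply Hz'; auto).
rewrite orient_swap in H2. lra.
Qed.

Lemma edge_pred_unique (vs : list pt) (x x' y : pt) :
  edge vs x y -> edge vs x' y -> x = x'.
Proof.
intros [Hx [Hy [Hn Hz]]] [Hx' [_ [Hn' Hz']]]. apply NNPP. intros Hne.
assert (H1 : 0 < orient x y x') by (apply Hz; auto).
assert (H2 : 0 < orient x' y x) by (apply Hz'; auto).
unfold orient in *. unpt. lra.
Qed.

Lemma edge_last_first (l : list pt) (x y : pt) :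
  NoDup (y :: l ++ [x]) -> ccw (y :: l ++ [x]) -> edge (y :: l ++ [x]) x y.
Proof.
intros Hd Hc.
assert (Hxy : x <> y).
{ inversion Hd as [|? ? H1 H2]; subst. intros ->. apply H1, in_or_app. simpl. auto. }
split; [right; apply in_or_app; simpl; auto|].
split; [left; reflexivity|]. split; [exact Hxy|].
intros z Hz Hzx Hzy. destruct Hz as [Hz|Hz]; [congruence|].
apply in_app_or in Hz as [Hz|[Hz|[]]]; [|congruence].
destruct Hc as [Hc _]. apply FOP_app in Hc as [_ [_ Hc]].
assert (H : 0 < orient y z x) by (apply Hc; simpl; auto).
unfold orient in *. unpt. lra.
Qed.

(** A cyclic rotation turns any consecutive pair into the last and first entries. *)
Lemma edge_app (l l' : list pt) (x y : pt) :
  NoDup (l ++ x :: y :: l') -> ccw (l ++ x :: y :: l') -> edge (l ++ x :: y :: l') x y.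
Proof.
intros Hd Hc.
assert (P : Permutation (l ++ x :: y :: l') (y :: (l' ++ l) ++ [x])).
{ change (x :: y :: l') with ([x] ++ y :: l'). rewrite app_assoc.
  rewrite Permutation_app_comm. simpl. rewrite <- app_assoc. reflexivity. }
apply (edge_perm (y :: (l' ++ l) ++ [x])).
{ intros z. split; apply Permutation_in; [symmetry|]; exact P. }
apply edge_last_first; [apply (Permutation_NoDup P Hd)|].
rewrite <- app_assoc. change (ccw ((y :: l') ++ (l ++ [x]))).
apply ccw_rot. rewrite <- app_assoc. exact Hc.
Qed.

(** With a chosen vertex in last position, adding a neighbour or replacing that vertex only edits
    the end of the list. *)
Lemma rotate_to_last (vs : list pt) (x : pt) :
  In x vs -> (2 <= length vs)%nat -> ccw vs ->
  exists y l, ccw (y :: l ++ [x]) /\ Permutation vs (y :: l ++ [x]).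
Proof.
intros Hx Hl Hc. apply in_split in Hx as [l1 [l2 ->]].
assert (Hc' : ccw ((l2 ++ l1) ++ [x])).
{ rewrite <- app_assoc. change (ccw (l1 ++ ([x] ++ l2))) in Hc.
  rewrite app_assoc in Hc. apply ccw_rot in Hc. exact Hc. }
assert (P : Permutation (l1 ++ x :: l2) ((l2 ++ l1) ++ [x])).
{ rewrite <- Permutation_cons_append. rewrite <- Permutation_middle.
  constructor. apply Permutation_app_comm. }
destruct (l2 ++ l1) as [|y l].
- apply Permutation_length in P. simpl in P. lia.
- exists y, l. split; assumption.
Qed.

Lemma edge_succ_ex (vs : list pt) (x : pt) :
  NoDup vs -> (2 <= length vs)%nat -> ccw vs -> In x vs -> exists y, edge vs x y.
Proof.
intros Hd Hl Hc Hx. destruct (rotate_to_last vs x Hx Hl Hc) as [y [l [Hc' P]]].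
exists y. apply (edge_perm (y :: l ++ [x])).
- intros z. split; apply Permutation_in; [symmetry|]; exact P.
- apply edge_last_first; [apply (Permutation_NoDup P Hd)|exact Hc'].
Qed.

Lemma edge_pred_ex (vs : list pt) (y : pt) :
  NoDup vs -> (2 <= length vs)%nat -> ccw vs -> In y vs -> exists x, edge vs x y.
Proof.
intros Hd Hl Hc Hy. apply in_split in Hy as [l1 [l2 ->]].
assert (Hc' : ccw (y :: l2 ++ l1)) by (apply (ccw_rot l1 (y :: l2)); exact Hc).
assert (P : Permutation (l1 ++ y :: l2) (y :: l2 ++ l1)) by
  apply (Permutation_app_comm l1 (y :: l2)).
destruct (exists_last (l := l2 ++ l1)) as [l [x E]].
{ intros E. rewrite E in P. apply Permutation_length in P. simpl in P. lia. }
rewrite E in *. exists x. apply (edge_perm (y :: l ++ [x])).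
- intros z. split; apply Permutation_in; [symmetry|]; exact P.
- apply edge_last_first; [apply (Permutation_NoDup P Hd)|exact Hc'].
Qed.

(** * Translation to the indexed definitions *)

Lemma edge_vtx (vs : list pt) (i : nat) :
  NoDup vs -> (2 <= length vs)%nat -> ccw vs -> (i < length vs)%nat ->
  edge vs (vtx vs i) (vtx vs (i + 1)).
Proof.
intros Hd Hl Hc Hi. unfold vtx. rewrite (Nat.mod_small i) by exact Hi.
destruct (nth_split vs (0, 0) Hi) as [l1 [l2 [E Hl1]]].
set (x := nth i vs (0, 0)) in *. destruct l2 as [|y l2].
- assert (Hn : length vs = (i + 1)%nat).
  { rewrite E, length_app. simpl. lia. }
  rewrite <- Hn, Nat.Div0.mod_same.
  destruct l1 as [|y l1]; [rewrite E in Hl; simpl in Hl; lia|].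
  simpl in E. rewrite E in *. apply edge_last_first; assumption.
- assert (Hn : (i + 1 < length vs)%nat).
  { rewrite E, length_app. simpl. lia. }
  rewrite Nat.mod_small by exact Hn.
  assert (Hy : nth (i + 1) vs (0, 0) = y).
  { rewrite E, app_nth2 by lia. replace (i + 1 - length l1)%nat with 1%nat by lia.
    reflexivity. }
  rewrite Hy. rewrite E in *. apply edge_app; assumption.
Qed.

Lemma convex_polygon_ccw (vs : list pt) :
  NoDup vs -> (3 <= length vs)%nat -> ccw vs -> convex_polygon vs.
Proof.
intros Hd Hl Hc. split; [exact Hl|]. intros i j Hi Hj Hji Hji1.
destruct (edge_vtx vs i Hd ltac:(lia) Hc Hi) as [_ [_ [_ H]]].
apply H.
- unfold vtx. apply nth_In. rewrite Nat.mod_small; exact Hj.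
- unfold vtx. rewrite !Nat.mod_small by assumption. intros E.
  apply Hji. apply (proj1 (NoDup_nth vs (0, 0)) Hd); assumption.
- unfold vtx. rewrite (Nat.mod_small j) by assumption. intros E.
  apply Hji1. apply (proj1 (NoDup_nth vs (0, 0)) Hd); try assumption.
  apply Nat.mod_upper_bound. lia.
Qed.

(** * Angle bounds as sign conditions *)

(** For an internal angle [theta] the cross product is a positive multiple of [sin (theta - w)],
    hence positive exactly when [theta > w]. It is polynomial in the coordinates, and still positive
    for a flat angle. *)
Definition wide (w : R) (vs : list pt) : Prop :=
  forall p v n, edge vs p v -> edge vs v n ->
    0 < cross (rot w (psub n v)) (psub p v).

Lemma sin_bounds (w : R) : 0 < w <= PI / 2 -> 0 < sin w /\ 0 <= cos w.
Proof.
intros Hw. pose proof PI_RGT_0. split; [apply sin_gt_0; lra|apply cos_ge_0; lra].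
Qed.

Lemma wide_angle (w : R) (a b : pt) :
  0 < w <= PI / 2 -> 0 < cross b a -> 0 < cross (rot w b) a ->
  w < acos (dot a b / (norm a * norm b)).
Proof.
intros Hw H1 H2.
set (A := norm a). set (B := norm b).
assert (HA2 : A * A = dot a a).
{ apply sqrt_sqrt. unpt. nra. }
assert (HB2 : B * B = dot b b).
{ apply sqrt_sqrt. unpt. nra. }
(* Lagrange's identity: after division by the norms, [c] and [s] are the cosine and sine of the
   angle. *)
assert (Hlag : cross b a * cross b a + dot a b * dot a b = (A * A) * (B * B)).
{ rewrite HA2, HB2. unpg. ring. }
assert (HA : 0 <= A) by apply sqrt_pos.
assert (HB : 0 <= B) by apply sqrt_pos.
assert (HA' : 0 < A).
{ destruct HA as [HA|HA]; [exact HA|]. rewrite <- HA in *.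
  assert (fst a * fst a + snd a * snd a = 0) by (unfold dot in HA2; lra).
  assert (fst a = 0) by nra. assert (snd a = 0) by nra.
  unfold cross in H1. rewrite H0, H3 in H1. lra. }
assert (HB' : 0 < B).
{ destruct HB as [HB|HB]; [exact HB|]. rewrite <- HB in *.
  assert (fst b * fst b + snd b * snd b = 0) by (unfold dot in HB2; lra).
  assert (fst b = 0) by nra. assert (snd b = 0) by nra.
  unfold cross in H1. rewrite H0, H3 in H1. lra. }
assert (HAB : 0 < A * B) by (apply Rmult_lt_0_compat; assumption).
set (c := dot a b / (A * B)).
assert (Hc : dot a b = c * (A * B)) by (unfold c; field; lra).
set (s := cross b a / (A * B)).
assert (Hs : cross b a = s * (A * B)) by (unfold s; field; lra).
assert (Hs0 : 0 < s) by (apply Rdiv_lt_0_compat; assumption).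
assert (Hcs : s * s + c * c = 1).
{ apply (Rmult_eq_reg_r ((A * B) * (A * B))); [|nra].
  rewrite Hs, Hc in Hlag. nra. }
assert (Hc1 : -1 <= c <= 1) by nra.
assert (Hcos : cos (acos c) = c) by (apply cos_acos; exact Hc1).
pose proof (acos_bound c) as Hb.
assert (Hsin : sin (acos c) = s).
{ assert (E := sin2_cos2 (acos c)). unfold Rsqr in E. rewrite Hcos in E.
  assert (0 <= sin (acos c)) by (apply sin_ge_0; lra).
  nra. }
assert (H2' : cross (rot w b) a = (A * B) * (cos w * s - sin w * c)).
{ transitivity (cos w * cross b a - sin w * dot a b).
  - unpg. ring.
  - rewrite Hs, Hc. ring. }
rewrite H2' in H2. apply Rnot_le_lt. intros Hle.
assert (Hneg : sin (w - acos c) >= 0).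
{ apply Rle_ge, sin_ge_0; lra. }
rewrite sin_minus, Hcos, Hsin in Hneg. nra.
Qed.

Lemma wide_angles_gt (w : R) (vs : list pt) :
  0 < w <= PI / 2 -> NoDup vs -> (3 <= length vs)%nat -> ccw vs -> wide w vs ->
  angles_gt w vs.
Proof.
intros Hw Hd Hl Hc Hwide i Hi. unfold internal_angle.
set (k := ((i + length vs - 1) mod length vs)%nat).
assert (Hk : (k < length vs)%nat) by (apply Nat.mod_upper_bound; lia).
assert (Ek : vtx vs (i + length vs - 1) = vtx vs k).
{ unfold vtx, k. rewrite Nat.Div0.mod_mod. reflexivity. }
assert (Ek1 : vtx vs (k + 1) = vtx vs i).
{ unfold vtx, k. rewrite Nat.Div0.add_mod_idemp_l.
  replace (i + length vs - 1 + 1)%nat with (i + 1 * length vs)%nat by lia.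
  rewrite Nat.Div0.mod_add. reflexivity. }
assert (E1 := edge_vtx vs k Hd ltac:(lia) Hc Hk). rewrite Ek1 in E1.
assert (E2 := edge_vtx vs i Hd ltac:(lia) Hc Hi).
rewrite Ek. apply wide_angle; [exact Hw| |apply Hwide; assumption].
change (0 < orient (vtx vs i) (vtx vs (i + 1)) (vtx vs k)).
destruct E2 as [_ [_ [_ H]]]. apply H.
- apply E1.
- apply E1.
(* Predecessor and successor of a vertex differ because there are at least three vertices; index 0
   and the last index wrap around. *)
- intros E. rewrite E in E1. destruct E1 as [_ [_ [_ H1]]].
  unfold vtx in E. apply (proj1 (NoDup_nth vs (0, 0)) Hd) in E;
    try (apply Nat.mod_upper_bound; lia).
  revert E. rewrite (Nat.mod_small k) by exact Hk.
  intros E. unfold k in E.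
  destruct (Nat.eq_dec i 0) as [->|Hi0].
  + rewrite !Nat.mod_small in E; lia.
  + replace (i + length vs - 1)%nat with ((i - 1) + 1 * length vs)%nat in E by lia.
    rewrite Nat.Div0.mod_add, (Nat.mod_small (i - 1)) in E by lia.
    destruct (Nat.eq_dec (i + 1) (length vs)) as [Hn|Hn].
    * rewrite Hn, Nat.Div0.mod_same in E. lia.
    * rewrite Nat.mod_small in E; lia.
Qed.

(** Under this condition a probe is flush with at most one edge. *)
Definition generic (w : R) (vs : list pt) : Prop :=
  forall p q p' q', edge vs p q -> edge vs p' q' ->
    cross (rot w (psub q p)) (psub q' p') <> 0.

(** The invariant of the adversary's polygons. The origin plays the role of the known point and of
    the centre of the circle; the strict bound leaves room for small displacements. *)
Record good (w rho : R) (vs : list pt) : Prop := {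
  good_nodup : NoDup vs;
  good_length : (3 <= length vs)%nat;
  good_ccw : ccw vs;
  good_wide : wide w vs;
  good_generic : generic w vs;
  good_bounded : forall v, In v vs -> dot v v < rho * rho;
  good_origin : hull vs (0, 0) }.

(** * Coordinates in a wedge *)

Lemma norm1_dot (u : pt) : norm u = 1 -> dot u u = 1.
Proof.
intros H. unfold norm in H. rewrite <- (sqrt_sqrt (dot u u)); [rewrite H; ring|].
unpt. nra.
Qed.

Lemma dot1_norm (u : pt) : dot u u = 1 -> norm u = 1.
Proof. intros H. unfold norm. rewrite H. apply sqrt_1. Qed.

Lemma dot_pos (d : pt) : d <> (0, 0) -> 0 < dot d d.
Proof.
destruct d as [x y]. unfold dot. simpl. intros H.
destruct (Req_dec x 0) as [->|]; [|nra].
destruct (Req_dec y 0) as [->|]; [congruence|nra].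
Qed.

Lemma cross_rot (w : R) (u : pt) : cross u (rot w u) = sin w * dot u u.
Proof. unpg. ring. Qed.
Lemma dot_rot (w : R) (u : pt) : dot u (rot w u) = cos w * dot u u.
Proof. unpg. ring. Qed.

Lemma sc1 (w : R) : sin w * sin w + cos w * cos w = 1.
Proof. exact (sin2_cos2 w). Qed.

Lemma rot_dot (w : R) (u : pt) : dot (rot w u) (rot w u) = dot u u.
Proof.
transitivity ((sin w * sin w + cos w * cos w) * dot u u); [unpg; ring|].
rewrite sc1. ring.
Qed.

Lemma rot_norm (w : R) (u : pt) : norm u = 1 -> norm (rot w u) = 1.
Proof. intros H. apply dot1_norm. rewrite rot_dot. apply norm1_dot, H. Qed.

(** Cramer's rule in the basis [u], [rot w u], whose determinant is [sin w]. *)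
Lemma wedge_coords (w : R) (q u x : pt) :
  0 < sin w -> norm u = 1 ->
  x = padd q (padd (pscale (cross (psub x q) (rot w u) / sin w) u)
                   (pscale (cross u (psub x q) / sin w) (rot w u))).
Proof.
intros Hs Hu. apply norm1_dot in Hu. destruct u as [u1 u2], x as [x1 x2], q as [q1 q2].
unpt. apply pt_eq; simpl.
- apply (Rmult_eq_reg_r (sin w)); [|lra].
  transitivity (q1 * sin w + sin w * (x1 - q1) * (u1 * u1 + u2 * u2)).
  + rewrite Hu. ring.
  + field. lra.
- apply (Rmult_eq_reg_r (sin w)); [|lra].
  transitivity (q2 * sin w + sin w * (x2 - q2) * (u1 * u1 + u2 * u2)).
  + rewrite Hu. ring.
  + field. lra.
Qed.

Lemma in_wedge_iff (w : R) (q u x : pt) :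
  0 < sin w -> norm u = 1 ->
  in_wedge w q u x <-> 0 <= cross u (psub x q) /\ 0 <= cross (psub x q) (rot w u).
Proof.
intros Hs Hu. split.
- intros [s [t [H1 [H2 ->]]]]. apply norm1_dot in Hu.
  assert (E := cross_rot w u). rewrite Hu in E.
  split.
  + replace (cross u _) with (t * cross u (rot w u)).
    * rewrite E. nra.
    * unpg. ring.
  + replace (cross _ (rot w u)) with (s * cross u (rot w u)).
    * rewrite E. nra.
    * unpg. ring.
- intros [H1 H2]. exists (cross (psub x q) (rot w u) / sin w), (cross u (psub x q) / sin w).
  split; [apply Rdiv_le_0_compat; assumption|].
  split; [apply Rdiv_le_0_compat; assumption|].
  apply wedge_coords; assumption.
Qed.

Lemma on_ray_cross (q u x : pt) : on_ray q u x -> cross u (psub x q) = 0.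
Proof. intros [s [_ ->]]. unpg. ring. Qed.

Lemma on_ray_cross_r (q u x : pt) : on_ray q u x -> cross (psub x q) u = 0.
Proof. intros [s [_ ->]]. unpg. ring. Qed.

Lemma wedge_on_ray1 (w : R) (q u x : pt) :
  0 < sin w -> norm u = 1 -> 0 <= cross (psub x q) (rot w u) ->
  cross u (psub x q) = 0 -> on_ray q u x.
Proof.
intros Hs Hu H1 H2. exists (cross (psub x q) (rot w u) / sin w).
split; [apply Rdiv_le_0_compat; assumption|].
rewrite (wedge_coords w q u x Hs Hu) at 1. rewrite H2.
apply pt_eq; unfold padd, pscale; simpl; field; lra.
Qed.

Lemma wedge_on_ray2 (w : R) (q u x : pt) :
  0 < sin w -> norm u = 1 -> 0 <= cross u (psub x q) ->
  cross (psub x q) (rot w u) = 0 -> on_ray q (rot w u) x.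
Proof.
intros Hs Hu H1 H2. exists (cross u (psub x q) / sin w).
split; [apply Rdiv_le_0_compat; assumption|].
rewrite (wedge_coords w q u x Hs Hu) at 1. rewrite H2.
apply pt_eq; unfold padd, pscale; simpl; field; lra.
Qed.

(** From the apex, the turn from [x] to [y] cannot exceed [w]. In wedge coordinates the expression
    is minus a sum of nonnegative terms; the mixed term uses [0 <= cos w], that is [w <= PI / 2]. *)
Lemma wedge_angle_le (w : R) (q u x y : pt) :
  0 < w <= PI / 2 -> in_wedge w q u x -> in_wedge w q u y ->
  cross (rot w (psub x q)) (psub y q) <= 0.
Proof.
intros Hw [s [t [Hs [Ht ->]]]] [s' [t' [Hs' [Ht' ->]]]].
destruct (sin_bounds w Hw) as [S C]. assert (E := sc1 w).
replace (cross _ _) with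
  (- (sin w * dot u u * (s * s' + 2 * cos w * (t * s') +
      (sin w * sin w + cos w * cos w) * (t * t')))) by (unpg; ring).
rewrite E.
assert (0 <= dot u u) by (unpt; nra).
assert (0 <= s * s') by nra. assert (0 <= t * s') by nra. assert (0 <= t * t') by nra.
assert (0 <= cos w * (t * s')) by nra.
assert (0 <= sin w * dot u u) by nra. nra.
Qed.

Lemma wedge_hull (w : R) (q u x : pt) (vs : list pt) :
  0 < sin w -> norm u = 1 -> (forall v, In v vs -> in_wedge w q u v) ->
  hull vs x -> in_wedge w q u x.
Proof.
intros Hs Hu H Hx. apply in_wedge_iff; try assumption.
split.
- apply (hull_ge vs (fun x => cross u (psub x q))); [apply affine_cross_l| |exact Hx].
  intros v Hv. apply (in_wedge_iff w q u v Hs Hu); auto.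
- apply (hull_ge vs (fun x => cross (psub x q) (rot w u)));
    [apply affine_cross_r| |exact Hx].
  intros v Hv. apply (in_wedge_iff w q u v Hs Hu); auto.
Qed.

(** * Uniqueness of the answer to a probe *)

Section Probes.
Variables (w rho : R) (vs : list pt).
Hypothesis Hw : 0 < w <= PI / 2.
Hypothesis Hg : good w rho vs.

Let Hs : 0 < sin w := proj1 (sin_bounds w Hw).
Let Hc : 0 <= cos w := proj2 (sin_bounds w Hw).

Lemma good_pred (v : pt) : In v vs -> exists p, edge vs p v.
Proof.
intros Hv. pose proof (good_length _ _ _ Hg).
apply edge_pred_ex; try apply Hg; [lia|exact Hv].
Qed.

Lemma good_succ (v : pt) : In v vs -> exists n, edge vs v n.
Proof.
intros Hv. pose proof (good_length _ _ _ Hg).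
apply edge_succ_ex; try apply Hg; [lia|exact Hv].
Qed.

Lemma good_third (x y : pt) : exists z, In z vs /\ z <> x /\ z <> y.
Proof.
apply NNPP. intros Hn.
assert (Hi : incl vs [x; y]).
{ intros z Hz. apply NNPP. intros Hz'. apply Hn. exists z. simpl in Hz'.
  split; [exact Hz|]. split; intros ->; apply Hz'; auto. }
pose proof (NoDup_incl_length (good_nodup _ _ _ Hg) Hi).
pose proof (good_length _ _ _ Hg). simpl in *. lia.
Qed.

(** An apex in the polygon would be one of its vertices, whose two neighbours are seen under an
    angle larger than [w], too large for the wedge. *)
Lemma apex_outside (q u : pt) :
  norm u = 1 -> (forall v, In v vs -> in_wedge w q u v) -> ~ hull vs q.
Proof.
intros Hu Hin Hq. assert (Hu' := norm1_dot u Hu).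
(* The height along the bisector of the wedge, which vanishes in the wedge only at the apex. *)
set (f := fun x => dot (padd u (rot w u)) (psub x q)).
assert (Hf : forall x s t, x = padd q (padd (pscale s u) (pscale t (rot w u))) ->
             f x = (s + t) * (1 + cos w)).
{ intros x s t ->. unfold f.
  replace (dot _ _) with
    (s * dot u u + (s + t) * dot u (rot w u) + t * dot (rot w u) (rot w u))
    by (unpg; ring).
  rewrite rot_dot, dot_rot, Hu'. ring. }
destruct (hull_face_ex vs f q) as [v [Hv Hfv]].
- apply affine_dot.
- intros v Hv. destruct (Hin v Hv) as [s [t [H1 [H2 E]]]]. rewrite (Hf v s t E). nra.
- exact Hq.
- unfold f. unpg. ring.
- assert (Evq : v = q).
  { destruct (Hin v Hv) as [s [t [H1 [H2 E]]]]. rewrite (Hf v s t E) in Hfv.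
    assert (s = 0) by nra. assert (t = 0) by nra. subst s t. rewrite E.
    apply pt_eq; unfold padd, pscale; simpl; ring. }
  subst v. destruct (good_pred q Hv) as [p Hp]. destruct (good_succ q Hv) as [n Hn].
  assert (H := good_wide _ _ _ Hg p q n Hp Hn).
  assert (H' := wedge_angle_le w q u n p Hw (Hin n (proj1 (proj2 Hn))) (Hin p (proj1 Hp))).
  lra.
Qed.

Lemma valid_wedge (a d q u : pt) :
  valid_probe w (in_hull vs) a d q u -> forall x, hull vs x -> in_wedge w q u x.
Proof. intros [_ [_ [H _]]] x Hx. apply H, hull_iff, Hx. Qed.

Lemma valid_apex (a d q u : pt) :
  valid_probe w (in_hull vs) a d q u -> ~ hull vs q.
Proof.
intros Hv. apply (apex_outside q u); [apply Hv|].
intros v Hi. apply (valid_wedge a d q u Hv), hull_in, Hi.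
Qed.

Lemma hull_on_ray_pos (q v x : pt) : ~ hull vs q -> hull vs x -> on_ray q v x ->
  exists s, 0 < s /\ x = padd q (pscale s v).
Proof.
intros Hq Hx [s [H0 E]]. exists s. split; [|exact E].
destruct H0 as [H0|<-]; [exact H0|]. exfalso. apply Hq.
replace q with x; [exact Hx|]. rewrite E. apply pt_eq; unfold padd, pscale; simpl; ring.
Qed.

(** The direction [d] has nonnegative wedge coordinates because its ray from the apex reaches the
    polygon, at a positive distance since the apex is outside. *)
Lemma valid_data (a d q u : pt) :
  valid_probe w (in_hull vs) a d q u ->
  exists sg rh al be s0,
    0 < sg /\ 0 < rh /\ 0 <= al /\ 0 <= be /\ 0 < s0 /\
    hull vs (padd q (pscale sg u)) /\ hull vs (padd q (pscale rh (rot w u))) /\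
    d = padd (pscale al u) (pscale be (rot w u)) /\ hull vs (padd q (pscale s0 d)).
Proof.
intros Hv. assert (Hq := valid_apex a d q u Hv). assert (Hwd := valid_wedge a d q u Hv).
destruct Hv as [Hu [_ [_ [[x [Hx Rx]] [[y [Hy Ry]] [s0 [Hs0 Hz]]]]]]].
apply hull_iff in Hx, Hy, Hz.
destruct (hull_on_ray_pos q u x Hq Hx Rx) as [sg [Hsg ->]].
destruct (hull_on_ray_pos q _ y Hq Hy Ry) as [rh [Hrh ->]].
destruct (hull_on_ray_pos q d _ Hq Hz) as [s1 [Hs1 E1]]; [exists s0; auto|].
rewrite E1 in Hz. destruct (Hwd _ Hz) as [s [t [H1 [H2 E]]]].
exists sg, rh, (s / s1), (t / s1), s1.
repeat split; try assumption; try (apply Rdiv_le_0_compat; assumption).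
injection E. intros Eb Ea. apply pt_eq; unfold padd, pscale; simpl.
- apply (Rmult_eq_reg_l s1); [|lra]. simpl in Ea.
  transitivity (s * fst u + t * fst (rot w u)); [simpl; lra|simpl; field; lra].
- apply (Rmult_eq_reg_l s1); [|lra]. simpl in Eb.
  transitivity (s * snd u + t * snd (rot w u)); [simpl; lra|simpl; field; lra].
Qed.

(* From the apex nearer to the polygon along the line, the polygon is seen under
   a strictly larger angle. *)
Lemma valid_not_nearer (a d q u q' u' : pt) (eta : R) :
  d <> (0, 0) -> 0 < eta ->
  valid_probe w (in_hull vs) a d q u -> valid_probe w (in_hull vs) a d q' u' ->
  q = padd q' (pscale eta d) -> False.
Proof.
intros Hd He Hv Hv' Eq.
destruct (valid_data a d q' u' Hv') as [sg [rh [al [be [s1 [Hsg [Hrh [Hal [Hbe [_ [H1 [H2 [Ed _]]]]]]]]]]]]].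
assert (Hq := valid_apex a d q u Hv).
assert (Hu' := norm1_dot u' (proj1 Hv')).
assert (HX := valid_wedge a d q u Hv _ H1). assert (HY := valid_wedge a d q u Hv _ H2).
assert (HK := wedge_angle_le w q u _ _ Hw HX HY).
destruct Hv as [_ [_ [_ [_ [_ [s [Hs0 Hz]]]]]]]. apply hull_iff in Hz.
set (A := eta * al). set (B := eta * be).
assert (HA : 0 <= A) by (unfold A; nra). assert (HB : 0 <= B) by (unfold B; nra).
assert (HAB : 0 < A \/ 0 < B).
{ destruct (Rle_lt_or_eq_dec 0 A HA) as [|EA]; [auto|].
  destruct (Rle_lt_or_eq_dec 0 B HB) as [|EB]; [auto|].
  exfalso. apply Hd. assert (al = 0) by (unfold A in EA; nra).
  assert (be = 0) by (unfold B in EB; nra). subst al be. rewrite Ed.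
  apply pt_eq; unfold padd, pscale; simpl; ring. }
assert (Eq' : q = padd q' (padd (pscale A u') (pscale B (rot w u')))).
{ rewrite Eq, Ed. apply pt_eq; unfold padd, pscale, A, B; simpl; ring. }
(* The farther wedge's two contacts, seen from [q], which has coordinates [A], [B] in that wedge. As
   both lie in the wedge at [q], this quantity is at most 0. *)
assert (EK : cross (rot w (psub (padd q' (pscale sg u')) q))
                   (psub (padd q' (pscale rh (rot w u'))) q) =
             - sin w * (A * A + B * B + 2 * cos w * A * B - rh * B - sg * A)).
{ rewrite Eq'.
  transitivity (- sin w * dot u' u' * (A * A + 2 * cos w * A * B - sg * A +
     (sin w * sin w + cos w * cos w) * (B * B - rh * B))).
  - unpg. ring.
  - rewrite sc1, Hu'. ring. }
rewrite EK in HK.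
assert (HK' : rh * B + sg * A <= A * A + B * B + 2 * cos w * A * B) by nra.
assert (Hcos : cos w <= 1) by apply COS_bound.
(* Position of [q] relative to the chord joining the two contacts. Strictly before the chord, the
   angle inequality fails. Otherwise [q] lies between a point of the chord, at scale [mu <= 1], and
   the hull point ahead on the line, at scale [k >= 1], so it is in the polygon. *)
destruct (Rlt_le_dec (A * rh + B * sg) (sg * rh)) as [Hlt|Hge].
- assert (HAB' : 0 <= A * B) by nra.
  assert (H3 : (A + B) * (A + B) >= rh * B + sg * A) by nra.
  assert (H4 : 0 < rh * B + sg * A) by nra.
  assert (H5 : (A + B) * (A + B) * (sg * rh) <= (rh * B + sg * A) * (A * rh + B * sg)).
  { assert (0 <= A * B * ((sg - rh) * (sg - rh))) by
      (apply Rmult_le_pos; [exact HAB'|exact (Rle_0_sqr (sg - rh))]).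
    lra. }
  assert (0 < sg * rh) by nra.
  assert ((rh * B + sg * A) * (A * rh + B * sg) < (rh * B + sg * A) * (sg * rh)) by
    (apply Rmult_lt_compat_l; assumption).
  assert ((rh * B + sg * A) * (sg * rh) <= (A + B) * (A + B) * (sg * rh)) by
    (apply Rmult_le_compat_r; lra).
  lra.
- apply Hq.
  set (D := A * rh + B * sg) in *.
  assert (HD : 0 < D) by nra.
  set (mu := sg * rh / D).
  assert (Hmu1 : mu <= 1).
  { unfold mu. apply (Rmult_le_reg_r D); [exact HD|]. unfold Rdiv.
    rewrite Rmult_assoc, Rinv_l; lra. }
  assert (Hmu0 : 0 < mu) by (apply Rdiv_lt_0_compat; nra).
  assert (Hy : hull vs (padd q' (padd (pscale (mu * A) u') (pscale (mu * B) (rot w u'))))).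
  { replace (padd q' _) with
      (mix (B * sg / D) (padd q' (pscale sg u')) (padd q' (pscale rh (rot w u')))).
    - apply hull_mix; try assumption. split; [apply Rdiv_le_0_compat; nra|].
      apply (Rmult_le_reg_r D); [exact HD|]. unfold Rdiv.
      rewrite Rmult_assoc, Rinv_l; unfold D; nra.
    - apply pt_eq; unfold mix, mu, padd, pscale, D; simpl; field; unfold D in HD; lra. }
  set (k := 1 + s / eta).
  assert (Hk : 1 <= k).
  { unfold k. assert (0 <= s / eta) by (apply Rdiv_le_0_compat; lra). lra. }
  assert (Ez : padd q (pscale s d) =
               padd q' (padd (pscale (k * A) u') (pscale (k * B) (rot w u')))).
  { rewrite Eq, Ed. apply pt_eq; unfold k, A, B, padd, pscale; simpl; field; lra. }
  rewrite Ez in Hz.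
  destruct (Req_dec k mu) as [Ek|Ek].
  + assert (k = 1) by lra. rewrite H in Hz. rewrite Eq'.
    rewrite !Rmult_1_l in Hz. exact Hz.
  + assert (0 < k - mu) by lra.
    rewrite Eq'. replace (padd q' _) with
      (mix ((1 - mu) / (k - mu))
         (padd q' (padd (pscale (mu * A) u') (pscale (mu * B) (rot w u'))))
         (padd q' (padd (pscale (k * A) u') (pscale (k * B) (rot w u'))))).
    * apply hull_mix; try assumption. split; [apply Rdiv_le_0_compat; lra|].
      apply (Rmult_le_reg_r (k - mu)); [lra|]. unfold Rdiv.
      rewrite Rmult_assoc, Rinv_l; lra.
    * apply pt_eq; unfold mix, padd, pscale; simpl; field; lra.
Qed.

(** Of two distinct apexes on the line one would be nearer. For a common apex, a contact of each
    wedge lies in the other, so the directions are parallel; the second side condition excludes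
    opposite ones. *)
Lemma valid_unique (a d q u q' u' : pt) :
  d <> (0, 0) ->
  valid_probe w (in_hull vs) a d q u -> valid_probe w (in_hull vs) a d q' u' ->
  q = q' /\ u = u'.
Proof.
intros Hd Hv Hv'.
assert (Eq : q = q').
{ destruct (proj1 (proj2 Hv)) as [l El]. destruct (proj1 (proj2 Hv')) as [l' El'].
  destruct (Rtotal_order l l') as [H|[H|H]].
  - exfalso. apply (valid_not_nearer a d q' u' q u (l' - l) Hd); try assumption; [lra|].
    rewrite El, El'. apply pt_eq; unfold padd, pscale; simpl; ring.
  - rewrite El, El', H. reflexivity.
  - exfalso. apply (valid_not_nearer a d q u q' u' (l - l') Hd); try assumption; [lra|].
    rewrite El, El'. apply pt_eq; unfold padd, pscale; simpl; ring. }
subst q'. split; [reflexivity|].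
assert (Hh : forall u1 u2, valid_probe w (in_hull vs) a d q u1 ->
   valid_probe w (in_hull vs) a d q u2 -> 0 <= cross u1 u2 /\ 0 <= cross u2 (rot w u1)).
{ intros u1 u2 V1 V2.
  destruct (valid_data a d q u2 V2) as [sg [rh [al [be [s1 [Hsg [_ [_ [_ [_ [H1 _]]]]]]]]]]].
  assert (HX := valid_wedge a d q u1 V1 _ H1).
  apply (in_wedge_iff w q u1 _ Hs (proj1 V1)) in HX as [X1 X2].
  replace (cross u1 _) with (sg * cross u1 u2) in X1 by (unpg; ring).
  replace (cross _ (rot w u1)) with (sg * cross u2 (rot w u1)) in X2 by (unpg; ring).
  split; nra. }
destruct (Hh u u' Hv Hv') as [H1 H2]. destruct (Hh u' u Hv' Hv) as [H3 _].
assert (Hx : cross u u' = 0).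
{ replace (cross u' u) with (- cross u u') in H3 by (unpg; ring). lra. }
assert (Hu := norm1_dot u (proj1 Hv)). assert (Hu' := norm1_dot u' (proj1 Hv')).
replace (cross u' (rot w u)) with (sin w * dot u u' - cos w * cross u u') in H2
  by (unpg; ring).
rewrite Hx in H2.
destruct u as [u1 u2], u' as [v1 v2]. unpt.
assert (Hdp : 0 <= u1 * v1 + u2 * v2) by nra.
assert (Hd1 : (u1 * v1 + u2 * v2) * (u1 * v1 + u2 * v2) = 1).
{ transitivity ((u1 * u1 + u2 * u2) * (v1 * v1 + v2 * v2) -
                (u1 * v2 - u2 * v1) * (u1 * v2 - u2 * v1)); [ring|].
  rewrite Hx, Hu, Hu'. ring. }
assert (Hd2 : u1 * v1 + u2 * v2 = 1) by nra.
assert (Hsq : Rsqr (u1 - v1) + Rsqr (u2 - v2) = 0) by (unfold Rsqr; lra).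
assert (E1 : u1 - v1 = 0) by (apply (Rplus_sqr_eq_0_l _ (u2 - v2)); exact Hsq).
rewrite Rplus_comm in Hsq.
assert (E2 : u2 - v2 = 0) by (apply (Rplus_sqr_eq_0_l _ (u1 - v1)); exact Hsq).
f_equal; lra.
Qed.

Lemma closest_unique (O : pt -> Prop) (q v x y : pt) :
  norm v = 1 -> closest_on_ray O q v x -> closest_on_ray O q v y -> x = y.
Proof.
intros Hv [Ox [[s [H0 Ex]] Hx]] [Oy [[t [Ht0 Ey]] Hy]].
assert (Hd : forall s, 0 <= s -> dist q (padd q (pscale s v)) = s).
{ intros k Hk. unfold dist, norm.
  replace (dot _ _) with (k * k * dot v v) by (unpg; ring).
  rewrite (norm1_dot v Hv), Rmult_1_r. apply sqrt_square, Hk. }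
assert (H1 : dist q x <= dist q y) by (apply Hx; [exact Oy|exists t; auto]).
assert (H2 : dist q y <= dist q x) by (apply Hy; [exact Ox|exists s; auto]).
rewrite Ex, Ey in H1, H2. rewrite !Hd in H1, H2 by assumption.
rewrite Ex, Ey. replace t with s by lra. reflexivity.
Qed.

(** This makes the run of a strategy on a good polygon deterministic. *)
Lemma answer_unique (a d : pt) (r r' : response) :
  d <> (0, 0) -> probe_answer w (in_hull vs) a d r ->
  probe_answer w (in_hull vs) a d r' -> r = r'.
Proof.
intros Hd. destruct r as [|q u p1 p2], r' as [|q' u' p1' p2']; simpl; intros H H'.
- reflexivity.
- exfalso. apply (H q' u'). tauto.
- exfalso. apply (H' q u). tauto.
- destruct H as [V [C1 C2]], H' as [V' [C1' C2']].
  destruct (valid_unique a d q u q' u' Hd V V') as [<- <-].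
  assert (Hu : norm u = 1) by apply V.
  rewrite (closest_unique _ _ _ _ _ Hu C1 C1').
  rewrite (closest_unique _ _ _ _ _ (rot_norm w u Hu) C2 C2'). reflexivity.
Qed.

End Probes.

(** * Existence of a valid probe along every line meeting the polygon *)

Definition lmin (f : pt -> R) (v0 : pt) (l : list pt) : R :=
  fold_right (fun v m => Rmin (f v) m) (f v0) l.

Lemma lmin_le (f : pt -> R) (v0 v : pt) (l : list pt) :
  In v (v0 :: l) -> lmin f v0 l <= f v.
Proof.
unfold lmin. induction l as [|a l IH]; simpl.
- intros [->|[]]. lra.
- intros [->|[->|H]].
  + apply Rle_trans with (2 := IH (or_introl eq_refl)). apply Rmin_r.
  + apply Rmin_l.
  + apply Rle_trans with (2 := IH (or_intror H)). apply Rmin_r.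
Qed.

Lemma lmin_attained (f : pt -> R) (v0 : pt) (l : list pt) :
  exists v, In v (v0 :: l) /\ lmin f v0 l = f v.
Proof.
unfold lmin. induction l as [|a l IH]; simpl.
- exists v0. auto.
- destruct IH as [v [Hv E]]. destruct (Rmin_case_strong (f a) (fold_right (fun v m => Rmin (f v) m) (f v0) l)
    (fun m => m = f a \/ m = f v)) as [H|H]; auto.
  + exists a. auto.
  + exists v. destruct Hv; auto.
Qed.

Lemma Rmin_abs (x y : R) : Rmin x y = (x + y - Rabs (x - y)) / 2.
Proof.
unfold Rmin. destruct (Rle_dec x y).
- rewrite Rabs_left1; lra.
- rewrite Rabs_pos_eq; lra.
Qed.

Lemma lmin_continuity (F : pt -> R -> R) (v0 : pt) (l : list pt) :
  (forall v, continuity (F v)) -> continuity (fun t => lmin (fun v => F v t) v0 l).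
Proof.
intros H. induction l as [|a l IH]; simpl; [apply H|].
set (G := fun t => lmin (fun v => F v t) v0 l) in *.
assert (E : forall t, (F a t + G t - Rabs (F a t - G t)) * / 2 =
                      lmin (fun v => F v t) v0 (a :: l)).
{ intros t. symmetry. apply Rmin_abs. }
intros t. apply (continuity_pt_ext (fun t => (F a t + G t - Rabs (F a t - G t)) * / 2)).
- exact E.
- apply continuity_pt_mult; [|apply continuity_pt_const; intros ? ?; reflexivity].
  apply continuity_pt_minus; [apply continuity_pt_plus; [apply H|apply IH]|].
  apply (continuity_pt_comp (fun t => F a t - G t) Rabs).
  + apply continuity_pt_minus; [apply H|apply IH].
  + apply Rcontinuity_abs.
Qed.

(* Rotating the tangent wedge, its apex moves continuously from one side of the
   line to the other while the direction of the line stays in the wedge. *)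
Lemma probe_exists (w : R) (vs : list pt) (a d x0 : pt) :
  0 < w <= PI / 2 -> d <> (0, 0) -> hull vs x0 -> cross d (psub x0 a) = 0 ->
  exists q u, valid_probe w (in_hull vs) a d q u.
Proof.
intros Hw Hd Hx0 Hl. destruct (sin_bounds w Hw) as [Hs Hc].
destruct vs as [|v0 l]; [elim (hull_nil x0 Hx0)|].
set (vs := v0 :: l) in *.
assert (HD := dot_pos d Hd).
set (D := sqrt (dot d d)).
assert (HD0 : 0 < D) by (apply sqrt_lt_R0; exact HD).
assert (HDD : D * D = dot d d) by (apply sqrt_sqrt; lra).
set (e := pscale (/ D) d).
assert (Ed : d = pscale D e).
{ unfold e. apply pt_eq; unfold pscale; simpl; field; lra. }
assert (He : dot e e = 1).
{ unfold e. transitivity (dot d d / (D * D)); [unpg; field; lra|rewrite HDD; field; lra]. }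
assert (Hxe : cross e (psub x0 a) = 0).
{ rewrite Ed in Hl. replace (cross _ _) with (D * cross e (psub x0 a)) in Hl by (unpg; ring).
  nra. }
(* Support values of the polygon: [m1] and [m2] are the offsets of the tangent lines carrying the
   two rays when the first has direction [rot t e]. *)
set (m1 := fun t => lmin (fun v => cross (rot t e) v) v0 l).
set (m2 := fun t => lmin (fun v => cross v (rot w (rot t e))) v0 l).
assert (C1 : continuity m1).
{ apply (lmin_continuity (fun v t => cross (rot t e) v)). intros v.
  unfold cross, rot. simpl. reg. }
assert (C2 : continuity m2).
{ apply (lmin_continuity (fun v t => cross v (rot w (rot t e)))). intros v.
  unfold cross, rot. simpl. reg. }
(* Up to the factor [sin w], the signed distance of the apex from the given line. The first ray is
   parallel to the line at [t = 0], the second at [t = - w]; as the line meets the polygon, the apex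
   is then on opposite sides, or on the line. *)
set (h := fun t => m2 t * sin t + m1 t * sin (t + w) - sin w * cross e a).
assert (Ch : continuity h).
{ unfold h. intros t. apply continuity_pt_minus.
  - apply continuity_pt_plus; apply continuity_pt_mult; try apply C1; try apply C2; reg.
  - apply continuity_pt_const. intros ? ?. reflexivity. }
assert (Hlow : h 0 <= 0).
{ assert (Hv : exists v, In v vs /\ cross e (psub v a) <= 0).
  { apply NNPP. intros Hn.
    assert (0 < cross e (psub x0 a)); [|lra].
    apply (hull_gt vs (fun x => cross e (psub x a))); [apply affine_cross_l| |exact Hx0].
    intros v Hv. apply Rnot_le_lt. intros Hle. apply Hn. exists v. auto. }
  destruct Hv as [v [Hv Hle]].
  assert (H1 : m1 0 <= cross (rot 0 e) v) by
    apply (lmin_le (fun v => cross (rot 0 e) v) v0 v l Hv).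
  unfold h. rewrite sin_0, Rplus_0_l.
  replace (cross (rot 0 e) v) with (cross e v) in H1
    by (unfold cross, rot; simpl; rewrite sin_0, cos_0; ring).
  replace (cross e (psub v a)) with (cross e v - cross e a) in Hle by (unpg; ring).
  nra. }
assert (Hhigh : 0 <= h (- w)).
{ assert (Hv : exists v, In v vs /\ 0 <= cross e (psub v a)).
  { apply NNPP. intros Hn.
    assert (0 < - cross e (psub x0 a)); [|lra].
    apply (hull_gt vs (fun x => - cross e (psub x a))); [apply affine_cross_l_opp| |exact Hx0].
    intros v Hv. apply Rnot_le_lt. intros Hle. apply Hn. exists v. split; [exact Hv|lra]. }
  destruct Hv as [v [Hv Hle]].
  assert (H1 : m2 (- w) <= cross v (rot w (rot (- w) e))) by
    apply (lmin_le (fun v => cross v (rot w (rot (- w) e))) v0 v l Hv).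
  unfold h. replace (- w + w) with 0 by ring. rewrite sin_0, sin_neg.
  replace (cross v (rot w (rot (- w) e))) with
     (- ((sin w * sin w + cos w * cos w) * cross e v)) in H1
    by (unfold cross, rot; simpl; rewrite sin_neg, cos_neg; ring).
  rewrite sc1 in H1.
  replace (cross e (psub v a)) with (cross e v - cross e a) in Hle by (unpg; ring).
  nra. }
destruct (IVT_cor h (- w) 0 Ch) as [t [Ht H0]]; [lra|nra|].
set (u := rot t e) in *. set (r := rot w u).
assert (Hu : dot u u = 1) by (unfold u; rewrite rot_dot; exact He).
assert (Hun : norm u = 1) by (apply dot1_norm; exact Hu).
(* The intersection of the two tangent lines, by Cramer's rule. *)
set (q := padd (pscale (m2 t / sin w) u) (pscale (m1 t / sin w) r)).
assert (Hq1 : forall v, cross u (psub v q) = cross u v - m1 t).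
{ intros v. unfold q. transitivity (cross u v - m1 t / sin w * cross u r).
  - unfold r. unpg. ring.
  - unfold r. rewrite cross_rot, Hu. field. lra. }
assert (Hq2 : forall v, cross (psub v q) r = cross v r - m2 t).
{ intros v. unfold q. transitivity (cross v r - m2 t / sin w * cross u r).
  - unfold r. unpg. ring.
  - unfold r. rewrite cross_rot, Hu. field. lra. }
assert (Hwd : forall v, In v vs -> in_wedge w q u v).
{ intros v Hv. apply in_wedge_iff; try assumption. fold r. rewrite Hq1, Hq2. split.
  - assert (m1 t <= cross u v) by apply (lmin_le (fun v => cross (rot t e) v) v0 v l Hv).
    lra.
  - assert (m2 t <= cross v r) by
      apply (lmin_le (fun v => cross v (rot w (rot t e))) v0 v l Hv).
    lra. }
assert (Ceu : cross e u = sin t).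
{ unfold u. rewrite cross_rot, He. ring. }
assert (Cer : cross e r = sin (t + w)).
{ rewrite sin_plus. transitivity ((sin t * cos w + cos t * sin w) * dot e e).
  - unfold r, u. unpg. ring.
  - rewrite He. ring. }
assert (Hqa : cross e (psub q a) = 0).
{ apply (Rmult_eq_reg_l (sin w)); [|lra]. rewrite Rmult_0_r, <- H0.
  unfold h. rewrite <- Ceu, <- Cer. unfold q. unpg. field. lra. }
set (lam := dot e (psub q a)).
assert (Eq : q = padd a (pscale (lam / D) d)).
{ rewrite Ed. clearbody q e. unfold lam. destruct q as [q1 q2], a as [a1 a2], e as [e1 e2].
  unpt. apply pt_eq; simpl.
  - transitivity (a1 + (e1 * (q1 - a1) + e2 * (q2 - a2)) * e1); [|field; lra].
    assert (E1 : (q1 - a1) * (e1 * e1 + e2 * e2) =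
      (e1 * (q1 - a1) + e2 * (q2 - a2)) * e1 - e2 * (e1 * (q2 - a2) - e2 * (q1 - a1))) by ring.
    rewrite He, Hqa in E1. lra.
  - transitivity (a2 + (e1 * (q1 - a1) + e2 * (q2 - a2)) * e2); [|field; lra].
    assert (E1 : (q2 - a2) * (e1 * e1 + e2 * e2) =
      (e1 * (q1 - a1) + e2 * (q2 - a2)) * e2 + e1 * (e1 * (q2 - a2) - e2 * (q1 - a1))) by ring.
    rewrite He, Hqa in E1. lra. }
assert (Hx0q : exists s, x0 = padd q (pscale s d)).
{ exists (dot e (psub x0 q) / D). rewrite Ed.
  assert (Hx0q : cross e (psub x0 q) = 0).
  { replace (cross e (psub x0 q)) with (cross e (psub x0 a) - cross e (psub q a))
      by (unpg; ring). lra. }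
  clearbody q e. destruct q as [q1 q2], x0 as [x1 x2], e as [e1 e2].
  unfold dot, psub, padd, pscale, cross in *. simpl in *. apply pt_eq; simpl.
  - transitivity (q1 + (e1 * (x1 - q1) + e2 * (x2 - q2)) * e1); [|field; lra].
    assert (E1 : (x1 - q1) * (e1 * e1 + e2 * e2) =
      (e1 * (x1 - q1) + e2 * (x2 - q2)) * e1 - e2 * (e1 * (x2 - q2) - e2 * (x1 - q1))) by ring.
    rewrite He, Hx0q in E1. lra.
  - transitivity (q2 + (e1 * (x1 - q1) + e2 * (x2 - q2)) * e2); [|field; lra].
    assert (E1 : (x2 - q2) * (e1 * e1 + e2 * e2) =
      (e1 * (x1 - q1) + e2 * (x2 - q2)) * e2 + e1 * (e1 * (x2 - q2) - e2 * (x1 - q1))) by ring.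
    rewrite He, Hx0q in E1. lra. }
exists q, u. split; [exact Hun|]. split; [exists (lam / D); exact Eq|].
split.
{ intros x Hx. apply hull_iff in Hx. apply (wedge_hull w q u x vs Hs Hun Hwd Hx). }
split.
{ destruct (lmin_attained (fun v => cross (rot t e) v) v0 l) as [v [Hv E]].
  exists v. split; [apply hull_iff, hull_in, Hv|].
  destruct (proj1 (in_wedge_iff w q u v Hs Hun) (Hwd v Hv)) as [_ H2].
  apply (wedge_on_ray1 w); try assumption. rewrite Hq1.
  replace (m1 t) with (cross u v) by (symmetry; exact E). ring. }
split.
{ destruct (lmin_attained (fun v => cross v (rot w (rot t e))) v0 l) as [v [Hv E]].
  exists v. split; [apply hull_iff, hull_in, Hv|].
  destruct (proj1 (in_wedge_iff w q u v Hs Hun) (Hwd v Hv)) as [H1 _].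
  apply (wedge_on_ray2 w); try assumption. fold r. rewrite Hq2.
  replace (m2 t) with (cross v r) by (symmetry; exact E). ring. }
destruct Hx0q as [s Es]. exists s. split; [|rewrite <- Es; apply hull_iff, Hx0].
(* For [t] in [[- w, 0]] the direction [e] points into the wedge. If the hull point were behind the
   apex, both [sin t] and [sin (t + w)] would vanish. *)
apply Rnot_lt_le. intros Hneg.
assert (Hx := wedge_hull w q u x0 vs Hs Hun Hwd Hx0).
apply in_wedge_iff in Hx as [H1 H2]; try assumption. fold r in H2.
rewrite Es, Ed in H1, H2.
replace (cross u _) with (- (s * D * cross e u)) in H1 by (unpg; ring).
replace (cross _ r) with (s * D * cross e r) in H2 by (unpg; ring).
rewrite Ceu in H1. rewrite Cer in H2.
assert (Hsd : s * D < 0) by nra.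
assert (Hst : 0 <= sin t) by nra.
assert (Hst' : sin t <= 0).
{ replace t with (- - t) by ring. rewrite sin_neg.
  assert (0 <= sin (- t)); [apply sin_ge_0; lra|lra]. }
assert (Hstw : 0 <= sin (t + w)) by (apply sin_ge_0; lra).
assert (Hstw' : sin (t + w) = 0) by nra.
assert (Hst0 : sin t = 0) by lra.
rewrite sin_plus, Hst0 in Hstw'.
assert (E := sc1 t). rewrite Hst0 in E.
assert (cos t = 0) by nra. rewrite H in E. lra.
Qed.

(** * Probes flush with an edge *)

(** The non-flush answers, tested on vertices only: each ray touches a single vertex, and a missed
    line has the polygon strictly on one side. All other vertices satisfy strict inequalities, which
    small changes preserve. *)
Definition strict (w : R) (vs : list pt) (a d : pt) (r : response) : Prop :=
  match r with
  | Miss => (forall v, In v vs -> 0 < cross d (psub v a)) \/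
            (forall v, In v vs -> 0 < cross (psub v a) d)
  | Hit q u p1 p2 =>
      norm u = 1 /\ (exists lam, q = padd a (pscale lam d)) /\
      (In p1 vs /\ on_ray q u p1 /\
        forall v, In v vs -> v <> p1 -> 0 < cross u (psub v q)) /\
      (In p2 vs /\ on_ray q (rot w u) p2 /\
        forall v, In v vs -> v <> p2 -> 0 < cross (psub v q) (rot w u)) /\
      (exists s, 0 <= s /\ hull vs (padd q (pscale s d)))
  end.

Definition flush (w : R) (r : response) (x y : pt) : Prop :=
  match r with
  | Miss => False
  | Hit q u _ _ =>
      (cross u (psub x q) = 0 /\ cross u (psub y q) = 0) \/
      (cross (psub x q) (rot w u) = 0 /\ cross (psub y q) (rot w u) = 0)
  end.

Definition contacts (r : response) : list pt :=
  match r with Miss => [] | Hit _ _ p1 p2 => [p1; p2] end.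

Lemma strict_not_flush (w : R) (vs : list pt) (a d : pt) (r : response) (x y : pt) :
  strict w vs a d r -> In x vs -> In y vs -> x <> y -> ~ flush w r x y.
Proof.
destruct r as [|q u p1 p2]; simpl; [tauto|].
intros [_ [_ [[_ [_ H1]] [[_ [_ H2]] _]]]] Hx Hy Hne [[E1 E2]|[E1 E2]].
- assert (x = p1) by (apply NNPP; intros Hn; specialize (H1 x Hx Hn); lra).
  assert (y = p1) by (apply NNPP; intros Hn; specialize (H1 y Hy Hn); lra).
  congruence.
- assert (x = p2) by (apply NNPP; intros Hn; specialize (H2 x Hx Hn); lra).
  assert (y = p2) by (apply NNPP; intros Hn; specialize (H2 y Hy Hn); lra).
  congruence.
Qed.

Lemma strict_nonneg (f : pt -> R) (vs : list pt) (p : pt) :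
  f p = 0 -> (forall v, In v vs -> v <> p -> 0 < f v) ->
  forall v, In v vs -> 0 <= f v.
Proof.
intros E H v Hv. destruct (classic (v = p)) as [->|Hn]; [lra|].
apply Rlt_le, H; assumption.
Qed.

(** A ray that meets the vertices in one point meets the hull only there, so this contact is the
    closest one. *)
Lemma strict_answer (w : R) (vs : list pt) (a d : pt) (r : response) :
  0 < w <= PI / 2 -> strict w vs a d r -> probe_answer w (in_hull vs) a d r.
Proof.
intros Hw. destruct (sin_bounds w Hw) as [Hs _]. destruct r as [|q u p1 p2]; simpl.
- intros H q u [_ [[lam ->] [_ [_ [_ [s [_ Hx]]]]]]]. apply hull_iff in Hx.
  set (x := padd _ _) in Hx.
  assert (E : cross d (psub x a) = 0) by (unfold x; unpg; ring).
  destruct H as [H|H].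
  + assert (Hp : 0 < cross d (psub x a)); [|lra].
    apply (hull_gt vs (fun x => cross d (psub x a)));
      [apply affine_cross_l|exact H|exact Hx].
  + assert (Hp : 0 < cross (psub x a) d).
    { apply (hull_gt vs (fun x => cross (psub x a) d));
        [apply affine_cross_r|exact H|exact Hx]. }
    unfold x in Hp. unpt. lra.
- intros [Hu [Hq [[I1 [R1 H1]] [[I2 [R2 H2]] [s [Hs0 Hz]]]]]].
  assert (E1 := on_ray_cross _ _ _ R1). assert (E2 := on_ray_cross_r _ _ _ R2).
  assert (Hin1 : in_hull vs p1) by (apply hull_iff, hull_in, I1).
  assert (Hin2 : in_hull vs p2) by (apply hull_iff, hull_in, I2).
  assert (Hwd : forall v, In v vs -> in_wedge w q u v).
  { intros v Hv. apply in_wedge_iff; try assumption. split.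
    - apply (strict_nonneg (fun v => cross u (psub v q)) vs p1); assumption.
    - apply (strict_nonneg (fun v => cross (psub v q) (rot w u)) vs p2); assumption. }
  split; [|split].
  + split; [exact Hu|]. split; [exact Hq|]. split.
    { intros x Hx. apply hull_iff in Hx. apply (wedge_hull w q u x vs); assumption. }
    split; [exists p1; auto|]. split; [exists p2; auto|].
    exists s. split; [exact Hs0|apply hull_iff, Hz].
  + split; [exact Hin1|]. split; [exact R1|]. intros y Hy Ry. apply hull_iff in Hy.
    replace y with p1; [lra|]. symmetry.
    apply (hull_face_unique vs (fun v => cross u (psub v q)));
      [apply affine_cross_l|lra|exact H1|exact Hy|apply on_ray_cross, Ry].
  + split; [exact Hin2|]. split; [exact R2|]. intros y Hy Ry. apply hull_iff in Hy.
    replace y with p2; [lra|]. symmetry.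
    apply (hull_face_unique vs (fun v => cross (psub v q) (rot w u)));
      [apply affine_cross_r|lra|exact H2|exact Hy|apply on_ray_cross_r, Ry].
Qed.

Lemma collinear_on_line (e q x y : pt) :
  0 < dot e e -> cross e (psub x q) = 0 -> cross e (psub y q) = 0 ->
  exists s, y = padd x (pscale s e).
Proof.
intros He Hx Hy. exists (dot e (psub y x) / dot e e).
destruct e as [e1 e2], q as [q1 q2], x as [x1 x2], y as [y1 y2]. unpt.
assert (E : e1 * (y2 - x2) - e2 * (y1 - x1) = 0) by lra.
apply pt_eq; simpl; apply (Rmult_eq_reg_r (e1 * e1 + e2 * e2)); try lra.
- transitivity (x1 * (e1 * e1 + e2 * e2) + (e1 * (y1 - x1) + e2 * (y2 - x2)) * e1);
    [|field; lra].
  assert (e2 * (e1 * (y2 - x2) - e2 * (y1 - x1)) = 0) by (rewrite E; ring). lra.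
- transitivity (x2 * (e1 * e1 + e2 * e2) + (e1 * (y1 - x1) + e2 * (y2 - x2)) * e2);
    [|field; lra].
  assert (e1 * (e1 * (y2 - x2) - e2 * (y1 - x1)) = 0) by (rewrite E; ring). lra.
Qed.

(** Adding such a point [z] to the polygon leaves the answer unchanged. *)
Definition away (w : R) (vs : list pt) (a d : pt) (r : response) (z : pt) : Prop :=
  match r with
  | Miss => ((forall v, In v vs -> 0 < cross d (psub v a)) /\ 0 < cross d (psub z a)) \/
            ((forall v, In v vs -> 0 < cross (psub v a) d) /\ 0 < cross (psub z a) d)
  | Hit q u _ _ => 0 < cross u (psub z q) /\ 0 < cross (psub z q) (rot w u)
  end.

Lemma ev_lin (x y : R) : 0 < x -> ev (fun t => 0 < x - t * y).
Proof. intros H. apply ev_pos; [auto_derive; exact I|]. rewrite Rmult_0_l. lra. Qed.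

Lemma ev_cross_l (e q z N : pt) : 0 < cross e (psub z q) ->
  ev (fun t => 0 < cross e (psub (psub z (pscale t N)) q)).
Proof.
intros H. apply (ev_impl (fun t => 0 < cross e (psub z q) - t * cross e N)).
- intros t _ Ht. replace (cross e (psub (psub z _) q)) with
   (cross e (psub z q) - t * cross e N) by (unpg; ring). exact Ht.
- apply ev_lin, H.
Qed.

Lemma ev_cross_r (e q z N : pt) : 0 < cross (psub z q) e ->
  ev (fun t => 0 < cross (psub (psub z (pscale t N)) q) e).
Proof.
intros H. apply (ev_impl (fun t => 0 < cross (psub z q) e - t * cross N e)).
- intros t _ Ht. replace (cross (psub (psub z _) q) e) with
   (cross (psub z q) e - t * cross N e) by (unpg; ring). exact Ht.
- apply ev_lin, H.
Qed.

Lemma away_ev (w : R) (vs : list pt) (a d : pt) (r : response) (z N : pt) :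
  away w vs a d r z -> ev (fun t => away w vs a d r (psub z (pscale t N))).
Proof.
destruct r as [|q u p1 p2]; simpl.
- intros [[H1 H2]|[H1 H2]].
  + apply (ev_impl (fun t => 0 < cross d (psub (psub z (pscale t N)) a))); [auto|].
    apply ev_cross_l, H2.
  + apply (ev_impl (fun t => 0 < cross (psub (psub z (pscale t N)) a) d)); [auto|].
    apply ev_cross_r, H2.
- intros [H1 H2]. apply ev_and; [apply ev_cross_l|apply ev_cross_r]; assumption.
Qed.

(** Contact vertices must survive, but others may disappear; this freedom is what permits moving a
    vertex. *)
Lemma strict_extend (w : R) (vs vs' : list pt) (a d : pt) (r : response) (z : pt) :
  strict w vs a d r -> away w vs a d r z ->
  (forall v, In v vs' -> In v vs \/ v = z) ->
  (forall v, In v vs -> In v (contacts r) -> In v vs') ->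
  (forall x, hull vs x -> hull vs' x) ->
  strict w vs' a d r.
Proof.
destruct r as [|q u p1 p2]; simpl.
- intros _ H Hi _ _. destruct H as [[H1 H2]|[H1 H2]]; [left|right];
  intros v Hv; destruct (Hi v Hv) as [Hv'| ->]; auto.
- intros [Hu [Hq [[I1 [R1 H1]] [[I2 [R2 H2]] [s [Hs0 Hz]]]]]] [A1 A2] Hi Hk Hh.
  split; [exact Hu|]. split; [exact Hq|]. split; [|split].
  + split; [apply Hk; auto|]. split; [exact R1|].
    intros v Hv Hn. destruct (Hi v Hv) as [Hv'| ->]; auto.
  + split; [apply Hk; auto|]. split; [exact R2|].
    intros v Hv Hn. destruct (Hi v Hv) as [Hv'| ->]; auto.
  + exists s. auto.
Qed.

(** The version for answers that may be flush with some edge: as [z] is off both rays, the faces of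
    the new hull on the rays are those of the old one, and so are the closest points. *)
Lemma hit_extend (w : R) (vs vs' : list pt) (a d q u p1 p2 z : pt) :
  0 < w <= PI / 2 ->
  probe_answer w (in_hull vs) a d (Hit q u p1 p2) ->
  away w vs a d (Hit q u p1 p2) z ->
  (forall v, In v vs' -> In v vs \/ v = z) ->
  (forall x, hull vs x -> hull vs' x) ->
  probe_answer w (in_hull vs') a d (Hit q u p1 p2).
Proof.
intros Hw [[Hu [Hq [Hwd [[x1 [X1 R1]] [[x2 [X2 R2]] [s [Hs0 Hz]]]]]]] [C1 C2]] [A1 A2] Hi Hh.
destruct (sin_bounds w Hw) as [Hs _].
assert (Hh' : forall x, in_hull vs x -> in_hull vs' x).
{ intros x Hx. apply hull_iff, Hh, hull_iff, Hx. }
assert (Hwv : forall v, In v vs' -> in_wedge w q u v).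
{ intros v Hv. destruct (Hi v Hv) as [Hv'| ->].
  - apply Hwd, hull_iff, hull_in, Hv'.
  - apply in_wedge_iff; try assumption. split; lra. }
simpl. split; [|split].
- split; [exact Hu|]. split; [exact Hq|]. split.
  { intros x Hx. apply hull_iff in Hx. apply (wedge_hull w q u x vs'); assumption. }
  split; [exists x1; auto|]. split; [exists x2; auto|]. exists s. auto.
- destruct C1 as [P1 [Q1 M1]]. split; [auto|]. split; [exact Q1|].
  intros y Hy Ry. apply M1; [|exact Ry]. apply hull_iff. apply hull_iff in Hy.
  apply (hull_face vs' vs (fun v => cross u (psub v q)));
    [apply affine_cross_l| | |exact Hy|apply on_ray_cross, Ry].
  + intros v Hv. apply (in_wedge_iff w q u v Hs Hu), Hwv, Hv.
  + intros v Hv E. destruct (Hi v Hv) as [Hv'| ->]; [exact Hv'|lra].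
- destruct C2 as [P2 [Q2 M2]]. split; [auto|]. split; [exact Q2|].
  intros y Hy Ry. apply M2; [|exact Ry]. apply hull_iff. apply hull_iff in Hy.
  apply (hull_face vs' vs (fun v => cross (psub v q) (rot w u)));
    [apply affine_cross_r| | |exact Hy|apply on_ray_cross_r, Ry].
  + intros v Hv. apply (in_wedge_iff w q u v Hs Hu), Hwv, Hv.
  + intros v Hv E. destruct (Hi v Hv) as [Hv'| ->]; [exact Hv'|lra].
Qed.

Section Flush.
Variables (w rho : R) (vs : list pt).
Hypothesis Hw : 0 < w <= PI / 2.
Hypothesis Hg : good w rho vs.

Let Hs : 0 < sin w := proj1 (sin_bounds w Hw).

(** A third vertex, to the left of both the line and the edge, forces their directions to agree. *)
Lemma edge_on_line (e q x y : pt) :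
  0 < dot e e -> (forall v, In v vs -> 0 <= cross e (psub v q)) -> edge vs x y ->
  cross e (psub x q) = 0 -> cross e (psub y q) = 0 ->
  exists s, 0 < s /\ y = padd x (pscale s e).
Proof.
intros He Hv [_ [_ [Hne Hz]]] Ex Ey.
destruct (collinear_on_line e q x y He Ex Ey) as [s Es].
exists s. split; [|exact Es].
destruct (good_third w rho vs Hg x y) as [z [Iz [Zx Zy]]].
specialize (Hz z Iz Zx Zy). specialize (Hv z Iz).
unfold orient in Hz. rewrite Es in Hz.
replace (cross _ _) with (s * (cross e (psub z q) - cross e (psub x q))) in Hz
  by (unpg; ring).
rewrite Ex in Hz. nra.
Qed.

(** Two vertices on a supporting line already form an edge: no third vertex is collinear with them,
    and all lie on one side. *)
Lemma support_cases (e q : pt) :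
  0 < dot e e -> (forall v, In v vs -> 0 <= cross e (psub v q)) ->
  (exists v, In v vs /\ cross e (psub v q) = 0) ->
  (exists x y, edge vs x y /\ cross e (psub x q) = 0 /\ cross e (psub y q) = 0) \/
  (exists b, In b vs /\ cross e (psub b q) = 0 /\
     forall v, In v vs -> v <> b -> 0 < cross e (psub v q)).
Proof.
intros He Hv [b [Ib Eb]].
destruct (classic (exists b', In b' vs /\ b' <> b /\ cross e (psub b' q) = 0))
  as [[b' [Ib' [Hne Eb']]]|Hn].
- left.
  assert (Hmain : forall x y s, In x vs -> In y vs -> x <> y -> 0 < s ->
     cross e (psub x q) = 0 -> y = padd x (pscale s e) -> edge vs x y).
  { intros x y s Ix Iy Hxy Hs0 Ex Es. repeat split; try assumption.
    intros z Iz Zx Zy.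
    assert (Hnz : orient x y z <> 0).
    { apply (ccw_orient_neq vs); try assumption; [apply Hg|congruence|congruence]. }
    assert (E : orient x y z = s * (cross e (psub z q) - cross e (psub x q))).
    { unfold orient. rewrite Es. unpg. ring. }
    specialize (Hv z Iz). rewrite Ex in E. nra. }
  destruct (collinear_on_line e q b b' He Eb Eb') as [s Es].
  destruct (Rtotal_order s 0) as [H|[H|H]].
  + exists b', b. split; [|auto]. apply (Hmain b' b (- s)); try assumption; [lra|].
    rewrite Es. apply pt_eq; unfold padd, pscale; simpl; ring.
  + exfalso. apply Hne. rewrite Es, H. apply pt_eq; unfold padd, pscale; simpl; ring.
  + exists b, b'. split; [|auto]. apply (Hmain b b' s); try assumption. congruence.
- right. exists b. split; [exact Ib|]. split; [exact Eb|].
  intros v Iv Hne. destruct (Hv v Iv) as [H|H]; [exact H|].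
  exfalso. apply Hn. exists v. auto.
Qed.

Lemma valid_side1 (a d q u v : pt) : valid_probe w (in_hull vs) a d q u ->
  In v vs -> 0 <= cross u (psub v q).
Proof.
intros V Hv. apply (in_wedge_iff w q u v Hs (proj1 V)).
apply V, hull_iff, hull_in, Hv.
Qed.

Lemma valid_side2 (a d q u v : pt) : valid_probe w (in_hull vs) a d q u ->
  In v vs -> 0 <= cross (psub v q) (rot w u).
Proof.
intros V Hv. apply (in_wedge_iff w q u v Hs (proj1 V)).
apply V, hull_iff, hull_in, Hv.
Qed.

(** The polygon lies to the right of the second ray; reversing the direction makes results for the
    left side applicable. *)
Definition opp (u : pt) : pt := pscale (-1) u.

Lemma cross_opp (u x : pt) : cross (opp u) x = cross x u.
Proof. unfold opp. unpg. ring. Qed.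

Lemma dot_opp (u : pt) : dot (opp u) (opp u) = dot u u.
Proof. unfold opp. unpg. ring. Qed.

(** The two edges would have directions [u] and [opp (rot w u)], which genericity forbids. *)
Lemma not_both_flush (a d q u x y x' y' : pt) :
  valid_probe w (in_hull vs) a d q u ->
  edge vs x y -> cross u (psub x q) = 0 -> cross u (psub y q) = 0 ->
  edge vs x' y' -> cross (psub x' q) (rot w u) = 0 -> cross (psub y' q) (rot w u) = 0 ->
  False.
Proof.
intros V E Ex Ey E' Ex' Ey'. assert (Hu := norm1_dot u (proj1 V)).
destruct (edge_on_line u q x y) as [s [_ Es]]; try assumption; [lra| |].
{ intros v Hv. apply (valid_side1 a d q u v V Hv). }
destruct (edge_on_line (opp (rot w u)) q x' y') as [s' [_ Es']]; try assumption.
{ rewrite dot_opp, rot_dot. lra. }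
{ intros v Hv. rewrite cross_opp. apply (valid_side2 a d q u v V Hv). }
{ rewrite cross_opp. exact Ex'. }
{ rewrite cross_opp. exact Ey'. }
apply (good_generic _ _ _ Hg x y x' y' E E'). rewrite Es, Es'. unfold opp. unpg. ring.
Qed.

(** Edges on different rays are excluded by genericity. A supporting line containing an edge has
    only its two ends as vertices, and their order is fixed by the side of the polygon. *)
Lemma flush_unique (a d : pt) (r : response) (x y x' y' : pt) :
  probe_answer w (in_hull vs) a d r -> edge vs x y -> edge vs x' y' ->
  flush w r x y -> flush w r x' y' -> x = x'.
Proof.
destruct r as [|q u p1 p2]; [intros _ _ _ []|]. intros [V _] E E' F F'.
assert (Hu := norm1_dot u (proj1 V)).
assert (Hsame : forall e, 0 < dot e e -> (forall v, In v vs -> 0 <= cross e (psub v q)) ->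
  cross e (psub x q) = 0 -> cross e (psub y q) = 0 ->
  cross e (psub x' q) = 0 -> cross e (psub y' q) = 0 -> x = x').
{ intros e He Hv Ex Ey Ex' Ey'.
  destruct (edge_on_line e q x y He Hv E Ex Ey) as [s [Hs0 Es]].
  assert (Hin : forall v, In v vs -> cross e (psub v q) = 0 -> v = x \/ v = y).
  { intros v Iv Ev. apply NNPP. intros Hn.
    assert (Ho : 0 < orient x y v).
    { destruct E as [_ [_ [_ Hz]]]. apply Hz; [exact Iv| |]; intros ->; apply Hn; auto. }
    unfold orient in Ho. rewrite Es in Ho.
    replace (cross _ _) with (s * (cross e (psub v q) - cross e (psub x q))) in Ho
      by (unpg; ring).
    rewrite Ev, Ex in Ho. lra. }
  destruct (Hin x' (proj1 E') Ex') as [->| ->]; [reflexivity|].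
  destruct (Hin y' (proj1 (proj2 E')) Ey') as [->| ->].
  - exfalso. destruct (good_third w rho vs Hg x y) as [z [Iz [Zx Zy]]].
    destruct E as [_ [_ [_ Hz]]], E' as [_ [_ [_ Hz']]].
    specialize (Hz z Iz Zx Zy). specialize (Hz' z Iz Zy Zx).
    unfold orient in *. unpt. lra.
  - exfalso. apply E'. reflexivity. }
destruct F as [[F1 F2]|[F1 F2]], F' as [[F1' F2']|[F1' F2']].
- apply (Hsame u); try assumption; [lra|]. intros v. apply (valid_side1 a d q u v V).
- exfalso. apply (not_both_flush a d q u x y x' y'); assumption.
- exfalso. apply (not_both_flush a d q u x' y' x y); assumption.
- apply (Hsame (opp (rot w u))); rewrite ?cross_opp; try assumption.
  + rewrite dot_opp, rot_dot. lra.
  + intros v Hv. rewrite cross_opp. apply (valid_side2 a d q u v V Hv).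
Qed.

(** Vertices on both sides of the line, or on it, give a hull point on the line by mixing, and then
    a valid probe exists. *)
Lemma miss_strict (a d : pt) :
  d <> (0, 0) -> probe_answer w (in_hull vs) a d Miss -> strict w vs a d Miss.
Proof.
intros Hd Hm. simpl in *. apply NNPP. intros Hn. apply not_or_and in Hn as [H1 H2].
apply not_all_ex_not in H1 as [x Hx]. apply not_all_ex_not in H2 as [y Hy].
apply imply_to_and in Hx as [Ix Hx]. apply imply_to_and in Hy as [Iy Hy].
replace (cross (psub y a) d) with (- cross d (psub y a)) in Hy by (unpg; ring).
set (fx := cross d (psub x a)) in *. set (fy := cross d (psub y a)) in *.
assert (Hz : exists t, 0 <= t <= 1 /\ (1 - t) * fx + t * fy = 0).
{ destruct (Req_dec fx 0) as [E|E]; [exists 0; split; [lra|rewrite E; ring]|].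
  exists (- fx / (fy - fx)). split; [split|].
  - apply Rdiv_le_0_compat; lra.
  - apply (Rmult_le_reg_r (fy - fx)); [lra|]. unfold Rdiv. rewrite Rmult_assoc, Rinv_l; lra.
  - field. lra. }
destruct Hz as [t [Ht E]].
destruct (probe_exists w vs a d (mix t x y) Hw Hd) as [q [u V]].
- apply hull_mix; [apply hull_in, Ix|apply hull_in, Iy|exact Ht].
- rewrite (affine_cross_l d a). exact E.
- exact (Hm q u V).
Qed.

Lemma answer_cases (a d : pt) (r : response) :
  d <> (0, 0) -> probe_answer w (in_hull vs) a d r ->
  strict w vs a d r \/ exists x y, edge vs x y /\ flush w r x y.
Proof.
intros Hd. destruct r as [|q u p1 p2].
{ intros H. left. apply miss_strict; assumption. }
intros [V [C1 C2]]. assert (Hu := norm1_dot u (proj1 V)).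
assert (S1 := fun v => valid_side1 a d q u v V). assert (S2 := fun v => valid_side2 a d q u v V).
destruct C1 as [P1 [Q1 _]], C2 as [P2 [Q2 _]]. apply hull_iff in P1, P2.
destruct (support_cases u q) as [[x [y [E [Ex Ey]]]]|[b1 [I1 [E1 H1]]]].
{ lra. } { exact S1. }
{ apply (hull_face_ex vs (fun v => cross u (psub v q)) p1);
    [apply affine_cross_l|exact S1|exact P1|apply on_ray_cross, Q1]. }
{ right. exists x, y. simpl. auto. }
destruct (support_cases (opp (rot w u)) q) as [[x [y [E [Ex Ey]]]]|[b2 [I2 [E2 H2]]]].
{ rewrite dot_opp, rot_dot. lra. }
{ intros v Hv. rewrite cross_opp. auto. }
{ destruct (hull_face_ex vs (fun v => cross (psub v q) (rot w u)) p2) as [v [Iv Ev]];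
    [apply affine_cross_r|exact S2|exact P2|apply on_ray_cross_r, Q2|].
  exists v. rewrite cross_opp. auto. }
{ right. exists x, y. rewrite cross_opp in Ex, Ey. simpl. auto. }
left.
assert (B1 : p1 = b1).
{ apply (hull_face_unique vs (fun v => cross u (psub v q)));
    [apply affine_cross_l|lra|exact H1|exact P1|apply on_ray_cross, Q1]. }
assert (B2 : p2 = b2).
{ apply (hull_face_unique vs (fun v => cross (psub v q) (rot w u)));
    [apply affine_cross_r|apply S2, I2| |exact P2|apply on_ray_cross_r, Q2].
  intros v Hv Hn. rewrite <- cross_opp. auto. }
subst b1 b2. simpl. split; [apply V|]. split; [apply V|].
split; [auto|]. split.
- split; [exact I2|]. split; [exact Q2|]. intros v Hv Hn. rewrite <- cross_opp. auto.
- destruct V as [_ [_ [_ [_ [_ [s [Hs0 Hz]]]]]]]. exists s.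
  split; [exact Hs0|]. apply hull_iff, Hz.
Qed.

(** Both ends have nonnegative values, so a side condition vanishing at the midpoint vanishes at
    both ends, which would make the probe flush. *)
Lemma not_flush_away (a d : pt) (r : response) (x y : pt) :
  d <> (0, 0) -> probe_answer w (in_hull vs) a d r -> edge vs x y -> ~ flush w r x y ->
  away w vs a d r (mix (1 / 2) x y).
Proof.
intros Hd Ha [Ix [Iy _]] Hf. destruct r as [|q u p1 p2].
- destruct (miss_strict a d Hd Ha) as [H|H]; [left|right]; (split; [exact H|]).
  + rewrite (affine_cross_l d a). assert (H1 := H x Ix). assert (H2 := H y Iy). lra.
  + rewrite (affine_cross_r d a). assert (H1 := H x Ix). assert (H2 := H y Iy). lra.
- destruct Ha as [V _]. simpl in *.
  rewrite (affine_cross_l u q), (affine_cross_r (rot w u) q).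
  assert (A1 := valid_side1 a d q u x V Ix). assert (A2 := valid_side1 a d q u y V Iy).
  assert (B1 := valid_side2 a d q u x V Ix). assert (B2 := valid_side2 a d q u y V Iy).
  split.
  + apply Rnot_le_lt. intros Hle. apply Hf. left. split; lra.
  + apply Rnot_le_lt. intros Hle. apply Hf. right. split; lra.
Qed.

Lemma strict_away (a d : pt) (r : response) (v : pt) :
  strict w vs a d r -> In v vs -> ~ In v (contacts r) -> away w vs a d r v.
Proof.
destruct r as [|q u p1 p2]; simpl.
- intros [H|H] Hv _; [left|right]; auto.
- intros [_ [_ [[_ [_ H1]] [[_ [_ H2]] _]]]] Hv Hn.
  split; [apply H1|apply H2]; try exact Hv; intros ->; apply Hn; auto.
Qed.

End Flush.

(** * Growing a polygon *)

Lemma psub0 (z N : pt) : psub z (pscale 0 N) = z.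
Proof. apply pt_eq; unfold psub, pscale; simpl; ring. Qed.

Lemma ev_neq_point (z N v : pt) : z <> v -> ev (fun t => psub z (pscale t N) <> v).
Proof.
intros H.
assert (Hd : 0 < dot (psub z v) (psub z v)).
{ apply dot_pos. intros E. apply H. injection E. intros. apply pt_eq; lra. }
apply (ev_impl (fun t => 0 < dot (psub (psub z (pscale t N)) v) (psub (psub z (pscale t N)) v))).
- intros t _ Ht E. rewrite E in Ht. unpt. lra.
- apply ev_pos; [unfold dot, psub, pscale; simpl; auto_derive; exact I|].
  rewrite psub0. exact Hd.
Qed.

Definition turn (w : R) (p v n : pt) : R := cross (rot w (psub n v)) (psub p v).
Definition skew (w : R) (p q p' q' : pt) : R := cross (rot w (psub q p)) (psub q' p').

Ltac ev_poly :=
  unfold skew, turn, orient, dot, cross, rot, psub, pscale; simpl; auto_derive; exact I.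

(* The vertex moving away from [z0] sits between [x] and [y]; the relation [E]
   collects the edges that do not change. *)
Section Grow.
Variables (w rho : R) (l' : list pt) (x y z0 N : pt) (E : pt -> pt -> Prop).
Let l := y :: l' ++ [x].
Let zt (t : R) : pt := psub z0 (pscale t N).
Definition grown (z p q : pt) : Prop := E p q \/ (p = x /\ q = z) \/ (p = z /\ q = y).
Hypothesis Hd : NoDup l.
Hypothesis Hc : ccw l.
Hypothesis Hz : ~ In z0 l.
Hypothesis HE : forall p q, E p q -> In p l /\ In q l.
Hypothesis Hwide : forall p v n, grown z0 p v -> grown z0 v n -> 0 < turn w p v n.
Hypothesis Hgen : forall p q p' q', grown z0 p q -> grown z0 p' q' -> skew w p q p' q' <> 0.
Hypothesis Hb : forall v, In v l -> dot v v < rho * rho.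
Hypothesis Hbz : dot z0 z0 < rho * rho.
(** Angles and genericity are assumed at [z0] itself and propagate by continuity. Orientations are
    assumed for small positive [t] instead, since a midpoint [z0] is collinear with [x] and [y]. *)
Hypothesis Hccw : ev (fun t => ForallOrdPairs (fun p q => 0 < orient p q (zt t)) l).
Hypothesis Hedge : ev (fun t => forall p q, In p l -> In q l -> edge (l ++ [zt t]) p q -> E p q).
Hypothesis Hor : ev (fun t => hull (l ++ [zt t]) (0, 0)).

Let Ix : In x l. Proof. right. apply in_or_app. simpl. auto. Qed.
Let Iy : In y l. Proof. left. reflexivity. Qed.
Let Hxy : x <> y.
Proof.
intros e. inversion Hd as [|? ? H1 H2]; subst. apply H1, in_or_app. simpl. auto.
Qed.

Lemma zt_fresh : ev (fun t => ~ In (zt t) l).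
Proof.
apply (ev_impl (fun t => forall v, In v l -> zt t <> v)).
- intros t _ H Hi. apply (H _ Hi). reflexivity.
- apply ev_in. intros v Hv. apply ev_neq_point. intros e. apply Hz. rewrite e. exact Hv.
Qed.

(** Only the angles at [x], at [y] and at the moving vertex depend on [t]; the remaining
    combinations of edges would put the moving vertex in [l] or identify [x] with [y]. *)
Lemma grown_wide_ev :
  ev (fun t => forall p v n, grown (zt t) p v -> grown (zt t) v n -> 0 < turn w p v n).
Proof.
assert (H1 : ev (fun t => forall p, In p l -> E p x -> 0 < turn w p x (zt t))).
{ apply ev_in. intros p Hp. apply ev_if. intros Ep.
  apply (ev_pos (fun t => turn w p x (zt t))); [unfold zt; ev_poly|].
  unfold zt. rewrite psub0. apply Hwide; [left; exact Ep|right; left; auto]. }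
assert (H2 : ev (fun t => forall n, In n l -> E y n -> 0 < turn w (zt t) y n)).
{ apply ev_in. intros n Hn. apply ev_if. intros En.
  apply (ev_pos (fun t => turn w (zt t) y n)); [unfold zt; ev_poly|].
  unfold zt. rewrite psub0. apply Hwide; [right; right; auto|left; exact En]. }
assert (H3 : ev (fun t => 0 < turn w x (zt t) y)).
{ apply (ev_pos (fun t => turn w x (zt t) y)); [unfold zt; ev_poly|].
  unfold zt. rewrite psub0. apply Hwide; [right; left; auto|right; right; auto]. }
pose proof (ev_and _ _ (ev_and _ _ H1 H2) (ev_and _ _ H3 zt_fresh)) as H.
revert H. apply ev_impl. intros t _ [[K1 K2] [K3 K4]] p v n A B.
destruct A as [A|[[-> ->]|[-> ->]]], B as [B|[[e1 e2]|[e1 e2]]]; subst.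
- apply Hwide; left; assumption.
- apply K1; [apply (HE _ _ A)|exact A].
- exfalso. apply K4, (HE _ _ A).
- exfalso. apply K4, (HE _ _ B).
- exfalso. apply K4. rewrite e1. exact Ix.
- exact K3.
- apply K2; [apply (HE _ _ B)|exact B].
- congruence.
- exfalso. apply K4. rewrite <- e1. exact Iy.
Qed.

Lemma grown_generic_ev :
  ev (fun t => forall p q p' q', grown (zt t) p q -> grown (zt t) p' q' ->
                 skew w p q p' q' <> 0).
Proof.
assert (H1 : ev (fun t => forall p, In p l -> forall q, In q l -> E p q ->
   (skew w p q x (zt t) <> 0 /\ skew w p q (zt t) y <> 0) /\
   (skew w x (zt t) p q <> 0 /\ skew w (zt t) y p q <> 0))).
{ apply ev_in. intros p Hp. apply ev_in. intros q Hq. apply ev_if. intros Epq.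
  apply ev_and; apply ev_and; (apply ev_neq; [unfold zt; ev_poly|]);
  unfold zt; rewrite psub0; apply Hgen; unfold grown; auto. }
assert (H2 : ev (fun t => (skew w x (zt t) x (zt t) <> 0 /\ skew w x (zt t) (zt t) y <> 0) /\
   (skew w (zt t) y x (zt t) <> 0 /\ skew w (zt t) y (zt t) y <> 0))).
{ apply ev_and; apply ev_and; (apply ev_neq; [unfold zt; ev_poly|]);
  unfold zt; rewrite psub0; apply Hgen; unfold grown; auto. }
revert H2. revert H1. intros H1 H2. pose proof (ev_and _ _ H1 H2) as H.
revert H. apply ev_impl. intros t _ [K1 [[K2 K3] [K4 K5]]] p q p' q' A B.
destruct A as [A|[[-> ->]|[-> ->]]], B as [B|[[-> ->]|[-> ->]]]; try assumption;
  try (destruct (K1 p (proj1 (HE _ _ A)) q (proj2 (HE _ _ A)) A) as [[? ?] [? ?]]; assumption);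
  try (destruct (K1 p' (proj1 (HE _ _ B)) q' (proj2 (HE _ _ B)) B) as [[? ?] [? ?]]; assumption).
apply Hgen; left; assumption.
Qed.

(** Uniqueness of successors and predecessors shows that the edges at the new vertex come from [x]
    and go to [y], so every edge is accounted for by [grown]. *)
Lemma grow_good : ev (fun t => good w rho (l ++ [zt t])).
Proof.
assert (Hbd : ev (fun t => 0 < rho * rho - dot (zt t) (zt t))).
{ apply ev_pos; [unfold zt; ev_poly|]. unfold zt. rewrite psub0. lra. }
pose proof (ev_and _ _ (ev_and _ _ (ev_and _ _ grown_wide_ev grown_generic_ev)
  (ev_and _ _ zt_fresh Hbd)) (ev_and _ _ Hccw (ev_and _ _ Hedge Hor))) as H.
revert H. apply ev_impl.
intros t _ [[[K1 K2] [K3 K4]] [K5 [K6 K7]]]. set (z := zt t) in *.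
assert (Nd : NoDup (l ++ [z])).
{ apply (Permutation_NoDup (Permutation_cons_append l z)). constructor; assumption. }
assert (Cc : ccw (l ++ [z])) by (apply ccw_snoc; split; assumption).
assert (Ezy : edge (l ++ [z]) z y) by (apply edge_last_first; assumption).
assert (Exz : edge (l ++ [z]) x z).
{ assert (e : l ++ [z] = (y :: l') ++ x :: z :: []).
  { unfold l. simpl. rewrite <- app_assoc. reflexivity. }
  rewrite e. apply edge_app; rewrite <- e; assumption. }
assert (Hed : forall p q, edge (l ++ [z]) p q -> grown z p q).
{ intros p q H. assert (H' := H). destruct H' as [Hp [Hq _]].
  apply in_app_or in Hp as [Hp|[<-|[]]].
  - apply in_app_or in Hq as [Hq|[<-|[]]].
    + left. apply K6; assumption.
    + right. left. split; [|reflexivity]. apply (edge_pred_unique _ _ _ _ H Exz).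
  - right. right. split; [reflexivity|]. apply (edge_succ_unique _ _ _ _ H Ezy). }
constructor.
- exact Nd.
- unfold l. rewrite length_app. simpl. rewrite length_app. simpl. lia.
- exact Cc.
- intros p v n A B. apply K1; apply Hed; assumption.
- intros p q p' q' A B. apply K2; apply Hed; assumption.
- intros v Hv. apply in_app_or in Hv as [Hv|[<-|[]]]; [auto|lra].
- exact K7.
Qed.

End Grow.

Lemma FOP_and {A : Type} (R R' : A -> A -> Prop) (l : list A) :
  ForallOrdPairs R l -> ForallOrdPairs R' l -> ForallOrdPairs (fun x y => R x y /\ R' x y) l.
Proof.
intros H. induction H as [|a l Ha H IH]; intros H'; [constructor|].
inversion H' as [|? ? Ha' H'']; subst. constructor; [|auto].
rewrite Forall_forall in *. auto.
Qed.

Lemma ev_orient (z0 N p q : pt) :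
  0 < orient p q z0 -> ev (fun t => 0 < orient p q (psub z0 (pscale t N))).
Proof.
intros H. apply ev_pos; [ev_poly|]. rewrite psub0. exact H.
Qed.

Lemma ev_orient_all (z0 N : pt) (l : list pt) :
  ev (fun t => forall p, In p l -> forall q, In q l -> 0 < orient p q z0 ->
        0 < orient p q (psub z0 (pscale t N))).
Proof.
apply ev_in. intros p _. apply ev_in. intros q _. apply ev_if. apply ev_orient.
Qed.

(** The inward normal for a counterclockwise edge direction; subtracting it leads out of the
    polygon. *)
Definition perp (e : pt) : pt := (- snd e, fst e).

Lemma cross_perp (e : pt) : cross e (perp e) = dot e e.
Proof. unfold perp. unpg. ring. Qed.

Lemma psub_neq0 (x y : pt) : x <> y -> 0 < dot (psub y x) (psub y x).
Proof.
intros H. apply dot_pos. intros e. apply H. injection e. intros. apply pt_eq; lra.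
Qed.

Lemma good_edge_pos (w : R) (vs : list pt) (x y v : pt) :
  edge vs x y -> In v vs -> 0 <= orient x y v.
Proof.
intros [_ [_ [_ H]]] Hv. destruct (classic (v = x)) as [->|Hx].
- unfold orient. unpt. lra.
- destruct (classic (v = y)) as [->|Hy].
  + unfold orient. unpt. lra.
  + apply Rlt_le. auto.
Qed.

Lemma mid_not_vertex (w rho : R) (vs : list pt) (x y : pt) :
  good w rho vs -> edge vs x y -> ~ In (mix (1 / 2) x y) vs.
Proof.
intros Hg E Hi. assert (E' := E). destruct E' as [_ [_ [Hne H]]].
assert (Hd := psub_neq0 x y Hne).
assert (E0 : orient x y (mix (1 / 2) x y) = 0) by (unfold orient, mix; unpg; field).
assert (mix (1 / 2) x y <> x).
{ intros e. apply Hne. assert (e1 := f_equal fst e). assert (e2 := f_equal snd e).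
  unfold mix in *. unpt. apply pt_eq; lra. }
assert (mix (1 / 2) x y <> y).
{ intros e. apply Hne. assert (e1 := f_equal fst e). assert (e2 := f_equal snd e).
  unfold mix in *. unpt. apply pt_eq; lra. }
specialize (H _ Hi H0 H1). lra.
Qed.

(** In the limit the midpoint is a vertex with a flat angle and the two half edges are parallel to
    the old edge, so angle bounds and genericity already hold there. Strict convexity appears as
    soon as the point leaves the edge. *)
Lemma grow_edge (w rho : R) (vs : list pt) (x y : pt) :
  0 < w <= PI / 2 -> good w rho vs -> edge vs x y ->
  ev (fun t => let z := psub (mix (1 / 2) x y) (pscale t (perp (psub y x))) in
    ~ hull vs z /\
    exists vs', good w rho vs' /\ length vs' = S (length vs) /\
      forall v, In v vs' <-> In v vs \/ v = z).
Proof.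
intros Hw Hg Exy. destruct (sin_bounds w Hw) as [Hs Hcos].
assert (Hne : x <> y) by apply Exy.
destruct (rotate_to_last vs x (proj1 Exy)) as [y' [l' [Hc P]]].
{ pose proof (good_length _ _ _ Hg). lia. } { apply Hg. }
assert (Hd := Permutation_NoDup P (good_nodup _ _ _ Hg)).
assert (Hin : forall v, In v vs <-> In v (y' :: l' ++ [x])).
{ intros v. split; apply Permutation_in; [|symmetry]; exact P. }
assert (y' = y).
{ apply (edge_succ_unique vs x); [|exact Exy].
  apply (edge_perm (y' :: l' ++ [x])); [intros z; symmetry; apply Hin|].
  apply edge_last_first; assumption. }
subst y'. set (l := y :: l' ++ [x]) in *.
set (m := mix (1 / 2) x y). set (N := perp (psub y x)).
set (E := fun p q => edge vs p q /\ ~ (p = x /\ q = y)).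
assert (Hout : forall t, 0 < t -> orient x y (psub m (pscale t N)) < 0).
{ intros t Ht. assert (Hp := psub_neq0 x y Hne).
  replace (orient _ _ _) with (- (t * dot (psub y x) (psub y x))); [nra|].
  unfold m, N, orient, perp, mix. unpg. field. }
assert (Hmid : forall p q, orient p q m = (orient p q x + orient p q y) / 2).
{ intros p q. unfold m, mix, orient. unpg. field. }
assert (Hm : ~ In m vs) by (apply (mid_not_vertex w rho); assumption).
(* Every limit edge is parallel to an old one, so genericity is inherited. *)
assert (Hdir : forall p q, grown x y E m p q ->
  exists p' q' k, edge vs p' q' /\ k <> 0 /\ psub q p = pscale k (psub q' p')).
{ intros p q [[H _]|[[-> ->]|[-> ->]]].
  - exists p, q, 1. split; [exact H|]. split; [lra|].
    apply pt_eq; unfold psub, pscale; simpl; ring.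
  - exists x, y, (1 / 2). split; [exact Exy|]. split; [lra|].
    apply pt_eq; unfold m, mix, psub, padd, pscale; simpl; field.
  - exists x, y, (1 / 2). split; [exact Exy|]. split; [lra|].
    apply pt_eq; unfold m, mix, psub, padd, pscale; simpl; field. }
assert (Hgood : ev (fun t => good w rho (l ++ [psub m (pscale t N)]))).
{ apply (grow_good w rho l' x y m N E); fold l.
  - exact Hd.
  - exact Hc.
  - intros H. apply Hm, Hin, H.
  - intros p q [H _]. split; apply Hin; apply H.
  - intros p v n A B.
    destruct A as [[A _]|[[-> ->]|[-> ->]]], B as [[B B']|[[e1 e2]|[e1 e2]]].
    + apply (good_wide _ _ _ Hg); assumption.
    + rewrite e1 in *. rewrite e2. replace (turn w p x m) with (turn w p x y / 2)
        by (unfold turn, m, mix; unpg; field).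
      assert (0 < turn w p x y) by (apply (good_wide _ _ _ Hg); assumption). lra.
    + exfalso. apply Hm. rewrite <- e1. apply A.
    + exfalso. apply Hm, B.
    + exfalso. apply Hm. rewrite e1. apply Exy.
    (* The flat angle at the midpoint: [sin (PI - w)] is [sin w], which is positive. *)
    + clear e1. rewrite e2. replace (turn w x m y) with (sin w * dot (psub y x) (psub y x) / 4)
        by (unfold turn, m, mix; unpg; field).
      assert (Hp := psub_neq0 x y Hne). nra.
    + replace (turn w m y n) with (turn w x y n / 2)
        by (unfold turn, m, mix; unpg; field).
      assert (0 < turn w x y n) by (apply (good_wide _ _ _ Hg); assumption). lra.
    + congruence.
    + exfalso. apply Hm. rewrite <- e1. apply Exy.
  - intros p q p' q' A B. apply Hdir in A as [p1 [q1 [k [A [Hk Ek]]]]].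
    apply Hdir in B as [p2 [q2 [k' [B [Hk' Ek']]]]].
    unfold skew. rewrite Ek, Ek'.
    replace (cross _ _) with (k * k' * cross (rot w (psub q1 p1)) (psub q2 p2))
      by (unpg; ring).
    apply Rmult_integral_contrapositive. split.
    + apply Rmult_integral_contrapositive. split; assumption.
    + apply (good_generic _ _ _ Hg); assumption.
  - intros v Hv. apply (good_bounded _ _ _ Hg), Hin, Hv.
  - assert (Bx := good_bounded _ _ _ Hg x (proj1 Exy)).
    assert (By := good_bounded _ _ _ Hg y (proj1 (proj2 Exy))).
    (* Strict convexity of the squared norm keeps the midpoint in the disk. *)
    assert (dot m m = (dot x x + dot y y) / 2 - dot (psub y x) (psub y x) / 4)
      by (unfold m, mix; unpg; field).
    assert (Hp := psub_neq0 x y Hne). lra.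
  - assert (Hyx : ev (fun t => 0 < orient y x (psub m (pscale t N)))).
    { apply ev_true. intros t Ht. specialize (Hout t Ht). unfold orient in *. unpt. lra. }
    pose proof (ev_and _ _ Hyx (ev_orient_all m N l)) as H. revert H. apply ev_impl.
    intros t _ [K1 K2].
    (* Orientation is affine in its last argument, so at the midpoint it is the average of the
       values at [x] and [y], hence positive for every pair except [y], [x]. For that pair it
       vanishes in the limit and becomes positive by moving outwards. *)
    apply (FOP_impl (fun p q => 0 < orient p q m \/ (p = y /\ q = x))).
    { intros p q Hp Hq [H|[-> ->]]; [apply K2; assumption|exact K1]. }
    assert (Hc' := Hc). unfold l in Hc'. change (ccw ((y :: l') ++ [x])) in Hc'.
    apply ccw_snoc in Hc' as [_ HFx]. destruct Hc as [HFy _].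
    apply FOP_app in HFy as [HFy [_ HFyx]].
    change l with ((y :: l') ++ [x]). apply FOP_app. split; [|split].
    + inversion HFx as [|? ? H1 H2]; subst. constructor.
      * rewrite Forall_forall in *. intros q Hq. left. rewrite Hmid.
        specialize (H1 q Hq). assert (orient y q y = 0) by (unfold orient; unpg; ring).
        lra.
      * assert (H := FOP_and _ _ _ H2 HFy). revert H. apply FOP_impl.
        intros p q _ _ [A B]. left. rewrite Hmid.
        rewrite <- (orient_cyc y p q) in B. lra.
    + repeat constructor.
    + intros p q [<-|Hp] [<-|[]]; [right; auto|left].
      rewrite Hmid. assert (H := HFyx p x Hp (or_introl eq_refl)).
      rewrite <- (orient_cyc y p x) in H.
      assert (orient p x x = 0) by (unfold orient; unpg; ring). lra.
  - apply ev_true. intros t Ht p q Hp Hq H. split.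
    + destruct H as [_ [_ [H1 H2]]]. split; [apply Hin, Hp|]. split; [apply Hin, Hq|].
      split; [exact H1|]. intros v Hv. apply H2. apply in_or_app. left. apply Hin, Hv.
    + intros [-> ->]. specialize (Hout t Ht).
      assert (0 <= orient x y (psub m (pscale t N))); [|lra].
      apply (good_edge_pos w (l ++ [psub m (pscale t N)])); [exact H|].
      apply in_or_app. simpl. auto.
  - apply ev_true. intros t _. apply (hull_sub vs); [|apply Hg].
    intros v Hv. apply hull_in, in_or_app. left. apply Hin, Hv. }
revert Hgood. apply ev_impl. intros t Ht Hgood. cbv zeta.
fold m N. split.
- intros Hh. specialize (Hout t Ht).
  assert (0 <= orient x y (psub m (pscale t N))); [|lra].
  apply (hull_ge vs (fun v => orient x y v)); [apply affine_cross_l| |exact Hh].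
  intros v Hv. apply (good_edge_pos w vs); assumption.
- exists (l ++ [psub m (pscale t N)]). split; [exact Hgood|]. split.
  + rewrite length_app, (Permutation_length P). simpl. lia.
  + intros v. rewrite in_app_iff, <- Hin. simpl. intuition.
Qed.

(** The vertex moves away from the midpoint of its neighbours, so its old position stays in the
    hull, while the limit polygon is the good polygon [vs] itself. *)
Lemma move_vertex (w rho : R) (vs : list pt) (x a y : pt) :
  0 < w <= PI / 2 -> good w rho vs -> edge vs x a -> edge vs a y ->
  ev (fun t => let z := psub a (pscale t (padd (psub x a) (psub y a))) in
    exists vs', good w rho vs' /\ length vs' = length vs /\ In z vs' /\
      (forall v, In v vs' -> In v vs \/ v = z) /\
      (forall v, In v vs -> v <> a -> In v vs') /\
      (forall v, hull vs v -> hull vs' v)).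
Proof.
intros Hw Hg Exa Eay.
destruct (rotate_to_last vs a (proj1 Eay)) as [y' [l0 [Hc P]]].
{ pose proof (good_length _ _ _ Hg). lia. } { apply Hg. }
assert (Hd := Permutation_NoDup P (good_nodup _ _ _ Hg)).
assert (Hin : forall v, In v vs <-> In v (y' :: l0 ++ [a])).
{ intros v. split; apply Permutation_in; [|symmetry]; exact P. }
assert (y' = y).
{ apply (edge_succ_unique vs a); [|exact Eay].
  apply (edge_perm (y' :: l0 ++ [a])); [intros z; symmetry; apply Hin|].
  apply edge_last_first; assumption. }
subst y'.
destruct (exists_last (l := l0)) as [l' [x' ->]].
{ intros ->. assert (H := Permutation_length P). pose proof (good_length _ _ _ Hg).
  simpl in H. lia. }
assert (x' = x).
{ apply (edge_pred_unique vs x' x a); [|exact Exa].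
  apply (edge_perm (y :: (l' ++ [x']) ++ [a])); [intros z; symmetry; apply Hin|].
  assert (e : y :: (l' ++ [x']) ++ [a] = (y :: l') ++ x' :: a :: [])
    by (simpl; rewrite <- app_assoc; reflexivity).
  rewrite e in *. apply edge_app; assumption. }
subst x'. set (l := y :: l' ++ [x]) in *.
change (y :: (l' ++ [x]) ++ [a]) with (l ++ [a]) in *.
set (N := padd (psub x a) (psub y a)).
assert (Ha : ~ In a l).
{ intros H. apply (NoDup_remove_2 l [] a) in Hd. apply Hd. rewrite app_nil_r. exact H. }
assert (Hil : forall v, In v l -> In v vs).
{ intros v Hv. apply Hin, in_or_app. auto. }
apply ccw_snoc in Hc as [Hcl HF].
set (E := fun p q => edge vs p q /\ In p l /\ In q l).
assert (Hsub : forall p q, grown x y E a p q -> edge vs p q).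
{ intros p q [[H _]|[[-> ->]|[-> ->]]]; assumption. }
assert (Hh : forall t, 0 < t -> forall v, hull vs v -> hull (l ++ [psub a (pscale t N)]) v).
{ intros t Ht v. apply hull_sub. intros u Hu. apply Hin in Hu.
  apply in_app_or in Hu as [Hu|[<-|[]]]; [apply hull_in, in_or_app; auto|].
  (* The old vertex lies between the new one and the midpoint of its neighbours; the weight solves
     [z = (1 + 2 * t) * a - 2 * t * m]. *)
  assert (e : mix (2 * t / (1 + 2 * t)) (psub a (pscale t N)) (mix (1 / 2) x y) = a).
  { apply pt_eq; unfold mix, N, psub, padd, pscale; simpl; field; lra. }
  rewrite <- e at 2. apply hull_mix.
  - apply hull_in, in_or_app. simpl. auto.
  - apply hull_mix; [| |lra]; apply hull_in, in_or_app; left.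
    + right. apply in_or_app. simpl. auto.
    + left. reflexivity.
  - split; [apply Rdiv_le_0_compat; lra|].
    apply (Rmult_le_reg_r (1 + 2 * t)); [lra|]. unfold Rdiv.
    rewrite Rmult_assoc, Rinv_l; lra. }
assert (Hgood : ev (fun t => good w rho (l ++ [psub a (pscale t N)]))).
{ apply (grow_good w rho l' x y a N E); fold l.
  - apply NoDup_remove_1 in Hd. rewrite app_nil_r in Hd. exact Hd.
  - exact Hcl.
  - exact Ha.
  - intros p q [_ H]. exact H.
  - intros p v n A B. apply (good_wide _ _ _ Hg); apply Hsub; assumption.
  - intros p q p' q' A B. apply (good_generic _ _ _ Hg); apply Hsub; assumption.
  - intros v Hv. apply (good_bounded _ _ _ Hg), Hil, Hv.
  - apply (good_bounded _ _ _ Hg), Eay.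
  - generalize (ev_orient_all a N l). apply ev_impl. intros t _ K. revert HF.
    apply FOP_impl. intros p q Hp Hq. apply K; assumption.
  (* No new edge may appear among the fixed vertices: if [a] is strictly to the right of [p], [q],
     so is its displaced position, and [a] is never collinear with them. *)
  - assert (K : ev (fun t => forall p, In p l -> forall q, In q l -> 0 < - orient p q a ->
       0 < - orient p q (psub a (pscale t N)))).
    { apply ev_in. intros p _. apply ev_in. intros q _. apply ev_if. intros H.
      apply (ev_pos (fun t => - orient p q (psub a (pscale t N)))); [ev_poly|].
      rewrite psub0. exact H. }
    revert K. apply ev_impl. intros t _ K p q Hp Hq H. split; [|auto].
    destruct H as [_ [_ [H1 H2]]].
    split; [auto|]. split; [auto|]. split; [exact H1|].
    intros v Hv Hvp Hvq. apply Hin in Hv. apply in_app_or in Hv as [Hv|[<-|[]]].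
    + apply H2; [apply in_or_app; auto|assumption|assumption].
    + assert (Hnz : orient p q a <> 0).
      { apply (ccw_orient_neq vs); try apply Hg; auto. apply Eay. }
      apply Rnot_le_lt. intros Hle.
      assert (Hneg : 0 < - orient p q (psub a (pscale t N))) by (apply K; auto; lra).
      assert (0 < orient p q (psub a (pscale t N))); [|lra].
      apply H2.
      * apply in_or_app. simpl. auto.
      * intros e. rewrite e in Hneg. unfold orient in Hneg. unpt. lra.
      * intros e. rewrite e in Hneg. unfold orient in Hneg. unpt. lra.
  - apply ev_true. intros t Ht. apply Hh; [exact Ht|]. apply Hg. }
revert Hgood. apply ev_impl. intros t Ht Hgood. cbv zeta. fold N.
exists (l ++ [psub a (pscale t N)]). split; [exact Hgood|]. split; [|split; [|split; [|split]]].
- rewrite (Permutation_length P), !length_app. reflexivity.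
- apply in_or_app. simpl. auto.
- intros v Hv. apply in_app_or in Hv as [Hv|[<-|[]]]; auto.
- intros v Hv Hva. apply Hin in Hv. apply in_app_or in Hv as [Hv|[e|[]]].
  + apply in_or_app. auto.
  + congruence.
- apply Hh, Ht.
Qed.

(** * Moving the apex away from the polygon *)

Lemma strict_build (w : R) (vs : list pt) (a d q U p1 p2 : pt) (s t : R) :
  0 < dot U U -> (exists lam, q = padd a (pscale lam d)) ->
  In p1 vs -> 0 <= s -> p1 = padd q (pscale s U) ->
  In p2 vs -> 0 <= t -> p2 = padd q (pscale t (rot w U)) ->
  (forall v, In v vs -> v <> p1 -> 0 < cross U (psub v q)) ->
  (forall v, In v vs -> v <> p2 -> 0 < cross (psub v q) (rot w U)) ->
  (exists s0, 0 <= s0 /\ hull vs (padd q (pscale s0 d))) ->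
  exists r, strict w vs a d r.
Proof.
intros HU Hq I1 Hs E1 I2 Ht E2 H1 H2 Hh.
set (n := sqrt (dot U U)). assert (Hn : 0 < n) by (apply sqrt_lt_R0; exact HU).
assert (Hnn : n * n = dot U U) by (apply sqrt_sqrt; lra).
assert (Hi : 0 < / n) by (apply Rinv_0_lt_compat, Hn).
exists (Hit q (pscale (/ n) U) p1 p2). simpl. split; [|split; [exact Hq|split; [|split; [|exact Hh]]]].
- apply dot1_norm. transitivity (dot U U / (n * n)); [unpg; field; lra|].
  rewrite Hnn. field. lra.
- split; [exact I1|]. split.
  + exists (s * n). split; [nra|]. rewrite E1. apply pt_eq; unfold padd, pscale; simpl; field; lra.
  + intros v Hv Hne. replace (cross _ _) with (/ n * cross U (psub v q)) by (unpg; ring).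
    apply Rmult_lt_0_compat; auto.
- split; [exact I2|]. split.
  + exists (t * n). split; [nra|]. rewrite E2.
    apply pt_eq; unfold padd, pscale, rot; simpl; field; lra.
  + intros v Hv Hne. replace (cross _ _) with (/ n * cross (psub v q) (rot w U)) by (unpg; ring).
    apply Rmult_lt_0_compat; auto.
Qed.

(* Positivity of the right-hand side says that moving the apex backwards by
   [eta * d] decreases the angle under which two contact points are seen. *)
Lemma recede (w : R) (u : pt) (sg rh al be eta : R) :
  dot u u = 1 ->
  let d := padd (pscale al u) (pscale be (rot w u)) in
  cross (padd (pscale rh (rot w u)) (pscale eta d))
        (rot w (padd (pscale sg u) (pscale eta d))) =
  sin w * (eta * (rh * be + sg * al) + eta * eta * dot d d).
Proof.
intros Hu d.
transitivity (sin w * (eta * (rh * be * (sin w * sin w + cos w * cos w) + sg * al) * dot u u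
   + eta * eta * dot d d)).
- unfold d. unpg. ring.
- rewrite sc1, Hu. ring.
Qed.

(** Rotation by [- w], which recovers the direction of the first ray from that of the second. *)
Definition rotinv (w : R) (u : pt) : pt :=
  (cos w * fst u + sin w * snd u, cos w * snd u - sin w * fst u).

Lemma rot_rotinv (w : R) (u : pt) : rot w (rotinv w u) = u.
Proof.
assert (H := sc1 w). unfold rot, rotinv. simpl. apply pt_eq; simpl.
- transitivity ((sin w * sin w + cos w * cos w) * fst u); [ring|rewrite H; ring].
- transitivity ((sin w * sin w + cos w * cos w) * snd u); [ring|rewrite H; ring].
Qed.

Lemma rotinv_rot (w : R) (u : pt) : rotinv w (rot w u) = u.
Proof.
assert (H := sc1 w). unfold rot, rotinv. simpl. apply pt_eq; simpl.
- transitivity ((sin w * sin w + cos w * cos w) * fst u); [ring|rewrite H; ring].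
- transitivity ((sin w * sin w + cos w * cos w) * snd u); [ring|rewrite H; ring].
Qed.

Lemma cross_rotinv (w : R) (u v : pt) : cross (rotinv w u) v = cross u (rot w v).
Proof. unfold rotinv. unpg. ring. Qed.

Section Swing.
Variables (w rho : R) (vs : list pt) (a d q u z0 N : pt).
Hypothesis Hw : 0 < w <= PI / 2.
Hypothesis Hg : good w rho vs.
Hypothesis Hd : d <> (0, 0).
Hypothesis V : valid_probe w (in_hull vs) a d q u.

Let r := rot w u.
Let Hs : 0 < sin w := proj1 (sin_bounds w Hw).
Let Hu : dot u u = 1 := norm1_dot u (proj1 V).
Let qt (t : R) : pt := psub q (pscale t d).

Ltac ev_poly' := unfold qt; unfold dot, cross, rotinv, rot, psub, pscale; simpl;
  auto_derive; exact I.

Lemma qt0 : qt 0 = q.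
Proof. unfold qt. apply psub0. Qed.

Lemma qt_line (t : R) : exists lam, qt t = padd a (pscale lam d).
Proof.
assert (V' := V). destruct V' as [_ [[lam E] _]]. exists (lam - t). unfold qt. rewrite E.
apply pt_eq; unfold psub, padd, pscale; simpl; ring.
Qed.

Lemma qt_hits (t : R) (vs' : list pt) : 0 < t -> (forall x, hull vs x -> hull vs' x) ->
  exists s0, 0 <= s0 /\ hull vs' (padd (qt t) (pscale s0 d)).
Proof.
intros Ht Hh. assert (V' := V). destruct V' as [_ [_ [_ [_ [_ [s [Hs0 Hx]]]]]]]. apply hull_iff in Hx.
exists (s + t). split; [lra|]. replace (padd _ _) with (padd q (pscale s d)); [auto|].
unfold qt. apply pt_eq; unfold psub, padd, pscale; simpl; ring.
Qed.

(** Covers both moves of the adversary: [z0] may be a vertex that is replaced by [z], or an edge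
    midpoint, in which case no vertex is lost. *)
Definition update (z : pt) (vs' : list pt) : Prop :=
  In z vs' /\ (forall v, In v vs' -> In v vs \/ v = z) /\
  (forall v, In v vs -> v <> z0 -> In v vs') /\
  (forall x, hull vs x -> hull vs' x).

(** The case where [z0] is on the first ray. The apex recedes to [qt t] with the second ray kept
    through the contact [b]; the first ray then leaves the old polygon and meets the line through
    [z0] in direction [N] at a point tending to [z0]. The new vertex is put there and becomes the
    only contact. *)
Lemma swing1 (b : pt) (dl : R) :
  cross u (psub z0 q) = 0 -> 0 < dot u (psub z0 q) -> 0 < cross u N -> 0 < dl ->
  In b vs -> cross (psub b q) r = 0 ->
  (forall v, In v vs -> v <> b -> 0 < cross (psub v q) r) ->
  exists t, 0 < t < dl /\
    forall vs', update (psub z0 (pscale t N)) vs' -> exists r', strict w vs' a d r'.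
Proof.
intros Hz Hzu HN Hdl Ib Eb Hb.
destruct (valid_data w rho vs Hw Hg a d q u V) as
  [_ [_ [al [be [s0 [_ [_ [Hal [Hbe [_ [_ [_ [Ed _]]]]]]]]]]]]].
fold r in Ed.
assert (Hq := valid_apex w rho vs Hw Hg a d q u V).
assert (Hwd := valid_wedge w vs a d q u V).
assert (S1 := fun v => valid_side1 w vs Hw a d q u v V).
destruct (hull_on_ray_pos vs q r b Hq (hull_in _ _ Ib)) as [rh [Hrh Erh]].
{ apply (wedge_on_ray2 w); [exact Hs|apply V|apply S1, Ib|exact Eb]. }
assert (Ez : exists sg, 0 < sg /\ z0 = padd q (pscale sg u)).
{ destruct (collinear_on_line u q q z0) as [sg E]; [lra|unpg; ring|exact Hz|].
  exists sg. split; [|exact E]. rewrite E in Hzu.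
  replace (dot u _) with (sg * dot u u) in Hzu by (unpg; ring). rewrite Hu in Hzu. lra. }
destruct Ez as [sg [Hsg Esg]].
assert (Hb0 : b <> z0).
{ intros e. rewrite Erh, Esg in e.
  assert (Hc : cross u (psub (padd q (pscale rh r)) q) =
               cross u (psub (padd q (pscale sg u)) q)) by (rewrite e; reflexivity).
  replace (cross u (psub (padd q (pscale rh r)) q)) with (rh * cross u r) in Hc by (unpg; ring).
  unfold r in Hc. rewrite cross_rot, Hu in Hc.
  replace (cross u (psub (padd q (pscale sg u)) q)) with 0 in Hc by (unpg; ring). nra. }
assert (HDD := dot_pos d Hd).
(* Direction of the first ray when the second one runs from the receded apex through [b]. *)
set (U := fun t => rotinv w (psub b (qt t))).
assert (HU0 : U 0 = pscale rh u).
{ unfold U. rewrite qt0, Erh.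
  transitivity (pscale rh (rotinv w r)).
  - unfold rotinv. apply pt_eq; unfold psub, padd, pscale; simpl; ring.
  - unfold r. rewrite rotinv_rot. reflexivity. }
(* Vertices of the old first ray also become strictly interior. At [t = 0] their value is 0, so
   continuity is not enough and the exact formula of [recede] is used. *)
assert (Hrec : forall v k t, 0 < t -> 0 < k -> v = padd q (pscale k u) ->
                 0 < cross (U t) (psub v (qt t))).
{ intros v k t Ht Hk Ev. unfold U. rewrite cross_rotinv.
  assert (Hr := recede w u k rh al be t Hu). fold r in Hr. cbv zeta in Hr.
  rewrite <- Ed in Hr.
  replace (psub b (qt t)) with (padd (pscale rh r) (pscale t d))
    by (rewrite Erh; unfold qt; apply pt_eq; unfold psub, padd, pscale; simpl; ring).
  replace (psub v (qt t)) with (padd (pscale k u) (pscale t d))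
    by (rewrite Ev; unfold qt; apply pt_eq; unfold psub, padd, pscale; simpl; ring).
  rewrite Hr. apply Rmult_lt_0_compat; [exact Hs|].
  assert (0 <= t * (rh * be + k * al)) by (apply Rmult_le_pos; nra).
  assert (0 < t * t * dot d d) by (apply Rmult_lt_0_compat; nra). lra. }
assert (C1 : ev (fun t => forall v, In v vs -> 0 < cross (U t) (psub v (qt t)))).
{ apply ev_in. intros v Hv. destruct (S1 v Hv) as [H|H].
  - apply ev_pos; [unfold U; ev_poly'|]. rewrite HU0, qt0.
    replace (cross _ _) with (rh * cross u (psub v q)) by (unpg; ring).
    apply Rmult_lt_0_compat; assumption.
  - destruct (hull_on_ray_pos vs q u v Hq (hull_in _ _ Hv)) as [k [Hk Ek]].
    { apply (wedge_on_ray1 w); [exact Hs|apply V| |symmetry; exact H].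
      apply (valid_side2 w vs Hw a d q u v V Hv). }
    apply ev_true. intros t Ht. apply (Hrec v k t); assumption. }
assert (C2 : ev (fun t => forall v, In v vs -> v <> b ->
   0 < cross (psub v (qt t)) (psub b (qt t)))).
{ apply ev_in. intros v Hv. apply ev_if. intros Hne.
  apply ev_pos; [ev_poly'|]. rewrite qt0, Erh.
  replace (cross _ _) with (rh * cross (psub v q) r) by (unpg; ring).
  apply Rmult_lt_0_compat; auto. }
assert (C3 : ev (fun t => 0 < cross (U t) N)).
{ apply ev_pos; [unfold U; ev_poly'|]. rewrite HU0.
  replace (cross _ _) with (rh * cross u N) by (unpg; ring).
  apply Rmult_lt_0_compat; assumption. }
(* This bounds the displacement [tau] by [dl]; the next condition places the new vertex in front of
   the apex. *)
assert (C4 : ev (fun t => 0 < dl * cross (U t) N - cross (U t) (psub z0 (qt t)))).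
{ apply ev_pos; [unfold U; ev_poly'|]. rewrite HU0, qt0.
  replace (_ - _) with (rh * (dl * cross u N - cross u (psub z0 q))) by (unpg; ring).
  rewrite Hz. apply Rmult_lt_0_compat; [assumption|]. nra. }
assert (C5 : ev (fun t => 0 < dot (U t) (psub z0 (qt t)) * cross (U t) N -
                              cross (U t) (psub z0 (qt t)) * dot (U t) N)).
{ apply ev_pos; [unfold U; ev_poly'|]. rewrite HU0, qt0.
  replace (_ - _) with (rh * rh * (dot u (psub z0 q) * cross u N -
    cross u (psub z0 q) * dot u N)) by (unpg; ring).
  rewrite Hz. apply Rmult_lt_0_compat; [nra|]. nra. }
destruct (ev_ex _ (ev_and _ _ (ev_and _ _ C1 C2) (ev_and _ _ C3 (ev_and _ _ C4 C5))))
  as [t [Ht [[K1 K2] [K3 [K4 K5]]]]].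
assert (K6 := Hrec z0 sg t Ht Hsg Esg).
set (W := U t) in *. set (q' := qt t) in *.
assert (HrW : rot w W = psub b q') by (apply rot_rotinv).
(* The parameter at which [z0 - tau * N] reaches the line of the new first ray. *)
set (tau := cross W (psub z0 q') / cross W N).
assert (Etau : tau * cross W N = cross W (psub z0 q')) by (unfold tau; field; lra).
exists tau. split.
{ split; [apply Rdiv_lt_0_compat; assumption|]. nra. }
intros vs' [Iz [Hin [Hk Hh]]]. set (z := psub z0 (pscale tau N)) in *.
assert (HWW : 0 < dot W W).
{ apply dot_pos. intros e. rewrite e in K3. unpt. lra. }
assert (Hzl : cross W (psub z q') = 0).
{ replace (cross W (psub z q')) with (cross W (psub z0 q') - tau * cross W N)
    by (unfold z; unpg; ring). lra. }
destruct (collinear_on_line W q' q' z HWW) as [s Es]; [unpg; ring|exact Hzl|].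
assert (Hs0 : 0 < s).
{ assert (Hdz : 0 < dot W (psub z q')).
  { apply (Rmult_lt_reg_r (cross W N)); [exact K3|]. rewrite Rmult_0_l.
    replace (dot W (psub z q') * cross W N) with
      (dot W (psub z0 q') * cross W N - (tau * cross W N) * dot W N)
      by (unfold z; unpg; ring).
    rewrite Etau. exact K5. }
  rewrite Es in Hdz. replace (dot W _) with (s * dot W W) in Hdz by (unpg; ring). nra. }
apply (strict_build w vs' a d q' W z b s 1).
- exact HWW.
- apply qt_line.
- exact Iz.
- lra.
- exact Es.
- apply Hk; [exact Ib|exact Hb0].
- lra.
- rewrite HrW. apply pt_eq; unfold psub, padd, pscale; simpl; ring.
- intros v Hv Hne. destruct (Hin v Hv) as [Hv'|e]; [auto|contradiction].
- rewrite HrW. intros v Hv Hne. destruct (Hin v Hv) as [Hv'| ->]; [auto|].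
  rewrite <- HrW, Es.
  replace (cross _ _) with (s * cross W (rot w W)) by (unpg; ring).
  rewrite cross_rot. apply Rmult_lt_0_compat; [exact Hs0|]. apply Rmult_lt_0_compat; assumption.
- apply qt_hits; assumption.
Qed.

(** The mirror image: [b] is the contact kept on the first ray, and the second ray swings to the new
    vertex. *)
Lemma swing2 (b : pt) (dl : R) :
  cross (psub z0 q) r = 0 -> 0 < dot r (psub z0 q) -> 0 < cross N r -> 0 < dl ->
  In b vs -> cross u (psub b q) = 0 ->
  (forall v, In v vs -> v <> b -> 0 < cross u (psub v q)) ->
  exists t, 0 < t < dl /\
    forall vs', update (psub z0 (pscale t N)) vs' -> exists r', strict w vs' a d r'.
Proof.
intros Hz Hzu HN Hdl Ib Eb Hb.
destruct (valid_data w rho vs Hw Hg a d q u V) as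
  [_ [_ [al [be [s0 [_ [_ [Hal [Hbe [_ [_ [_ [Ed _]]]]]]]]]]]]].
fold r in Ed.
assert (Hq := valid_apex w rho vs Hw Hg a d q u V).
assert (Hwd := valid_wedge w vs a d q u V).
assert (S2 := fun v => valid_side2 w vs Hw a d q u v V). fold r in S2.
assert (Hr : dot r r = 1) by (unfold r; rewrite rot_dot; exact Hu).
destruct (hull_on_ray_pos vs q u b Hq (hull_in _ _ Ib)) as [rh [Hrh Erh]].
{ apply (wedge_on_ray1 w); [exact Hs|apply V|apply S2, Ib|exact Eb]. }
assert (Ez : exists sg, 0 < sg /\ z0 = padd q (pscale sg r)).
{ destruct (collinear_on_line r q q z0) as [sg E]; [lra|unpg; ring| |].
  { replace (cross r (psub z0 q)) with (- cross (psub z0 q) r) by (unfold cross; ring). lra. }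
  exists sg. split; [|exact E]. rewrite E in Hzu.
  replace (dot r _) with (sg * dot r r) in Hzu by (unfold dot, psub, padd, pscale; simpl; ring).
  rewrite Hr in Hzu. lra. }
destruct Ez as [sg [Hsg Esg]].
assert (Hb0 : b <> z0).
{ intros e. rewrite Erh, Esg in e.
  assert (Hc : cross u (psub (padd q (pscale rh u)) q) =
               cross u (psub (padd q (pscale sg r)) q)) by (rewrite e; reflexivity).
  replace (cross u (psub (padd q (pscale sg r)) q)) with (sg * cross u r) in Hc by (unpg; ring).
  unfold r in Hc. rewrite cross_rot, Hu in Hc.
  replace (cross u (psub (padd q (pscale rh u)) q)) with 0 in Hc by (unpg; ring). nra. }
assert (HDD := dot_pos d Hd).
set (U := fun t => psub b (qt t)).
set (W := fun t => rot w (U t)).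
assert (HU0 : U 0 = pscale rh u).
{ unfold U. rewrite qt0, Erh. apply pt_eq; unfold psub, padd, pscale; simpl; ring. }
assert (HW0 : W 0 = pscale rh r).
{ unfold W. rewrite HU0. unfold r. apply pt_eq; unfold rot, pscale; simpl; ring. }
assert (Hrec : forall v k t, 0 < t -> 0 < k -> v = padd q (pscale k r) ->
                 0 < cross (psub v (qt t)) (W t)).
{ intros v k t Ht Hk Ev. unfold W, U.
  assert (Hre := recede w u rh k al be t Hu). fold r in Hre. cbv zeta in Hre.
  rewrite <- Ed in Hre.
  replace (psub b (qt t)) with (padd (pscale rh u) (pscale t d))
    by (rewrite Erh; unfold qt; apply pt_eq; unfold psub, padd, pscale; simpl; ring).
  replace (psub v (qt t)) with (padd (pscale k r) (pscale t d))
    by (rewrite Ev; unfold qt; apply pt_eq; unfold psub, padd, pscale; simpl; ring).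
  rewrite Hre. apply Rmult_lt_0_compat; [exact Hs|].
  assert (0 <= t * (k * be + rh * al)) by (apply Rmult_le_pos; nra).
  assert (0 < t * t * dot d d) by (apply Rmult_lt_0_compat; nra). lra. }
assert (C1 : ev (fun t => forall v, In v vs -> 0 < cross (psub v (qt t)) (W t))).
{ apply ev_in. intros v Hv. destruct (S2 v Hv) as [H|H].
  - apply ev_pos; [unfold W, U; ev_poly'|]. rewrite HW0, qt0.
    replace (cross _ _) with (rh * cross (psub v q) r)
      by (unfold cross, psub, pscale; simpl; ring).
    apply Rmult_lt_0_compat; assumption.
  - destruct (hull_on_ray_pos vs q r v Hq (hull_in _ _ Hv)) as [k [Hk Ek]].
    { apply (wedge_on_ray2 w); [exact Hs|apply V| |symmetry; exact H].
      apply (valid_side1 w vs Hw a d q u v V Hv). }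
    apply ev_true. intros t Ht. apply (Hrec v k t); assumption. }
assert (C2 : ev (fun t => forall v, In v vs -> v <> b ->
   0 < cross (U t) (psub v (qt t)))).
{ apply ev_in. intros v Hv. apply ev_if. intros Hne.
  apply ev_pos; [unfold U; ev_poly'|]. rewrite HU0, qt0.
  replace (cross _ _) with (rh * cross u (psub v q)) by (unpg; ring).
  apply Rmult_lt_0_compat; auto. }
assert (C3 : ev (fun t => 0 < cross N (W t))).
{ apply ev_pos; [unfold W, U; ev_poly'|]. rewrite HW0.
  replace (cross _ _) with (rh * cross N r) by (unfold cross, pscale; simpl; ring).
  apply Rmult_lt_0_compat; assumption. }
assert (C4 : ev (fun t => 0 < dl * cross N (W t) - cross (psub z0 (qt t)) (W t))).
{ apply ev_pos; [unfold W, U; ev_poly'|]. rewrite HW0, qt0.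
  replace (_ - _) with (rh * (dl * cross N r - cross (psub z0 q) r))
    by (unfold cross, psub, pscale; simpl; ring).
  rewrite Hz. apply Rmult_lt_0_compat; [assumption|]. nra. }
assert (C5 : ev (fun t => 0 < dot (W t) (psub z0 (qt t)) * cross N (W t) -
                              cross (psub z0 (qt t)) (W t) * dot (W t) N)).
{ apply ev_pos; [unfold W, U; ev_poly'|]. rewrite HW0, qt0.
  replace (_ - _) with (rh * rh * (dot r (psub z0 q) * cross N r -
    cross (psub z0 q) r * dot r N)) by (unfold dot, cross, psub, pscale; simpl; ring).
  rewrite Hz. apply Rmult_lt_0_compat; [nra|]. nra. }
destruct (ev_ex _ (ev_and _ _ (ev_and _ _ C1 C2) (ev_and _ _ C3 (ev_and _ _ C4 C5))))
  as [t [Ht [[K1 K2] [K3 [K4 K5]]]]].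
assert (K6 := Hrec z0 sg t Ht Hsg Esg).
assert (HrW : rot w (U t) = W t) by reflexivity.
set (Wt := W t) in *. set (Ut := U t) in *.
assert (HUb : Ut = psub b (qt t)) by reflexivity.
set (q' := qt t) in *. clearbody Wt Ut.
set (tau := cross (psub z0 q') Wt / cross N Wt).
assert (Etau : tau * cross N Wt = cross (psub z0 q') Wt) by (unfold tau; field; lra).
exists tau. split.
{ split; [apply Rdiv_lt_0_compat; assumption|]. nra. }
intros vs' [Iz [Hin [Hk Hh]]]. set (z := psub z0 (pscale tau N)) in *.
assert (HWW : 0 < dot Wt Wt).
{ apply dot_pos. intros e. rewrite e in K3. unfold cross in K3. simpl in K3. lra. }
assert (HUU : 0 < dot Ut Ut) by (rewrite <- (rot_dot w), HrW; exact HWW).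
assert (Hzl : cross Wt (psub z q') = 0).
{ replace (cross Wt (psub z q')) with (tau * cross N Wt - cross (psub z0 q') Wt)
    by (unfold z, cross, psub, pscale; simpl; ring). lra. }
destruct (collinear_on_line Wt q' q' z HWW) as [s Es];
  [unfold cross, psub; simpl; ring|exact Hzl|].
assert (Hs0 : 0 < s).
{ assert (Hdz : 0 < dot Wt (psub z q')).
  { apply (Rmult_lt_reg_r (cross N Wt)); [exact K3|]. rewrite Rmult_0_l.
    replace (dot Wt (psub z q') * cross N Wt) with
      (dot Wt (psub z0 q') * cross N Wt - (tau * cross N Wt) * dot Wt N)
      by (unfold z, dot, cross, psub, pscale; simpl; ring).
    rewrite Etau. exact K5. }
  rewrite Es in Hdz. replace (dot Wt _) with (s * dot Wt Wt) in Hdz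
    by (unfold dot, padd, psub, pscale; simpl; ring). nra. }
apply (strict_build w vs' a d q' Ut b z 1 s).
- exact HUU.
- apply qt_line.
- apply Hk; [exact Ib|exact Hb0].
- lra.
- rewrite HUb. apply pt_eq; unfold psub, padd, pscale; simpl; ring.
- exact Iz.
- lra.
- rewrite HrW. exact Es.
- intros v Hv Hne. destruct (Hin v Hv) as [Hv'| ->]; [auto|].
  rewrite Es. replace (cross _ _) with (s * cross Ut Wt)
    by (unfold cross, psub, padd, pscale; simpl; ring).
  rewrite <- HrW, cross_rot. apply Rmult_lt_0_compat; [exact Hs0|].
  apply Rmult_lt_0_compat; assumption.
- rewrite HrW. intros v Hv Hne. destruct (Hin v Hv) as [Hv'|e]; [auto|contradiction].
- apply qt_hits; assumption.
Qed.

End Swing.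

(** * The adversary *)

Definition entry : Type := ((pt * pt) * response)%type.
Definition dflt : entry := (((0, 0), (0, 0)), Miss).

(** The probing part of [run], without the output and with the condition on answers as a parameter,
    so that a history can be judged by [strict] or by [probe_answer]. *)
Definition play (S : strategy) (p c : pt) (rho : R) (Q : pt -> pt -> response -> Prop)
    (h : list entry) : Prop :=
  forall i, (i < length h)%nat ->
    let '((a, d), r) := nth i h dflt in
    S p c rho (firstn i h) = Probe a d /\ d <> (0, 0) /\ Q a d r.

Lemma firstn_S_nth (k : nat) (h : list entry) :
  (k < length h)%nat -> firstn (S k) h = firstn k h ++ [nth k h dflt].
Proof.
revert k. induction h as [|e h IH]; intros [|k] H; simpl in *; try lia; [reflexivity|].
f_equal. apply IH. lia.
Qed.

Section Play.
Variables (S : strategy) (p c : pt) (rho : R).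

Lemma play_nil (Q : pt -> pt -> response -> Prop) : play S p c rho Q [].
Proof. intros i Hi. simpl in Hi. lia. Qed.

Lemma play_snoc (Q : pt -> pt -> response -> Prop) (h : list entry) (a d : pt) (r : response) :
  play S p c rho Q h -> S p c rho h = Probe a d -> d <> (0, 0) -> Q a d r ->
  play S p c rho Q (h ++ [((a, d), r)]).
Proof.
intros H E Hd HQ i Hi. rewrite length_app in Hi. simpl in Hi.
destruct (Nat.eq_dec i (length h)) as [->|Hne].
- rewrite nth_middle, firstn_app, firstn_all, Nat.sub_diag. simpl.
  rewrite app_nil_r. auto.
- rewrite app_nth1, firstn_app by lia. replace (i - length h)%nat with 0%nat by lia.
  simpl. rewrite app_nil_r. apply H. lia.
Qed.

Lemma nth_firstn_lt (k i : nat) (h : list entry) :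
  (i < k)%nat -> nth i (firstn k h) dflt = nth i h dflt.
Proof.
revert i h. induction k as [|k IH]; intros i h H; [lia|].
destruct h as [|e h]; simpl; [destruct i; reflexivity|].
destruct i as [|i]; [reflexivity|]. apply IH. lia.
Qed.

Lemma play_firstn (Q Q' : pt -> pt -> response -> Prop) (h : list entry) (k : nat) :
  play S p c rho Q h ->
  (forall i, (i < k)%nat -> (i < length h)%nat -> let '((a, d), r) := nth i h dflt in
     d <> (0, 0) -> Q a d r -> Q' a d r) ->
  play S p c rho Q' (firstn k h).
Proof.
intros H HQ i Hi. rewrite length_firstn in Hi.
rewrite nth_firstn_lt, firstn_firstn by lia. replace (Nat.min i k) with i by lia.
specialize (H i ltac:(lia)). specialize (HQ i ltac:(lia) ltac:(lia)).
destruct (nth i h dflt) as [[a d] r]. destruct H as [H1 [H2 H3]]. auto.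
Qed.

Lemma play_impl (Q Q' : pt -> pt -> response -> Prop) (h : list entry) :
  play S p c rho Q h ->
  (forall a d r, In ((a, d), r) h -> d <> (0, 0) -> Q a d r -> Q' a d r) ->
  play S p c rho Q' h.
Proof.
intros H HQ. rewrite <- (firstn_all h). apply (play_firstn Q); [exact H|].
intros i _ Hi. assert (Hin := nth_In h dflt Hi).
destruct (nth i h dflt) as [[a d] r]. apply HQ, Hin.
Qed.

Lemma play_in (Q : pt -> pt -> response -> Prop) (h : list entry) (a d : pt) (r : response) :
  play S p c rho Q h -> In ((a, d), r) h -> d <> (0, 0) /\ Q a d r.
Proof.
intros H Hin. apply (In_nth _ _ dflt) in Hin as [i [Hi E]].
specialize (H i Hi). rewrite E in H. apply H.
Qed.

(** By induction on the prefix, the strategy asks the same line and the polygon gives the same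
    answer. The run cannot stop inside [h], where the strategy still probes. *)
Lemma play_determined (w : R) (vs : list pt) (h H : list entry) (P : list pt) :
  0 < w <= PI / 2 -> good w 2 vs ->
  play S p c rho (probe_answer w (in_hull vs)) h ->
  run w S (in_hull vs) p c rho H P ->
  (length h <= length H)%nat /\ firstn (length h) H = h.
Proof.
intros Hw Hg Hh [HH HP].
change (play S p c rho (probe_answer w (in_hull vs)) H) in HH.
assert (K : forall k, (k <= length h)%nat ->
  (k <= length H)%nat /\ firstn k H = firstn k h).
{ induction k as [|k IH]; intros Hk; [simpl; split; [lia|reflexivity]|].
  destruct (IH ltac:(lia)) as [Hl E]. assert (Hk' := Hh k ltac:(lia)).
  destruct (Nat.eq_dec k (length H)) as [Hn|Hn].
  - exfalso. rewrite <- E, Hn, firstn_all in Hk'.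
    destruct (nth (length H) h dflt) as [[a d] r].
    destruct Hk' as [Hk' _]. rewrite HP in Hk'. discriminate.
  - split; [lia|]. rewrite !firstn_S_nth, E by lia. f_equal. f_equal.
    assert (HHk := HH k ltac:(lia)). rewrite E in HHk.
    destruct (nth k h dflt) as [[a d] r], (nth k H dflt) as [[a' d'] r'].
    destruct Hk' as [E1 [Hd A1]], HHk as [E2 [Hd' A2]].
    rewrite E1 in E2. injection E2 as -> ->. f_equal.
    apply (answer_unique w 2 vs Hw Hg a' d'); assumption. }
destruct (K (length h) (le_n _)) as [K1 K2]. split; [exact K1|].
rewrite K2. apply firstn_all.
Qed.

End Play.

Lemma ev_in_entries (l : list entry) (Q : pt -> pt -> response -> R -> Prop) :
  (forall a d r, In ((a, d), r) l -> ev (Q a d r)) ->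
  ev (fun t => forall a d r, In ((a, d), r) l -> Q a d r t).
Proof.
intros H.
apply (ev_impl (fun t => forall e, In e l -> Q (fst (fst e)) (snd (fst e)) (snd e) t)).
- intros t _ K a d r Hin. apply (K _ Hin).
- apply ev_in. intros [[a d] r] Hin. apply H, Hin.
Qed.

(** The indices are chosen one entry at a time in the induction, so [R] need not be a function. *)
Lemma pigeonhole {A : Type} (l : list A) (R : A -> nat -> Prop) (m n : nat) :
  NoDup l -> (forall x, In x l -> exists i, (m <= i < n)%nat /\ R x i) ->
  (forall x x' i, In x l -> In x' l -> R x i -> R x' i -> x = x') ->
  (length l <= n - m)%nat.
Proof.
intros Hd Hex Hinj.
assert (H : exists is, length is = length l /\ NoDup is /\
  (forall i, In i is -> (m <= i < n)%nat /\ exists x, In x l /\ R x i)).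
{ induction l as [|x l IH].
  { exists []. split; [reflexivity|]. split; [constructor|]. intros i []. }
  inversion Hd as [|? ? Hx Hd']; subst.
  destruct IH as [js [E [Nd K]]]; [exact Hd'| | |].
  - intros y Hy. apply Hex. right. exact Hy.
  - intros y y' i Hy Hy'. apply Hinj; right; assumption.
  - destruct (Hex x (or_introl eq_refl)) as [i [Hi Rx]].
    exists (i :: js). split; [simpl; lia|]. split.
    + constructor; [|exact Nd]. intros Hin. destruct (K i Hin) as [_ [y [Hy Ry]]].
      apply Hx. rewrite (Hinj x y i); simpl; auto.
    + intros k [<-|Hk]; [split; [exact Hi|exists x; simpl; auto]|].
      destruct (K k Hk) as [K1 [y [Hy Ry]]]. split; [exact K1|exists y; simpl; auto]. }
destruct H as [js [E [Nd K]]]. rewrite <- E, <- (length_seq (n - m) m).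
apply NoDup_incl_length; [exact Nd|]. intros i Hi. apply in_seq.
destruct (K i Hi) as [Hb _]. lia.
Qed.

Section Adversary.
Variables (w : R) (S : strategy).
Hypothesis Hw : 0 < w <= PI / 2.
Hypothesis Hcorrect : correct w S.

Let o : pt := (0, 0).
Let Hs : 0 < sin w := proj1 (sin_bounds w Hw).

Notation plays vs h := (play S o o 2 (strict w vs) h).
Notation runs vs H P := (run w S (in_hull vs) o o 2 H P).

Lemma good_encloses (vs : list pt) : good w 2 vs -> encloses o 2 (in_hull vs).
Proof.
intros Hg. split; [lra|]. intros x Hx. apply hull_iff in Hx.
assert (H : dot x x <= 2 * 2).
{ induction Hx as [v Hv|x y t _ IH1 _ IH2 Ht].
  - apply Rlt_le, (good_bounded _ _ _ Hg), Hv.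
  - assert (E : dot (mix t x y) (mix t x y) =
      (1 - t) * dot x x + t * dot y y - t * (1 - t) * dot (psub x y) (psub x y))
      by (unfold mix; unpg; ring).
    assert (0 <= dot (psub x y) (psub x y)) by
      (apply Rplus_le_le_0_compat; apply Rle_0_sqr).
    assert (0 <= t * (1 - t) * dot (psub x y) (psub x y)) by
      (apply Rmult_le_pos; [apply Rmult_le_pos; lra|assumption]).
    nra. }
unfold dist, norm. rewrite <- (sqrt_square 2) by lra. apply sqrt_le_1_alt.
replace (dot (psub x o) (psub x o)) with (dot x x); [exact H|].
unfold o. unpg. ring.
Qed.

Lemma good_correct (vs : list pt) : good w 2 vs ->
  (exists (h : list entry) P, runs vs h P) /\
  (forall (h : list entry) P, runs vs h P -> forall x, in_hull P x <-> in_hull vs x).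
Proof.
intros Hg. pose proof (good_length _ _ _ Hg) as Hl. apply Hcorrect.
- apply convex_polygon_ccw; [apply Hg|exact Hl|apply Hg].
- apply wide_angles_gt; [exact Hw|apply Hg|exact Hl|apply Hg|apply Hg].
- apply hull_iff, Hg.
- apply good_encloses, Hg.
Qed.

Lemma run_play (vs : list pt) (H : list entry) (P : list pt) :
  runs vs H P -> play S o o 2 (probe_answer w (in_hull vs)) H.
Proof. intros [K _]. exact K. Qed.

(* Otherwise a vertex could be added outside the edge without changing any answer. *)
Lemma certified (vs : list pt) (H : list entry) (P : list pt) (x y : pt) :
  good w 2 vs -> runs vs H P -> edge vs x y ->
  exists i, (i < length H)%nat /\ flush w (snd (nth i H dflt)) x y.
Proof.
intros Hg HR Exy. apply NNPP. intros Hn.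
assert (HP := run_play vs H P HR).
assert (Hnf : forall a d r, In ((a, d), r) H -> ~ flush w r x y).
{ intros a d r Hin Hf. apply (In_nth _ _ dflt) in Hin as [i [Hi E]].
  apply Hn. exists i. rewrite E. auto. }
set (z := fun t => psub (mix (1 / 2) x y) (pscale t (perp (psub y x)))).
assert (He : ev (fun t => forall a d r, In ((a, d), r) H -> away w vs a d r (z t))).
{ apply ev_in_entries. intros a d r Hin. apply away_ev.
  destruct (play_in _ _ _ _ _ _ _ _ _ HP Hin) as [Hd Ha].
  apply (not_flush_away w vs Hw); try assumption. apply (Hnf a d r Hin). }
destruct (ev_ex _ (ev_and _ _ He (grow_edge w 2 vs x y Hw Hg Exy)))
  as [t [Ht [Hz [Hout [vs' [Hg' [_ Hin']]]]]]].
fold (z t) in Hout, Hin'.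
assert (Hh : forall v, hull vs v -> hull vs' v).
{ intros v. apply hull_sub. intros u Hu. apply hull_in, Hin'. auto. }
(* The same history and output are legitimate for both polygons, yet only the larger one contains
   [z t]. *)
assert (HR' : runs vs' H P).
{ destruct HR as [_ HO]. split; [|exact HO].
  change (play S o o 2 (probe_answer w (in_hull vs')) H).
  apply (play_impl _ _ _ _ _ _ _ HP). intros a d r Hin Hd Ha.
  specialize (Hz a d r Hin).
  destruct r as [|q u p1 p2].
  - apply (strict_answer w vs' a d Miss Hw).
    apply (strict_extend w vs vs' a d Miss (z t)); try assumption.
    + apply (miss_strict w vs Hw a d Hd Ha).
    + intros v Hv. apply Hin', Hv.
    + intros v _ [].
  - apply (hit_extend w vs vs' a d q u p1 p2 (z t)); try assumption.
    intros v Hv. apply Hin', Hv. }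
assert (H1 := proj2 (good_correct vs Hg) H P HR (z t)).
assert (H2 := proj2 (good_correct vs' Hg') H P HR' (z t)).
apply Hout, hull_iff, H1, H2, hull_iff, hull_in, Hin'. auto.
Qed.

Lemma plays_prefix (vs : list pt) (h H : list entry) (P : list pt) :
  good w 2 vs -> plays vs h -> runs vs H P ->
  (length h <= length H)%nat /\ firstn (length h) H = h.
Proof.
intros Hg Hh HR. apply (play_determined S o o 2 w vs h H P Hw Hg); [|exact HR].
apply (play_impl _ _ _ _ _ _ _ Hh). intros a d r _ _. apply strict_answer, Hw.
Qed.

Lemma plays_strict (vs : list pt) (h : list entry) (i : nat) (x y : pt) :
  plays vs h -> (i < length h)%nat -> edge vs x y -> ~ flush w (snd (nth i h dflt)) x y.
Proof.
intros Hh Hi [Ix [Iy [Hne _]]]. specialize (Hh i Hi).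
destruct (nth i h dflt) as [[a d] r]. destruct Hh as [_ [_ Hst]]. simpl.
apply (strict_not_flush w vs a d); assumption.
Qed.

(** The probes of [h] are strict, hence flush with no edge, so each edge needs a later probe of its
    own. Edges are counted by their starting vertices. *)
Lemma lower_bound (vs : list pt) (h H : list entry) (P : list pt) :
  good w 2 vs -> plays vs h -> runs vs H P -> (length h + length vs <= length H)%nat.
Proof.
intros Hg Hh HR. destruct (plays_prefix vs h H P Hg Hh HR) as [Hl E].
assert (K : (length vs <= length H - length h)%nat); [|lia].
apply (pigeonhole vs
  (fun x i => (i < length H)%nat /\ exists y, edge vs x y /\ flush w (snd (nth i H dflt)) x y)).
- apply Hg.
- intros x Ix. destruct (good_succ w 2 vs Hg x Ix) as [y Exy].
  destruct (certified vs H P x y Hg HR Exy) as [i [Hi Hf]]. exists i.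
  split; [|split; [exact Hi|exists y; auto]]. split; [|exact Hi].
  apply Nat.nlt_ge. intros Hlt.
  apply (plays_strict vs h i x y Hh Hlt Exy).
  rewrite <- E, nth_firstn_lt by exact Hlt. exact Hf.
- intros x x' i _ _ [Hi [y [Exy Hf]]] [_ [y' [Exy' Hf']]].
  assert (HPi := run_play vs H P HR i Hi).
  destruct (nth i H dflt) as [[a d] r]. destruct HPi as [_ [_ Ha]].
  apply (flush_unique w 2 vs Hw Hg a d r x y x' y'); assumption.
Qed.

Lemma least (Q : nat -> Prop) (n : nat) :
  Q n -> exists j, (j <= n)%nat /\ Q j /\ forall i, (i < j)%nat -> ~ Q i.
Proof.
induction n as [n IH] using Wf_nat.lt_wf_ind. intros Hn.
destruct (classic (exists i, (i < n)%nat /\ Q i)) as [[i [Hi Qi]]|Hno].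
- destruct (IH i Hi Qi) as [j [Hj K]]. exists j. split; [lia|exact K].
- exists n. split; [lia|]. split; [exact Hn|]. intros i Hi Qi. apply Hno. exists i. auto.
Qed.

(** A complete run contains a flush probe, as edges must be certified. The first non-strict probe
    comes after [h], because the run starts with [h], and a non-strict answer is flush with an
    edge. *)
Lemma first_flush (vs : list pt) (h : list entry) :
  good w 2 vs -> plays vs h ->
  exists h' a d r x y, plays vs h' /\ (length h <= length h')%nat /\
    firstn (length h) h' = h /\
    S o o 2 h' = Probe a d /\ d <> (0, 0) /\ probe_answer w (in_hull vs) a d r /\
    edge vs x y /\ flush w r x y.
Proof.
intros Hg Hh. destruct (proj1 (good_correct vs Hg)) as [H [P HR]].
destruct (plays_prefix vs h H P Hg Hh HR) as [Hl E].
assert (HP := run_play vs H P HR).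
set (Q := fun i => (i < length H)%nat /\
  let '((a, d), r) := nth i H dflt in ~ strict w vs a d r).
assert (HQ : exists i, Q i).
{ destruct (good_third w 2 vs Hg o o) as [x [Ix _]].
  destruct (good_succ w 2 vs Hg x Ix) as [y Exy].
  destruct (certified vs H P x y Hg HR Exy) as [i [Hi Hf]].
  exists i. split; [exact Hi|]. destruct (nth i H dflt) as [[a d] r]. intros Hst.
  apply (strict_not_flush w vs a d r x y Hst); try assumption; apply Exy. }
destruct HQ as [i0 HQ]. destruct (least Q i0 HQ) as [j [_ [[Hj Hns] Hmin]]].
assert (Hpl : plays vs (firstn j H)).
{ apply (play_firstn S o o 2 (probe_answer w (in_hull vs))); [exact HP|].
  intros i Hij Hi. specialize (Hmin i Hij).
  destruct (nth i H dflt) as [[a d] r] eqn:En. intros _ _. apply NNPP. intros Hst.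
  apply Hmin. split; [exact Hi|]. rewrite En. exact Hst. }
assert (Hjl : (length h <= j)%nat).
{ apply Nat.nlt_ge. intros Hlt. specialize (Hh j Hlt).
  rewrite <- E, nth_firstn_lt in Hh by exact Hlt.
  destruct (nth j H dflt) as [[a d] r]. apply Hns, Hh. }
assert (HPj := HP j Hj). destruct (nth j H dflt) as [[a d] r].
destruct HPj as [ES [Hd Ha]].
destruct (answer_cases w 2 vs Hw Hg a d r Hd Ha) as [Hst|[x [y [Exy Hf]]]]; [contradiction|].
exists (firstn j H), a, d, r, x, y.
rewrite length_firstn, firstn_firstn.
replace (Nat.min (length h) j) with (length h) by lia.
repeat (split; try assumption). lia.
Qed.

(** The ray not carrying the edge touches a single vertex, which serves as the pivot. The parameter
    [k] selects the point of the edge to displace: its midpoint, or an end. *)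
Lemma swing_flush (vs : list pt) (a d N x y : pt) (r : response) (k dl : R) :
  good w 2 vs -> d <> (0, 0) -> probe_answer w (in_hull vs) a d r ->
  edge vs x y -> flush w r x y -> 0 <= k <= 1 -> 0 < cross (psub y x) N -> 0 < dl ->
  exists t, 0 < t < dl /\
    forall vs', update vs (mix k x y) (psub (mix k x y) (pscale t N)) vs' ->
      exists r', strict w vs' a d r'.
Proof.
intros Hg Hd Ha Exy Hf Hk HN Hdl.
destruct r as [|q u p1 p2]; [destruct Hf|]. destruct Ha as [V [C1 C2]].
assert (Hu := norm1_dot u (proj1 V)).
assert (Hq := valid_apex w 2 vs Hw Hg a d q u V).
assert (S1 := fun v => valid_side1 w vs Hw a d q u v V).
assert (S2 := fun v => valid_side2 w vs Hw a d q u v V).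
assert (S2' : forall v, In v vs -> 0 <= cross (opp (rot w u)) (psub v q))
  by (intros v Hv; rewrite cross_opp; auto).
assert (Hr : dot (rot w u) (rot w u) = 1) by (rewrite rot_dot; exact Hu).
assert (Ho : 0 < dot (opp (rot w u)) (opp (rot w u))) by (rewrite dot_opp, Hr; lra).
destruct C1 as [P1 [Q1 _]], C2 as [P2 [Q2 _]]. apply hull_iff in P1, P2.
assert (Ix := proj1 Exy). assert (Iy := proj1 (proj2 Exy)).
destruct Hf as [[Ex Ey]|[Ex Ey]].
- destruct (support_cases w 2 vs Hg (opp (rot w u)) q Ho S2')
    as [[x' [y' [E' [Ex' Ey']]]]|[b [Ib [Eb Hb]]]].
  { destruct (hull_face_ex vs (fun v => cross (psub v q) (rot w u)) p2) as [v [Iv Ev]];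
      [apply affine_cross_r|exact S2|exact P2|apply on_ray_cross_r, Q2|].
    exists v. rewrite cross_opp. auto. }
  { exfalso. rewrite cross_opp in Ex', Ey'.
    apply (not_both_flush w 2 vs Hw Hg a d q u x y x' y'); assumption. }
  rewrite cross_opp in Eb.
  destruct (edge_on_line w 2 vs Hg u q x y) as [s [Hs0 Es]]; try assumption; [lra|].
  assert (Hpos : forall v, In v vs -> cross u (psub v q) = 0 -> 0 < dot u (psub v q)).
  { intros v Iv Ev. destruct (hull_on_ray_pos vs q u v Hq (hull_in _ _ Iv)) as [g [Hg0 Eg]].
    { apply (wedge_on_ray1 w); [exact Hs|apply V|apply S2, Iv|exact Ev]. }
    rewrite Eg. replace (dot u _) with (g * dot u u) by (unpg; ring). rewrite Hu. lra. }
  apply (swing1 w 2 vs a d q u (mix k x y) N Hw Hg Hd V b dl); try assumption.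
  + rewrite (affine_cross_l u q), Ex, Ey. ring.
  + rewrite (affine_dot u q). assert (A := Hpos x Ix Ex). assert (B := Hpos y Iy Ey).
    destruct (Req_dec k 0) as [->|]; [lra|]. nra.
  + rewrite Es in HN. replace (cross _ N) with (s * cross u N) in HN by (unpg; ring). nra.
  + intros v Hv Hne. rewrite <- cross_opp. auto.
- destruct (support_cases w 2 vs Hg u q ltac:(lra) S1)
    as [[x' [y' [E' [Ex' Ey']]]]|[b [Ib [Eb Hb]]]].
  { apply (hull_face_ex vs (fun v => cross u (psub v q)) p1);
      [apply affine_cross_l|exact S1|exact P1|apply on_ray_cross, Q1]. }
  { exfalso. apply (not_both_flush w 2 vs Hw Hg a d q u x' y' x y); assumption. }
  destruct (edge_on_line w 2 vs Hg (opp (rot w u)) q x y) as [s [Hs0 Es]]; try assumption.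
  { rewrite cross_opp. exact Ex. } { rewrite cross_opp. exact Ey. }
  assert (Hpos : forall v, In v vs -> cross (psub v q) (rot w u) = 0 ->
             0 < dot (rot w u) (psub v q)).
  { intros v Iv Ev.
    destruct (hull_on_ray_pos vs q (rot w u) v Hq (hull_in _ _ Iv)) as [g [Hg0 Eg]].
    { apply (wedge_on_ray2 w); [exact Hs|apply V|apply S1, Iv|exact Ev]. }
    rewrite Eg. replace (dot _ _) with (g * dot (rot w u) (rot w u)) by (unpg; ring).
    rewrite Hr. lra. }
  apply (swing2 w 2 vs a d q u (mix k x y) N Hw Hg Hd V b dl); try assumption.
  + rewrite (affine_cross_r (rot w u) q), Ex, Ey. ring.
  + rewrite (affine_dot (rot w u) q). assert (A := Hpos x Ix Ex). assert (B := Hpos y Iy Ey).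
    destruct (Req_dec k 0) as [->|]; [lra|]. nra.
  + rewrite Es in HN.
    replace (cross _ N) with (s * cross N (rot w u)) in HN by (unfold opp; unpg; ring). nra.
Qed.

Lemma play_update (vs vs' : list pt) (h : list entry) (z0 z : pt) :
  plays vs h -> update vs z0 z vs' ->
  (forall a d r, In ((a, d), r) h -> away w vs a d r z) ->
  (forall a d r v, In ((a, d), r) h -> In v (contacts r) -> In v vs -> In v vs') ->
  plays vs' h.
Proof.
intros Hh [_ [U2 [_ U4]]] Ha Hk. apply (play_impl _ _ _ _ _ _ _ Hh).
intros a d r Hin _ Hst. apply (strict_extend w vs vs' a d r z); try assumption.
- apply (Ha a d r Hin).
- intros v Hv Hc. apply (Hk a d r v Hin Hc Hv).
Qed.

(** The earlier probes are not flush with the edge, so its midpoint is strictly clear of them and a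
    small displacement preserves their answers; the threatening probe becomes strict. One vertex
    buys at least one probe. *)
Lemma add_step (vs : list pt) (h : list entry) :
  good w 2 vs -> plays vs h ->
  exists vs' h', good w 2 vs' /\ plays vs' h' /\ length vs' = Datatypes.S (length vs) /\
    (Datatypes.S (length h) <= length h')%nat.
Proof.
intros Hg Hh.
destruct (first_flush vs h Hg Hh) as
  [h1 [a [d [r [x [y [Hh1 [Hl [_ [ES [Hd [Ha [Exy Hf]]]]]]]]]]]]].
set (z := fun t => psub (mix (1 / 2) x y) (pscale t (perp (psub y x)))).
assert (He : ev (fun t => forall a d r, In ((a, d), r) h1 -> away w vs a d r (z t))).
{ apply ev_in_entries. intros a' d' r' Hin. apply away_ev.
  destruct (play_in _ _ _ _ _ _ _ _ _ Hh1 Hin) as [Hd' Hst].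
  apply (not_flush_away w vs Hw); try assumption.
  - apply strict_answer; assumption.
  - apply (strict_not_flush w vs a' d'); try assumption; apply Exy. }
destruct (ev_and _ _ He (grow_edge w 2 vs x y Hw Hg Exy)) as [dl [Hdl K]].
assert (HN : 0 < cross (psub y x) (perp (psub y x))).
{ rewrite cross_perp. apply psub_neq0, Exy. }
destruct (swing_flush vs a d _ x y r (1 / 2) dl Hg Hd Ha Exy Hf ltac:(lra) HN Hdl)
  as [t [Ht Hsw]].
destruct (K t Ht) as [Hz [_ [vs' [Hg' [Hl' Hin']]]]]. fold (z t) in Hin', Hsw.
assert (Hup : update vs (mix (1 / 2) x y) (z t) vs').
{ split; [apply Hin'; auto|]. split; [intros v Hv; apply Hin', Hv|].
  split; [intros v Hv _; apply Hin'; auto|].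
  intros v. apply hull_sub. intros u Hu. apply hull_in, Hin'. auto. }
destruct (Hsw vs' Hup) as [r' Hr'].
exists vs', (h1 ++ [((a, d), r')]). split; [exact Hg'|]. split; [|split; [exact Hl'|]].
- apply play_snoc; try assumption.
  apply (play_update vs vs' h1 (mix (1 / 2) x y) (z t)); try assumption.
  intros _ _ _ v _ _ Hv. apply Hin'. auto.
- rewrite length_app. simpl. lia.
Qed.

(** Whichever edge the second probe would be flush with, one of its ends is no contact of the first
    probe, so it can be moved without disturbing that answer or adding a vertex. *)
Lemma move_step (vs : list pt) (e : entry) :
  good w 2 vs -> plays vs [e] ->
  (forall x y, edge vs x y -> ~ In x (contacts (snd e)) \/ ~ In y (contacts (snd e))) ->
  exists vs' h', good w 2 vs' /\ plays vs' h' /\ length vs' = length vs /\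
    (2 <= length h')%nat.
Proof.
intros Hg Hh Hfree.
destruct (first_flush vs [e] Hg Hh) as
  [h1 [a [d [r [x [y [Hh1 [Hl [E1 [ES [Hd [Ha [Exy Hf]]]]]]]]]]]]].
(* If two or more probes precede the first flush one, nothing has to be changed. *)
destruct (Compare_dec.le_lt_dec 2 (length h1)) as [H2|H2].
{ exists vs, h1. auto. }
assert (E : h1 = [e]).
{ destruct h1 as [|e1 [|e2 h1]]; simpl in *; [lia|exact E1|lia]. }
subst h1.
assert (Hmove : forall p v n k, edge vs p v -> edge vs v n -> ~ In v (contacts (snd e)) ->
  0 <= k <= 1 -> mix k x y = v -> 0 < cross (psub y x) (padd (psub p v) (psub n v)) ->
  exists vs' h', good w 2 vs' /\ plays vs' h' /\ length vs' = length vs /\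
    (2 <= length h')%nat).
{ intros p v n k Epv Evn Hv Hk Ek HN.
  set (z := fun t => psub v (pscale t (padd (psub p v) (psub n v)))).
  assert (He : ev (fun t => forall a d r, In ((a, d), r) [e] -> away w vs a d r (z t))).
  { apply ev_in_entries. intros a' d' r' Hin. apply away_ev.
    destruct (play_in _ _ _ _ _ _ _ _ _ Hh Hin) as [Hd' Hst].
    apply strict_away; [exact Hst|apply Evn|].
    destruct Hin as [->|[]]. exact Hv. }
  destruct (ev_and _ _ He (move_vertex w 2 vs p v n Hw Hg Epv Evn)) as [dl [Hdl K]].
  destruct (swing_flush vs a d _ x y r k dl Hg Hd Ha Exy Hf Hk HN Hdl) as [t [Ht Hsw]].
  rewrite Ek in Hsw.
  destruct (K t Ht) as [Hz [vs' [Hg' [Hl' [U1 [U2 [U3 U4]]]]]]].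
  fold (z t) in U1, U2, Hsw.
  assert (Hup : update vs v (z t) vs') by (repeat (split; try assumption)).
  destruct (Hsw vs' Hup) as [r' Hr'].
  exists vs', ([e] ++ [((a, d), r')]). split; [exact Hg'|]. split; [|split; [exact Hl'|simpl; lia]].
  apply play_snoc; try assumption.
  apply (play_update vs vs' [e] v (z t)); try assumption.
  intros a' d' r0 c [->|[]] Hc Ic. apply U3; [exact Ic|]. intros ->. exact (Hv Hc). }
(* If [n] were equal to [p], a third vertex would lie on both sides of the same line. *)
assert (Hn3 : forall p v n, edge vs p v -> edge vs v n -> 0 < orient p v n).
{ intros p v n Epv Evn. destruct Epv as [Ip [Iv [Hpv Hor]]].
  apply Hor; [apply Evn| |intros ->; apply Evn; reflexivity].
  intros ->. destruct (good_third w 2 vs Hg p v) as [t [It [T1 T2]]].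
  assert (A := Hor t It T1 T2).
  assert (B : 0 < orient v p t) by (apply Evn; assumption).
  unfold orient in *. unpt. lra. }
destruct (Hfree x y Exy) as [Hx|Hy].
- destruct (good_pred w 2 vs Hg x (proj1 Exy)) as [p Epx].
  apply (Hmove p x y 0); try assumption; [lra| |].
  + apply pt_eq; unfold mix, padd, pscale; simpl; ring.
  + assert (H := Hn3 p x y Epx Exy).
    replace (cross _ _) with (orient p x y) by (unfold orient; unpg; ring). exact H.
- destruct (good_succ w 2 vs Hg y (proj1 (proj2 Exy))) as [n Eyn].
  apply (Hmove x y n 1); try assumption; [lra| |].
  + apply pt_eq; unfold mix, padd, pscale; simpl; ring.
  + assert (H := Hn3 x y n Exy Eyn).
    replace (cross _ _) with (orient x y n) by (unfold orient; unpg; ring). exact H.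
Qed.

Lemma add_steps (vs : list pt) (h : list entry) (k : nat) :
  good w 2 vs -> plays vs h -> (2 <= length h)%nat ->
  exists vs' h', good w 2 vs' /\ plays vs' h' /\ length vs' = (length vs + k)%nat /\
    (2 + k <= length h')%nat.
Proof.
intros Hg Hh Hl. induction k as [|k IH].
- exists vs, h. repeat split; try assumption; try apply Hg; lia.
- destruct IH as [vs1 [h1 [Hg1 [Hh1 [L1 L1']]]]].
  destruct (add_step vs1 h1 Hg1 Hh1) as [vs2 [h2 [Hg2 [Hh2 [L2 L2']]]]].
  exists vs2, h2. split; [exact Hg2|]. split; [exact Hh2|]. lia.
Qed.

(** Some edge has to be certified, so the strategy cannot answer at once. Its first line does not
    depend on the polygon. *)
Lemma first_probe (vs : list pt) :
  good w 2 vs -> exists a d, S o o 2 [] = Probe a d /\ d <> (0, 0).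
Proof.
intros Hg. destruct (proj1 (good_correct vs Hg)) as [H [P HR]].
destruct (good_third w 2 vs Hg o o) as [x [Ix _]].
destruct (good_succ w 2 vs Hg x Ix) as [y Exy].
destruct (certified vs H P x y Hg HR Exy) as [i [Hi _]].
assert (K := run_play vs H P HR 0%nat ltac:(lia)). simpl firstn in K.
destruct (nth 0 H dflt) as [[a d] r]. exists a, d. split; apply K.
Qed.

End Adversary.

(** * The initial polygons *)

(** Complex multiplication: a similarity about the origin, used both for rotating and for
    shrinking. *)
Definition cmul (g v : pt) : pt :=
  (fst g * fst v - snd g * snd v, snd g * fst v + fst g * snd v).

Lemma cmul_sub (g x y : pt) : psub (cmul g x) (cmul g y) = cmul g (psub x y).
Proof. apply pt_eq; unfold cmul, psub; simpl; ring. Qed.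
Lemma cmul_cross (g x y : pt) : cross (cmul g x) (cmul g y) = dot g g * cross x y.
Proof. unfold cmul. unpg. ring. Qed.
Lemma cmul_dot (g x y : pt) : dot (cmul g x) (cmul g y) = dot g g * dot x y.
Proof. unfold cmul. unpg. ring. Qed.
Lemma cmul_rot (w : R) (g x : pt) : rot w (cmul g x) = cmul g (rot w x).
Proof. apply pt_eq; unfold cmul, rot; simpl; ring. Qed.
Lemma cmul_mix (t : R) (g x y : pt) : cmul g (mix t x y) = mix t (cmul g x) (cmul g y).
Proof. apply pt_eq; unfold cmul, mix, padd, pscale; simpl; ring. Qed.
Lemma cmul_orient (g x y z : pt) :
  orient (cmul g x) (cmul g y) (cmul g z) = dot g g * orient x y z.
Proof. unfold orient. rewrite !cmul_sub. apply cmul_cross. Qed.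

Lemma cmul_inj (g x y : pt) : 0 < dot g g -> cmul g x = cmul g y -> x = y.
Proof.
intros Hg E. apply NNPP. intros Hne.
assert (H := psub_neq0 y x ltac:(congruence)).
assert (H0 : dot (psub (cmul g x) (cmul g y)) (psub (cmul g x) (cmul g y)) = 0)
  by (rewrite E; unpg; ring).
rewrite cmul_sub, cmul_dot in H0. nra.
Qed.

Lemma cmul_hull (g x : pt) (V : list pt) : hull V x -> hull (map (cmul g) V) (cmul g x).
Proof.
intros H. induction H.
- apply hull_in, in_map. assumption.
- rewrite cmul_mix. apply hull_mix; assumption.
Qed.

Lemma cmul_edge (g x y : pt) (V : list pt) :
  0 < dot g g -> edge (map (cmul g) V) (cmul g x) (cmul g y) -> edge V x y.
Proof.
intros Hg [Ix [Iy [Hne H]]].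
assert (Hin : forall v, In (cmul g v) (map (cmul g) V) -> In v V).
{ intros v Hv. apply in_map_iff in Hv as [v' [E Hv']].
  apply cmul_inj in E; [subst; exact Hv'|exact Hg]. }
split; [auto|]. split; [auto|]. split; [intros ->; apply Hne; reflexivity|].
intros z Iz Zx Zy. assert (K := H (cmul g z) (in_map _ _ _ Iz)).
rewrite cmul_orient in K.
assert (0 < dot g g * orient x y z).
{ apply K; intros E; apply cmul_inj in E; auto. }
nra.
Qed.

Lemma cmul_ccw (g : pt) (V : list pt) : 0 < dot g g -> ccw V -> ccw (map (cmul g) V).
Proof.
intros Hg. induction V as [|a V IH]; [auto|]. simpl. intros [H1 H2]. split; [|auto].
clear IH H2. induction H1 as [|b V Hb H IH]; simpl; constructor; [|exact IH].
rewrite Forall_forall in *. intros z Hz. apply in_map_iff in Hz as [z' [<- Hz']].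
rewrite cmul_orient. apply Rmult_lt_0_compat; auto.
Qed.

Lemma cmul_good (w rho rho' : R) (g : pt) (V : list pt) :
  0 < dot g g -> dot g g <= 1 -> (forall v, In v V -> dot v v < rho' * rho') ->
  good w rho V -> good w rho' (map (cmul g) V).
Proof.
intros Hg Hg1 Hb HV.
assert (Hed : forall x y, edge (map (cmul g) V) x y ->
  exists x' y', x = cmul g x' /\ y = cmul g y' /\ edge V x' y').
{ intros x y E. assert (Ix := proj1 E). assert (Iy := proj1 (proj2 E)).
  apply in_map_iff in Ix as [x' [<- _]]. apply in_map_iff in Iy as [y' [<- _]].
  exists x', y'. repeat split; try reflexivity; apply (cmul_edge g _ _ V Hg E). }
constructor.
- apply FinFun.Injective_map_NoDup; [|apply HV]. intros x y. apply cmul_inj, Hg.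
- rewrite length_map. apply HV.
- apply cmul_ccw; [exact Hg|apply HV].
- intros p v n A B. apply Hed in A as [p' [v' [-> [-> A]]]].
  apply Hed in B as [v'' [n' [E [-> B]]]]. apply cmul_inj in E; [subst v''|exact Hg].
  rewrite !cmul_sub, cmul_rot, cmul_cross. apply Rmult_lt_0_compat; [exact Hg|].
  apply (good_wide _ _ _ HV); assumption.
- intros p q p' q' A B. apply Hed in A as [p1 [q1 [-> [-> A]]]].
  apply Hed in B as [p2 [q2 [-> [-> B]]]].
  rewrite !cmul_sub, cmul_rot, cmul_cross.
  apply Rmult_integral_contrapositive. split; [lra|].
  apply (good_generic _ _ _ HV); assumption.
- intros v Hv. apply in_map_iff in Hv as [v' [<- Hv']]. rewrite cmul_dot.
  assert (K := Hb v' Hv'). assert (0 <= dot v' v') by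
    (apply Rplus_le_le_0_compat; apply Rle_0_sqr). nra.
- replace (0, 0) with (cmul g (0, 0)); [apply cmul_hull, HV|].
  apply pt_eq; unfold cmul; simpl; ring.
Qed.

(** Successors are unique, so a list giving each vertex one outgoing edge is complete, and both
    conditions become finite checks. *)
Lemma edges_listed (w : R) (V : list pt) (L : list (pt * pt)) :
  (forall x y, In (x, y) L -> edge V x y) ->
  (forall x, In x V -> exists y, In (x, y) L) ->
  (forall p v v' n, In (p, v) L -> In (v', n) L -> v = v' -> 0 < turn w p v n) ->
  (forall p q p' q', In (p, q) L -> In (p', q') L -> skew w p q p' q' <> 0) ->
  wide w V /\ generic w V.
Proof.
intros H1 H2 H3 H4.
assert (Hn : forall x y, edge V x y -> In (x, y) L).
{ intros x y E. destruct (H2 x (proj1 E)) as [y' Hy].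
  rewrite (edge_succ_unique V x y y'); auto. }
split.
- intros p v n A B. apply (H3 p v v n); auto.
- intros p q p' q' A B. apply H4; auto.
Qed.

Section Start.
Variables (w : R) (S : strategy) (V : list pt).
Hypothesis Hw : 0 < w <= PI / 2.
Hypothesis Hcorrect : correct w S.
Hypothesis HV : good w 2 V.
Let bot : pt := (0, -1).
Let top : pt := (0, 1).
Let C := cos (w / 2).
Let H := sin (w / 2).
Hypothesis Ibot : In bot V.
Hypothesis Itop : In top V.
Hypothesis Hbt : ~ edge V bot top.
Hypothesis Htb : ~ edge V top bot.
Hypothesis Hbot : forall v, In v V -> v <> bot -> 0 < C * snd v + H * fst v + C.
Hypothesis Htop : forall v, In v V -> v <> top -> 0 < H * fst v - C * snd v + C.

(** The polygon is adapted to the first line. If the line passes through the origin, the polygon is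
    rotated so that the first axis becomes the line and the contacts are the images of the
    non-adjacent [bot] and [top]. Otherwise it is shrunk until the line misses it and every vertex
    stays free. In both cases [move_step] secures the second probe. *)
Lemma start : exists vs h, good w 2 vs /\ play S (0, 0) (0, 0) 2 (strict w vs) h /\
  length vs = length V /\ (2 <= length h)%nat.
Proof.
pose proof PI_RGT_0 as Hpi.
assert (HC : 0 < C) by (apply cos_gt_0; lra).
assert (HH : 0 < H) by (apply sin_gt_0; lra).
assert (HCH : H * H + C * C = 1) by apply sc1.
assert (Hcw : cos w = C * C - H * H).
{ replace w with (w / 2 + w / 2) by field. rewrite cos_plus. reflexivity. }
assert (Hsw : sin w = 2 * H * C).
{ replace w with (w / 2 + w / 2) by field. rewrite sin_plus. fold C H. ring. }
destruct (first_probe w S Hw Hcorrect V HV) as [a [d [ES Hd]]].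
assert (HDD := dot_pos d Hd).
assert (Hplay : forall vs r, strict w vs a d r ->
  play S (0, 0) (0, 0) 2 (strict w vs) [((a, d), r)]).
{ intros vs r Hr. apply (play_snoc S (0, 0) (0, 0) 2 (strict w vs) []); try assumption.
  apply play_nil. }
destruct (Req_dec (cross d a) 0) as [H0|H0].
- set (n := sqrt (dot d d)). assert (Hn : 0 < n) by (apply sqrt_lt_R0; exact HDD).
  assert (Hnn : n * n = dot d d) by (apply sqrt_sqrt; lra).
  set (g := pscale (/ n) d).
  assert (Hg1 : dot g g = 1).
  { transitivity (dot d d / (n * n)); [unfold g; unpg; field; lra|].
    rewrite Hnn. field. lra. }
  (* The cotangent of [w / 2]: at this distance on the axis the segment from [bot] to [top] is seen
     under the angle [w]. *)
  set (k := C / H). assert (Hk : 0 < k) by (apply Rdiv_lt_0_compat; assumption).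
  assert (HkH : k * H = C) by (unfold k; field; lra).
  set (q := pscale (- k) g). set (u := cmul g (C, - H)).
  assert (Hq : q = cmul g (- k, 0)).
  { apply pt_eq; unfold q, cmul, pscale; simpl; ring. }
  assert (Hru : rot w u = cmul g (C, H)).
  { unfold u. rewrite cmul_rot. f_equal. apply pt_eq; unfold rot; simpl; rewrite Hcw, Hsw.
    - transitivity (C * (H * H + C * C)); [ring|rewrite HCH; ring].
    - transitivity (H * (H * H + C * C)); [ring|rewrite HCH; ring]. }
  set (r := Hit q u (cmul g bot) (cmul g top)).
  assert (Hgood : good w 2 (map (cmul g) V)).
  { apply (cmul_good w 2); try assumption; [lra|lra|]. apply HV. }
  assert (Hst : strict w (map (cmul g) V) a d r).
  { simpl. split; [|split; [|split; [|split]]].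
    - apply dot1_norm. unfold u. rewrite cmul_dot, Hg1.
      transitivity (H * H + C * C); [unpg; ring|exact HCH].
    - destruct (collinear_on_line d a a (0, 0) HDD) as [mu Emu]; [unpg; ring| |].
      { replace (cross d (psub (0, 0) a)) with (- cross d a) by (unpg; ring). lra. }
      exists (mu - k / n). assert (E1 := f_equal fst Emu). assert (E2 := f_equal snd Emu).
      unfold padd, pscale in E1, E2. simpl in E1, E2.
      apply pt_eq; unfold q, g, padd, pscale; simpl.
      + transitivity (- k / n * fst d + (fst a + mu * fst d)); [rewrite <- E1; field; lra|field; lra].
      + transitivity (- k / n * snd d + (snd a + mu * snd d)); [rewrite <- E2; field; lra|field; lra].
    - split; [apply in_map, Ibot|]. split.
      + exists (/ H). split; [apply Rlt_le, Rinv_0_lt_compat, HH|].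
        rewrite Hq. unfold u, bot, k. apply pt_eq; unfold cmul, padd, pscale; simpl; field; lra.
      + intros v Hv Hne. apply in_map_iff in Hv as [v' [<- Hv']].
        rewrite Hq, cmul_sub. unfold u. rewrite cmul_cross, Hg1.
        replace (cross _ _) with (C * snd v' + H * fst v' + k * H) by (unpg; ring).
        rewrite HkH, Rmult_1_l. apply Hbot; [exact Hv'|]. intros e. apply Hne. congruence.
    - split; [apply in_map, Itop|]. rewrite Hru. split.
      + exists (/ H). split; [apply Rlt_le, Rinv_0_lt_compat, HH|].
        rewrite Hq. unfold top, k. apply pt_eq; unfold cmul, padd, pscale; simpl; field; lra.
      + intros v Hv Hne. apply in_map_iff in Hv as [v' [<- Hv']].
        rewrite Hq, cmul_sub. rewrite cmul_cross, Hg1.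
        replace (cross _ _) with (H * fst v' - C * snd v' + k * H) by (unpg; ring).
        rewrite HkH, Rmult_1_l. apply Htop; [exact Hv'|]. intros e. apply Hne. congruence.
    - exists (k / n). split; [apply Rlt_le, Rdiv_lt_0_compat; assumption|].
      replace (padd q _) with ((0, 0) : pt); [apply Hgood|].
      apply pt_eq; unfold q, g, padd, pscale; simpl; field; lra. }
  destruct (move_step w S Hw Hcorrect (map (cmul g) V) ((a, d), r) Hgood (Hplay _ _ Hst))
    as [vs [h [G1 [G2 [G3 G4]]]]].
  + intros x y E. apply NNPP. intros Hn'. apply not_or_and in Hn' as [N1 N2].
    apply NNPP in N1, N2. simpl in N1, N2.
    assert (Hne : x <> y) by apply E.
    destruct N1 as [<-|[<-|[]]], N2 as [<-|[<-|[]]]; try congruence;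
    apply cmul_edge in E; try (apply (Hbt E)); try (apply (Htb E)); lra.
  + exists vs, h. rewrite length_map in G3. auto.
(* A line off the origin misses every sufficiently small copy of the polygon; the sign of
   [cross d a] tells on which side. *)
- assert (Hsmall : exists e r, 0 < e <= 1 /\
    strict w (map (cmul (e, 0)) V) a d r /\ r = Miss).
  { destruct (Rdichotomy _ _ H0) as [Hneg|Hpos].
    - assert (K : ev (fun t => forall v, In v V -> 0 < - cross d a - t * - cross d v)).
      { apply ev_in. intros v _. apply ev_lin. lra. }
      assert (K1 : ev (fun t => t <= 1)) by (exists 1; split; [lra|intros; lra]).
      destruct (ev_ex _ (ev_and _ _ K K1)) as [e [He [Ke Ke1]]].
      exists e, Miss. split; [lra|]. split; [|reflexivity]. left. intros v Hv.
      apply in_map_iff in Hv as [v' [<- Hv']]. specialize (Ke v' Hv').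
      replace (cross d _) with (- cross d a - e * - cross d v')
        by (unfold cmul; unpg; ring). exact Ke.
    - assert (K : ev (fun t => forall v, In v V -> 0 < cross d a - t * cross d v)).
      { apply ev_in. intros v _. apply ev_lin. lra. }
      assert (K1 : ev (fun t => t <= 1)) by (exists 1; split; [lra|intros; lra]).
      destruct (ev_ex _ (ev_and _ _ K K1)) as [e [He [Ke Ke1]]].
      exists e, Miss. split; [lra|]. split; [|reflexivity]. right. intros v Hv.
      apply in_map_iff in Hv as [v' [<- Hv']]. specialize (Ke v' Hv').
      replace (cross (psub _ a) d) with (cross d a - e * cross d v')
        by (unfold cmul; unpg; ring). exact Ke. }
  destruct Hsmall as [e [r [He [Hst Er]]]].
  assert (Hgood : good w 2 (map (cmul (e, 0)) V)).
  { apply (cmul_good w 2); try assumption; try (unpg; nra). apply HV. }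
  destruct (move_step w S Hw Hcorrect _ ((a, d), r) Hgood (Hplay _ _ Hst))
    as [vs [h [G1 [G2 [G3 G4]]]]].
  + intros x y _. left. rewrite Er. intros [].
  + exists vs, h. rewrite length_map in G3. auto.
Qed.

End Start.

(* A probe along the first axis touches them at the non-adjacent vertices [(0, -1)]
   and [(0, 1)], so every edge keeps an endpoint free to move. For
   [w = PI / 2] a quadrilateral cannot have all angles larger than [w]. *)
Definition square : list pt := [(0, -1); (1, 0); (0, 1); (-1, 0)].
Definition pentagon : list pt := [(0, -1); (1, -1/2); (1, 1/2); (0, 1); (-4/5, 0)].

(** The [n - length V] additional vertices bring at least as many non-flush probes, on top of the
    two initial ones; the [n] edges then require [n] flush probes. *)
Lemma adversary_bound (w : R) (S : strategy) (V : list pt) (n : nat) :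
  0 < w <= PI / 2 -> correct w S -> good w 2 V ->
  (exists vs h, good w 2 vs /\ play S (0, 0) (0, 0) 2 (strict w vs) h /\
     length vs = length V /\ (2 <= length h)%nat) ->
  (length V <= n)%nat ->
  exists (vs : list pt) (p c : pt) (rho : R),
     convex_polygon vs /\ length vs = n /\ angles_gt w vs /\
     in_hull vs p /\ encloses c rho (in_hull vs) /\
     forall h P, run w S (in_hull vs) p c rho h P -> (2 * n + 2 - length V <= length h)%nat.
Proof.
intros Hw HS HV [vs0 [h0 [Hg0 [Hp0 [L0 L0']]]]] Hn.
destruct (add_steps w S Hw HS vs0 h0 (n - length V) Hg0 Hp0 L0')
  as [vs [h [Hg [Hp [L L']]]]].
exists vs, (0, 0), (0, 0), 2.
pose proof (good_length _ _ _ Hg) as Hl.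
split; [apply convex_polygon_ccw; [apply Hg|exact Hl|apply Hg]|].
split; [lia|].
split; [apply wide_angles_gt; [exact Hw|apply Hg|exact Hl|apply Hg|apply Hg]|].
split; [apply hull_iff, Hg|].
split; [apply (good_encloses w), Hg|].
intros H P HR.
assert (K := lower_bound w S Hw HS vs h H P Hg Hp HR).
unfold entry in *. lia.
Qed.

Lemma edge_intro (V : list pt) (x y : pt) :
  In x V -> In y V -> x <> y ->
  Forall (fun z => z = x \/ z = y \/ 0 < orient x y z) V -> edge V x y.
Proof.
intros Hx Hy Hne H. repeat split; try assumption. rewrite Forall_forall in H.
intros z Iz Zx Zy. destruct (H z Iz) as [E|[E|E]]; [contradiction|contradiction|exact E].
Qed.

Definition cycle (V : list pt) : list (pt * pt) :=
  combine V (tl V ++ [hd (0, 0) V]).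

Ltac concrete_edge :=
  apply edge_intro;
  [simpl; auto 10|simpl; auto 10|let e := fresh in intros e; injection e; intros; lra|
   repeat (apply Forall_cons || apply Forall_nil);
   first [left; reflexivity|right; left; reflexivity|
          right; right; unfold orient; unpg; lra]].

Lemma square_edge (x y : pt) : In (x, y) (cycle square) -> edge square x y.
Proof.
intros [E|[E|[E|[E|[]]]]]; injection E; intros <- <-; concrete_edge.
Qed.

Lemma pentagon_edge (x y : pt) : In (x, y) (cycle pentagon) -> edge pentagon x y.
Proof.
intros [E|[E|[E|[E|[E|[]]]]]]; injection E; intros <- <-; concrete_edge.
Qed.

Ltac concrete_nodup :=
  repeat constructor; simpl; intros K;
  repeat (destruct K as [K|K]; [injection K; intros; lra|]); destruct K.

(** The angles are right and edge directions differ by multiples of [PI / 2], so both conditions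
    hold because [w] is strictly between 0 and [PI / 2]. *)
Lemma square_good (w : R) : 0 < w < PI / 2 -> good w 2 square.
Proof.
intros Hw. pose proof PI_RGT_0 as Hpi.
assert (Hs : 0 < sin w) by (apply sin_gt_0; lra).
assert (Hc : 0 < cos w) by (apply cos_gt_0; lra).
destruct (edges_listed w square (cycle square)) as [H1 H2].
- apply square_edge.
- intros x [<-|[<-|[<-|[<-|[]]]]]; eexists; simpl; auto 10.
- intros p v v' n [E|[E|[E|[E|[]]]]] [F|[F|[F|[F|[]]]]]; injection E; injection F;
  intros <- <- <- <- K; try (exfalso; injection K; intros; lra);
  unfold turn; unpg; lra.
- intros p q p' q' [E|[E|[E|[E|[]]]]] [F|[F|[F|[F|[]]]]]; injection E; injection F;
  intros <- <- <- <-; unfold skew; unpg; lra.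
- constructor; try assumption.
  + concrete_nodup.
  + simpl. lia.
  + simpl. repeat constructor; unfold orient; unpg; lra.
  + intros v [<-|[<-|[<-|[<-|[]]]]]; unpg; lra.
  + replace (0, 0) with (mix (1 / 2) (0, -1) (0, 1)) by
      (apply pt_eq; unfold mix, padd, pscale; simpl; field).
    apply hull_mix; [apply hull_in; simpl; auto|apply hull_in; simpl; auto|lra].
Qed.

(** The angle at [(-4/5, 0)] is obtuse because [4/5 < 1], those at [(0, -1)] and [(0, 1)] because
    [4/5 > 1/2]. *)
Lemma pentagon_good : good (PI / 2) 2 pentagon.
Proof.
destruct (edges_listed (PI / 2) pentagon (cycle pentagon)) as [H1 H2].
- apply pentagon_edge.
- intros x [<-|[<-|[<-|[<-|[<-|[]]]]]]; eexists; simpl; auto 10.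
- intros p v v' n [E|[E|[E|[E|[E|[]]]]]] [F|[F|[F|[F|[F|[]]]]]]; injection E; injection F;
  intros <- <- <- <- K; try (exfalso; injection K; intros; lra);
  unfold turn; unpg; rewrite sin_PI2, cos_PI2; lra.
- intros p q p' q' [E|[E|[E|[E|[E|[]]]]]] [F|[F|[F|[F|[F|[]]]]]]; injection E; injection F;
  intros <- <- <- <-; unfold skew; unpg; rewrite sin_PI2, cos_PI2; lra.
- constructor; try assumption.
  + concrete_nodup.
  + simpl. lia.
  + simpl. repeat constructor; unfold orient; unpg; lra.
  + intros v [<-|[<-|[<-|[<-|[<-|[]]]]]]; unpg; lra.
  + replace (0, 0) with (mix (1 / 2) (0, -1) (0, 1)) by
      (apply pt_eq; unfold mix, padd, pscale; simpl; field).
    apply hull_mix; [apply hull_in; simpl; auto|apply hull_in; simpl; auto 10|lra].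
Qed.

Lemma edge_excluded (V : list pt) (x y z : pt) :
  In z V -> z <> x -> z <> y -> orient x y z < 0 -> ~ edge V x y.
Proof. intros Hz Hx Hy H [_ [_ [_ K]]]. specialize (K z Hz Hx Hy). lra. Qed.

Theorem theorem4p5 :
  (forall (w : R), 0 < w < PI / 2 ->
   forall (S : strategy), correct w S ->
   forall (n : nat), (5 <= n)%nat ->
   exists (vs : list pt) (p c : pt) (rho : R),
     convex_polygon vs /\ length vs = n /\ angles_gt w vs /\
     in_hull vs p /\ encloses c rho (in_hull vs) /\
     forall h P, run w S (in_hull vs) p c rho h P -> (2 * n - 2 <= length h)%nat)
  /\
  (forall (S : strategy), correct (PI / 2) S ->
   forall (n : nat), (5 <= n)%nat ->
   exists (vs : list pt) (p c : pt) (rho : R),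
     convex_polygon vs /\ length vs = n /\ angles_gt (PI / 2) vs /\
     in_hull vs p /\ encloses c rho (in_hull vs) /\
     forall h P, run (PI / 2) S (in_hull vs) p c rho h P -> (2 * n - 3 <= length h)%nat).
Proof.
pose proof PI_RGT_0 as Hpi. split.
- intros w Hw S HS n Hn. assert (Hw' : 0 < w <= PI / 2) by lra.
  assert (HV := square_good w Hw).
  assert (HC : 0 < cos (w / 2)) by (apply cos_gt_0; lra).
  assert (HH : 0 < sin (w / 2)) by (apply sin_gt_0; lra).
  (* This keeps the vertex [(-1, 0)] strictly inside the wedge of the first probe. *)
  assert (HCH : 0 < cos (w / 2) - sin (w / 2)).
  { assert (Hc : 0 < cos w) by (apply cos_gt_0; lra).
    replace w with (w / 2 + w / 2) in Hc by field. rewrite cos_plus in Hc. nra. }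
  destruct (adversary_bound w S square n Hw' HS HV) as [vs [p [c [rho H]]]].
  + apply (start w S square Hw' HS HV); try (simpl; auto 10; fail).
    * apply (edge_excluded _ _ _ (1, 0)); [simpl; auto| | |unfold orient; unpg; lra];
        intros E; injection E; intros; lra.
    * apply (edge_excluded _ _ _ (-1, 0)); [simpl; auto| | |unfold orient; unpg; lra];
        intros E; injection E; intros; lra.
    * intros v [<-|[<-|[<-|[<-|[]]]]] Hne; simpl; try lra. congruence.
    * intros v [<-|[<-|[<-|[<-|[]]]]] Hne; simpl; try lra. congruence.
  + simpl. lia.
  + exists vs, p, c, rho. simpl length in H.
    replace (2 * n - 2)%nat with (2 * n + 2 - 4)%nat by lia. exact H.
- intros S HS n Hn. assert (Hw' : 0 < PI / 2 <= PI / 2) by lra.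
  (* Before rotation the first apex is now [(-1, 0)], and the abscissa [-4/5] keeps the leftmost
     vertex strictly inside the wedge. *)
  assert (HH : sin (PI / 2 / 2) = cos (PI / 2 / 2)).
  { replace (PI / 2 / 2) with (PI / 4) by field. rewrite sin_PI4, cos_PI4. reflexivity. }
  assert (HC : 0 < cos (PI / 2 / 2)) by (apply cos_gt_0; lra).
  destruct (adversary_bound (PI / 2) S pentagon n Hw' HS pentagon_good) as [vs [p [c [rho H]]]].
  + apply (start (PI / 2) S pentagon Hw' HS pentagon_good); try (simpl; auto 10; fail).
    * apply (edge_excluded _ _ _ (1, 1/2)); [simpl; auto| | |unfold orient; unpg; lra];
        intros E; injection E; intros; lra.
    * apply (edge_excluded _ _ _ (-4/5, 0)); [simpl; auto 10| | |unfold orient; unpg; lra];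
        intros E; injection E; intros; lra.
    * intros v [<-|[<-|[<-|[<-|[<-|[]]]]]] Hne; simpl; rewrite ?HH; try lra. congruence.
    * intros v [<-|[<-|[<-|[<-|[<-|[]]]]]] Hne; simpl; rewrite ?HH; try lra. congruence.
  + simpl. lia.
  + exists vs, p, c, rho. simpl length in H.
    replace (2 * n - 3)%nat with (2 * n + 2 - 5)%nat by lia. exact H.
Qed.
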